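(* Let $\mathscr{AP}$ be the ascending FG process with parameters $\mathbf x,\mathbf r,\mathbf w,\boldsymbol\theta,\mathbf y,\mathbf s$ (see context), and let $\mathcal S^{(T)}\subset\{1,\ldots,T\}\times\mathbb Z_{\ge1}$ be the associated random point configuration. Then $\mathcal S^{(T)}$ is determinantal: for any finite set $A=\{(t_1,a_1),\ldots,(t_m,a_m)\}\subset\{1,\ldots,T\}\times\mathbb Z_{\ge1}$, $$\mathbb P_{\mathscr{AP}}\bigl[A\subset\mathcal S^{(T)}\bigr]=\det\left[K_{\mathscr{AP}}(t_i,a_i;t_j,a_j)\right]_{i,j=1}^m,$$ where, for $1\le t,t'\le T$ and $a,a'\ge1$, $$\begin{aligned}K_{\mathscr{AP}}(t,a;t',a')=\frac1{(2\pi\mathbf i)^2}&\oint_{\Gamma_{y,\theta^{-2}w}}du\oint_{\Gamma_{y,w}}dv\,\frac1{u-v}\prod_{k=1}^N\frac{(u-y_k)(v-x_k)}{(u-x_k)(v-y_k)}\,\frac{y_a(1-s_a^{-2})}{v-s_a^{-2}y_a}\,\frac1{u-y_{a'}}\\&\times\prod_{j=1}^{a-1}\frac{v-y_j}{v-s_j^{-2}y_j}\prod_{j=1}^{a'-1}\frac{u-s_j^{-2}y_j}{u-y_j}\prod_{d=1}^t\frac{v-\theta_d^{-2}w_d}{v-w_d}\prod_{c=1}^{t'}\frac{u-w_c}{u-\theta_c^{-2}w_c}.\end{aligned}$$ The integration contours are positively oriented circles one inside the other (the $u$ contour is outside for $t\le t'$, the $v$ contour is outside for $t>t'$); the $u$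 contour encircles all the points $y_i,\theta_j^{-2}w_j$ and none of the $x_k$; the $v$ contour encircles all the points $y_i,w_j$ and none of the $s_k^{-2}y_k$. The parameters are assumed to be such that these contours exist.
   Context: Signatures. A signature with $N$ parts is an integer sequence $\lambda=(\lambda_1\ge\ldots\ge\lambda_N\ge0)$; $\mathcal S(\lambda)=\{\lambda_j+N+1-j:1\le j\le N\}\subset\mathbb Z_{\ge1}$; $0^N=(0,\ldots,0)$. Vertex weights. For $i_1,j_1,i_2,j_2\in\{0,1\}$ (numbers of paths entering from the bottom, entering from the left, exiting at the top, exiting to the right) put $W(\cdot)=W(\cdot\mid x;y;r;s)$ with $W(0,0;0,0)=1$, $W(1,1;1,1)=\frac{r^{-2}x-y}{s^{-2}y-x}$, $W(1,0;1,0)=\frac{s^{-2}y-r^{-2}x}{s^{-2}y-x}$, $W(0,1;0,1)=\frac{y-x}{s^{-2}y-x}$, $W(1,0;0,1)=\frac{x(r^{-2}-1)}{s^{-2}y-x}$, $W(0,1;1,0)=\frac{y(s^{-2}-1)}{s^{-2}y-x}$, and $W=0$ otherwise. Put $\widehat W=W/W(0,1;0,1)$. Partition functions. A configuration on $\mathbb Z_{\ge1}\times\{1,\ldots,k\}$ consists of vertical edge states $v(i,j)\in\{0,1\}$ ($i\ge1$, $0\le j\le k$; $v(i,j-1)$ below and $v(i,j)$ above the vertex $(i,j)$) and horizontal edge states $h(i,j)\in\{0,1\}$ ($i\ge0$, $1\le j\le k$; $h(i-1,j)$ to the left and $h(i,j)$ to the right of $(i,j)$). For $\lambda,\mu$ with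 the same number of parts, $G_{\lambda/\mu}(x_1,\ldots,x_k;\mathbf y;r_1,\ldots,r_k;\mathbf s)$ is the sum over configurations with $v(i,0)=\mathbf 1_{i\in\mathcal S(\mu)}$, $v(i,k)=\mathbf 1_{i\in\mathcal S(\lambda)}$, $h(0,j)=0$, $h(i,j)=0$ for all large $i$, of $\prod_{i,j}W(v(i,j-1),h(i-1,j);v(i,j),h(i,j)\mid x_j;y_i;r_j;s_i)$; $G_\lambda=G_{\lambda/0^N}$ for $\lambda$ with $N$ parts. For $\lambda$ with $k$ parts, $F_\lambda(x_1,\ldots,x_k;\mathbf y;r_1,\ldots,r_k;\mathbf s)$ is the sum over configurations with $v(i,0)=\mathbf 1_{i\in\mathcal S(\lambda)}$, $v(i,k)=0$, $h(0,j)=0$, $h(i,j)=1$ for all large $i$, of the same product with $\widehat W$ in place of $W$. Both sums have finitely many nonzero terms, each with all but finitely many factors equal to $1$. Ascending FG process. Let $N,T\ge1$, and let $\mathbf x=(x_1,\ldots,x_N)$, $\mathbf r=(r_1,\ldots,r_N)$, $\mathbf w=(w_1,\ldots,w_T)$, $\boldsymbol\theta=(\theta_1,\ldots,\theta_T)$, $\mathbf y=(y_1,y_2,\ldots)$, $\mathbf s=(s_1,s_2,\ldots)$ be real parameters with $\sup_{p\ge1}\left|\frac{s_p^{-2}y_p-x_i}{y_p-x_i}\frac{y_p-w_j}{s_p^{-2}y_p-w_j}\right|<1$ for all $i,j$, and $x_i<y_j<r_i^{-2}x_i<s_j^{-2}y_j$, $w_i<y_j<\theta_i^{-2}w_i<s_j^{-2}y_j$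 for all $i,j$ (these conditions make all vertex weights nonnegative and the normalizing series convergent). The ascending FG process is the probability measure on sequences $(\lambda^{(1)},\ldots,\lambda^{(T)})$ of signatures with $N$ parts each, $$\mathscr{AP}(\lambda^{(1)},\ldots,\lambda^{(T)})=\frac1Z\,G_{\lambda^{(1)}}(w_1;\mathbf y;\theta_1;\mathbf s)\,G_{\lambda^{(2)}/\lambda^{(1)}}(w_2;\mathbf y;\theta_2;\mathbf s)\cdots G_{\lambda^{(T)}/\lambda^{(T-1)}}(w_T;\mathbf y;\theta_T;\mathbf s)\,F_{\lambda^{(T)}}(\mathbf x;\mathbf y;\mathbf r;\mathbf s),$$ $$Z=\frac{\prod_{1\le i\le j\le N}(r_i^{-2}x_i-x_j)\prod_{1\le i<j\le N}(s_i^{-2}y_i-y_j)}{\prod_{i,j=1}^N(y_i-x_j)}\prod_{i=1}^N\prod_{j=1}^T\frac{x_i-\theta_j^{-2}w_j}{x_i-w_j}.$$ The associated random point configuration is $\mathcal S^{(T)}=\bigcup_{t=1}^T\{t\}\times\mathcal S(\lambda^{(t)})$. *)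

(* Defs.v *)
From HB Require Import structures.
From mathcomp Require Import all_boot all_order all_algebra.
From mathcomp Require Import all_classical all_reals all_analysis.
From mathcomp Require Import complex.
Set Implicit Arguments.
Unset Strict Implicit.
Unset Printing Implicit Defensive.
Import Order.TTheory GRing.Theory Num.Theory.
Import numFieldNormedType.Exports.

Local Open Scope classical_set_scope.
Local Open Scope ring_scope.
Local Open Scope complex_scope.

(* Indexing. The column sequences y and s are functions on nat used at the
   arguments 1, 2, ... only; positions a and the elements of S(lambda) are
   positive integers. Finite families (x_1, ..., x_N), (w_1, ..., w_T), the
   parts of a signature and the times 1, ..., T are indexed by ordinals, so
   that i : 'I_n stands for the index i + 1. *)

Definition signature (N : nat) := {l : N.-tuple nat | sorted geq l}.

Lemma sorted_geq_nseq0 (N : nat) : sorted geq (nseq_tuple N 0%N).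
Proof. by case: N => //; elim=> //= n ->. Qed.

Definition sig0 (N : nat) : signature N :=
  exist (fun l : N.-tuple nat => sorted geq l) _ (sorted_geq_nseq0 N).

(* With j counted from 0, the element lambda_j + N + 1 - j of the usual
   notation becomes lambda_j + (N - j). *)
Definition sigS (N : nat) (lam : signature N) : seq nat :=
  [seq (tnth (val lam) j + (N - j))%N | j : 'I_N].

Section Weights.
Context {R : realType}.

(* The Boolean arguments are the numbers of paths entering from the bottom,
   entering from the left, exiting at the top and exiting to the right. *)
Definition vertexW (x y r s : R) (i1 j1 i2 j2 : bool) : R :=
  match i1, j1, i2, j2 with
  | false, false, false, false => 1
  | true, true, true, true => (r ^- 2 * x - y) / (s ^- 2 * y - x)
  | true, false, true, false => (s ^- 2 * y - r ^- 2 * x) / (s ^- 2 * y - x)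
  | false, true, false, true => (y - x) / (s ^- 2 * y - x)
  | true, false, false, true => x * (r ^- 2 - 1) / (s ^- 2 * y - x)
  | false, true, true, false => y * (s ^- 2 - 1) / (s ^- 2 * y - x)
  | _, _, _, _ => 0
  end.

Definition vertexWhat (x y r s : R) (i1 j1 i2 j2 : bool) : R :=
  vertexW x y r s i1 j1 i2 j2 / vertexW x y r s false true false true.

(* A configuration with k rows. [vert c i j] is the vertical edge of column
   i + 1 at height j, for 0 <= j <= k; [horiz c i j] is the horizontal edge
   between columns i and i + 1 (column 0 being the left boundary) in row
   j + 1. *)
Definition config (k : nat) : Type :=
  ((nat -> 'I_k.+1 -> bool) * (nat -> 'I_k -> bool))%type.
Definition vert (k : nat) (c : config k) := c.1.
Definition horiz (k : nat) (c : config k) := c.2.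

Definition config_bnd (k : nat) (bot top : pred nat) (out : bool)
    (c : config k) : Prop :=
  [/\ forall i, vert c i ord0 = bot i.+1,
      forall i, vert c i ord_max = top i.+1,
      forall j, horiz c 0%N j = false &
      \forall i \near \oo, forall j, horiz c i j = out].

(* The product over columns is the limit of its partial products. These are
   eventually constant when all but finitely many factors are 1, and eventually
   0 when some factor vanishes. *)
Definition config_weight (k : nat)
    (V : R -> R -> R -> R -> bool -> bool -> bool -> bool -> R)
    (x : 'I_k -> R) (y : nat -> R) (r : 'I_k -> R) (s : nat -> R)
    (c : config k) : R :=
  \big[*%R/1]_(0 <= i <oo) \prod_(j < k)
    V (x j) (y i.+1) (r j) (s i.+1)
      (vert c i (widen_ord (leqnSn k) j)) (horiz c i j)
      (vert c i (lift ord0 j)) (horiz c i.+1 j).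

Definition FG_G (N k : nat) (lam mu : signature N)
    (x : 'I_k -> R) (y : nat -> R) (r : 'I_k -> R) (s : nat -> R) : R :=
  \sum_(c \in [set c : config k |
      config_bnd (mem (sigS mu)) (mem (sigS lam)) false c])
    config_weight vertexW x y r s c.

Definition FG_F (k : nat) (lam : signature k)
    (x : 'I_k -> R) (y : nat -> R) (r : 'I_k -> R) (s : nat -> R) : R :=
  \sum_(c \in [set c : config k |
      config_bnd (mem (sigS lam)) pred0 true c])
    config_weight vertexWhat x y r s c.

Definition ascFG_Z (N T : nat) (x r : 'I_N -> R) (w theta : 'I_T -> R)
    (y s : nat -> R) : R :=
  ((\prod_(i < N) \prod_(j < N | (i <= j)%N) (r i ^- 2 * x i - x j)) *
   (\prod_(i < N) \prod_(j < N | (i < j)%N)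
      (s i.+1 ^- 2 * y i.+1 - y j.+1))) /
  (\prod_(i < N) \prod_(j < N) (y i.+1 - x j)) *
  \prod_(i < N) \prod_(j < T) ((x i - theta j ^- 2 * w j) / (x i - w j)).

(* In the product, [nth _ (_ :: lam) t] is the signature preceding
   [tnth lam t], with lambda^(0) = 0^N. *)
Definition ascFG (N T : nat) (x r : 'I_N -> R) (w theta : 'I_T -> R)
    (y s : nat -> R) (lam : T.-tuple (signature N)) : R :=
  (ascFG_Z x r w theta y s)^-1 *
  (\prod_(t < T)
     FG_G (tnth lam t) (nth (sig0 N) (sig0 N :: lam) t)
       (fun _ : 'I_1 => w t) y (fun _ : 'I_1 => theta t) s) *
  FG_F (last (sig0 N) lam) x y r s.

(* The measure of an event is the sum of its (nonnegative) point masses. *)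
Definition ascFG_prob (N T : nat) (x r : 'I_N -> R) (w theta : 'I_T -> R)
    (y s : nat -> R) (E : set (T.-tuple (signature N))) : \bar R :=
  \esum_(lam in E) (ascFG x r w theta y s lam)%:E.

Definition ascFG_points (N T : nat) (lam : T.-tuple (signature N)) :
    set ('I_T * nat) :=
  [set p | p.2 \in sigS (tnth lam p.1)].

End Weights.

Section Kernel.
Context {R : realType}.

Record circle := Circle { ccenter : R[i]; cradius : R }.

Definition encircles (C : circle) (z : R[i]) : Prop :=
  `|z - ccenter C| < (cradius C)%:C.

Definition leaves_out (C : circle) (z : R[i]) : Prop :=
  (cradius C)%:C < `|z - ccenter C|.

Definition circle_inside (C D : circle) : Prop :=
  `|ccenter C - ccenter D| + (cradius C)%:C < (cradius D)%:C.

Definition complex_integral (a b : R) (f : R -> R[i]) : R[i] :=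
  (\int[lebesgue_measure]_(tau in `[a, b]) complex.Re (f tau))%R +i*
  (\int[lebesgue_measure]_(tau in `[a, b]) complex.Im (f tau))%R.

(* The positively oriented circle is z = c + rho e^(i tau), 0 <= tau <= 2 pi. *)
Definition circle_integral (C : circle) (f : R[i] -> R[i]) : R[i] :=
  complex_integral 0 (2 * pi) (fun tau =>
    let e := (cradius C)%:C * (cos tau +i* sin tau) in
    f (ccenter C + e) * ('i%C * e)).

(* [Cu] and [Cv] are the contours of u and v for the pair of times t, t'. *)
Definition ascFG_contours (N T : nat) (x : 'I_N -> R) (w theta : 'I_T -> R)
    (y s : nat -> R) (t t' : 'I_T) (Cu Cv : circle) : Prop :=
  [/\ forall p, (1 <= p)%N -> encircles Cu (y p)%:C,
      forall j, encircles Cu (theta j ^- 2 * w j)%:C &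
      forall k, leaves_out Cu (x k)%:C] /\
  [/\ forall p, (1 <= p)%N -> encircles Cv (y p)%:C,
      forall j, encircles Cv (w j)%:C &
      forall p, (1 <= p)%N -> leaves_out Cv (s p ^- 2 * y p)%:C] /\
  (if (t <= t')%N then circle_inside Cv Cu else circle_inside Cu Cv).

Definition ascFG_integrand (N T : nat) (x : 'I_N -> R) (w theta : 'I_T -> R)
    (y s : nat -> R) (t : 'I_T) (a : nat) (t' : 'I_T) (a' : nat)
    (u v : R[i]) : R[i] :=
  (u - v)^-1 *
  (\prod_(k < N) (((u - (y k.+1)%:C) * (v - (x k)%:C)) /
                  ((u - (x k)%:C) * (v - (y k.+1)%:C)))) *
  ((y a * (1 - s a ^- 2))%:C / (v - (s a ^- 2 * y a)%:C)) *
  (u - (y a')%:C)^-1 *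
  (\prod_(1 <= j < a) ((v - (y j)%:C) / (v - (s j ^- 2 * y j)%:C))) *
  (\prod_(1 <= j < a') ((u - (s j ^- 2 * y j)%:C) / (u - (y j)%:C))) *
  (\prod_(d < T | (d <= t)%N)
     ((v - (theta d ^- 2 * w d)%:C) / (v - (w d)%:C))) *
  (\prod_(c < T | (c <= t')%N)
     ((u - (w c)%:C) / (u - (theta c ^- 2 * w c)%:C))).

Definition ascFG_kernel (N T : nat) (x : 'I_N -> R) (w theta : 'I_T -> R)
    (y s : nat -> R) (Cu Cv : circle)
    (t : 'I_T) (a : nat) (t' : 'I_T) (a' : nat) : R[i] :=
  ((2 * pi)%:C * 'i%C) ^- 2 *
  circle_integral Cu (fun u => circle_integral Cv (fun v =>
    ascFG_integrand x w theta y s t a t' a' u v)).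

End Kernel.
Arguments circle R : clear implicits.

(* Main.v *)
(** Write [S_p = s_p^-2 y_p], [om_t = theta_t^-2 w_t] and
    [phi_a(z) = prod_(j<a) (z - S_j) / prod_(j<=a) (z - y_j)].

    The vertex weights are free-fermionic, so the operator adding a row of
    vertices acts on determinants through each of their rows separately
    ([row_wedge]). Summed over all signatures, the row with parameters
    [(w, om)] multiplies [phi_a] by [(z - om) / (z - w)]: the remainder at [M]
    columns is a multiple of [prod_(p<=M) (z - S_p) (y_p - w) / ((z - y_p) (S_p - w))],
    which tends to 0 at the points [x_k] by the hypothesis on the supremum.
    Hence [F_lambda] is a constant times the determinant of divided differences
    of the [phi_l], [l] in [S(lambda)], at the points [x_k]. Divided differences
    are taken as first rows of functions of a bidiagonal matrix, which allows
    coinciding [x_k].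

    To insert the event that the configuration contains given points [(t_k, a_k)],
    border this determinant: append to the vector of [phi_a] the [n]-row
    transition weights from [a] to [a_k], and one additional row for each
    point. Summing row by row, the probability is the quotient of two such
    determinants at time 0, and a Schur complement turns it into an [m x m]
    determinant. Its entries are the double contour integrals, up to
    transposition: the transition weights are single contour integrals, and the
    inverse matrix in the Schur complement is absorbed by partial fractions of
    the [u]-integrand modulo [prod_k (u - x_k)].

    Contour integrals are only needed for rational functions, and follow from
    the moments of the integrand against powers of [z - c] on the circle. *)
Require Import Defs.
From HB Require Import structures.
From mathcomp Require Import all_boot all_order all_algebra.
From mathcomp Require Import all_classical all_reals all_analysis.
From mathcomp Require Import complex.
From mathcomp Require Import zify ring lra.
Set Implicit Arguments.
Unset Strict Implicit.
Unset Printing Implicit Defensive.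
Import Order.TTheory GRing.Theory Num.Theory.
Import numFieldNormedType.Exports.
Local Open Scope ring_scope.

(** * Free-fermionic rows of vertices *)

(** Coinciding nodes decide the form of the estimates: the remainder at [M] columns cannot be
    bounded node by node, because a higher divided difference is not a value of the function. Its
    coordinates obey a recursion in [M] along the bidiagonal matrix, each a contraction driven by
    the preceding coordinate.

    The indicator of a set of occupied points does not act on a determinant row by row; the borders
    are there to make it do so. Subtracting a unit mark from the particle that sits at a point, and
    replacing the unit row of the point by the row of that particle, has determinant 1; if the point
    is missed, a column vanishes. Going back to time 0, the marks are transported like all other
    coordinates and become transition weights.

    Infinite sums are unordered sums of nonnegative terms, while bordered determinants have no
    visible sign: their positivity is carried backwards in time from that of F. The limits use
    [x_k < w_j], which the bound on the supremum forces. *)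

Section RowTransfer.
Variables (F : fieldType).

Fixpoint sum_bits (n : nat) (f : seq bool -> F) : F :=
  if n is n'.+1 then
    sum_bits n' (fun b => f (false :: b)) + sum_bits n' (fun b => f (true :: b))
  else f [::].

Lemma eq_sum_bits n f g :
  (forall b, size b = n -> f b = g b) -> sum_bits n f = sum_bits n g.
Proof.
elim: n f g => [|n IH] f g fg /=; first exact: fg.
by congr (_ + _); apply: IH => b bn; apply: fg; rewrite /= bn.
Qed.

Lemma sum_bitsD n f g :
  sum_bits n (fun b => f b + g b) = sum_bits n f + sum_bits n g.
Proof. by elim: n f g => [|n IH] f g //=; rewrite !IH addrACA. Qed.

Lemma sum_bitsZ n c f : sum_bits n (fun b => c * f b) = c * sum_bits n f.
Proof. by elim: n f => [|n IH] f //=; rewrite !IH mulrDr. Qed.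

Lemma sum_bitsE n f : sum_bits n f = \sum_(b : n.-tuple bool) f b.
Proof.
elim: n f => [|n IH] f /=.
  by rewrite (big_pred1 [tuple]) // => b; apply/esym/eqP/val_inj; case: b => -[].
rewrite !IH.
pose h (p : bool * n.-tuple bool) : n.+1.-tuple bool := [tuple of p.1 :: p.2].
rewrite (reindex h) /=; last first.
  exists (fun b : n.+1.-tuple bool => (thead b, [tuple of behead b])).
    by move=> [b1 b2] _; congr pair; apply/val_inj.
  by move=> b _; rewrite [in RHS](tuple_eta b).
rewrite -(pair_bigA _ (fun (p1 : bool) p2 => f (p1 :: tval p2))) /=.
by rewrite big_bool addrC.
Qed.

Fixpoint true_pos (i : nat) (b : seq bool) : seq nat :=
  if b is x :: b' then
    if x then i :: true_pos i.+1 b' else true_pos i.+1 b'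
  else [::].

Variable W : nat -> bool -> bool -> bool -> bool -> F.

(* [h] and [out] are the horizontal edges at the left and right ends of the row. *)
Fixpoint row_weight (i : nat) (h : bool) (bot top : seq bool) (out : bool) : F :=
  match bot, top with
  | [::], [::] => (h == out)%:R
  | b :: bot', t :: top' =>
      W i b h t false * row_weight i.+1 false bot' top' out +
      W i b h t true * row_weight i.+1 true bot' top' out
  | _, _ => 0
  end.

End RowTransfer.

(** The weight of the full vertex is the one that the free-fermion relation forces when the empty
    vertex has weight 1. It is a 2 by 2 minor of the coefficients with which the two incoming paths
    split. *)
Definition ff_weight (F : fieldType) (b1 b2 c1 c2 : nat -> F) (i : nat)
    (i1 j1 i2 j2 : bool) : F :=
  match i1, j1, i2, j2 with
  | false, false, false, false => 1
  | true, true, true, true => c1 i * c2 i - b1 i * b2 i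
  | true, false, true, false => b1 i
  | false, true, false, true => b2 i
  | true, false, false, true => c1 i
  | false, true, true, false => c2 i
  | _, _, _, _ => 0
  end.

Section Wedge.
Variables (F : fieldType) (n : nat).
Implicit Types (l s : seq 'rV[F]_n).

(** An alternating form on lists of any length, described through adjacent entries only: columns are
    read from left to right, so only neighbouring vectors ever meet. Determinants with fixed rows
    before and after the list are instances. *)
Definition wedge_like (D : seq 'rV[F]_n -> F) : Prop :=
  (forall s1 s2 a b u v, D (s1 ++ (a *: u + b *: v) :: s2) =
     a * D (s1 ++ u :: s2) + b * D (s1 ++ v :: s2)) /\
  (forall s1 s2 u, D (s1 ++ u :: u :: s2) = 0).

Lemma wedge_lin D (w : wedge_like D) s1 s2 a b u v :
  D (s1 ++ (a *: u + b *: v) :: s2) =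
     a * D (s1 ++ u :: s2) + b * D (s1 ++ v :: s2).
Proof. by case: w. Qed.

Lemma wedge_lin2 D (w : wedge_like D) s1 s2 a b x u v :
  D (s1 ++ x :: (a *: u + b *: v) :: s2) =
     a * D (s1 ++ x :: u :: s2) + b * D (s1 ++ x :: v :: s2).
Proof. by have := wedge_lin w (rcons s1 x) s2 a b u v; rewrite !cat_rcons. Qed.

Lemma wedge_swap D (w : wedge_like D) s1 s2 u v :
  D (s1 ++ v :: u :: s2) = - D (s1 ++ u :: v :: s2).
Proof.
have := w.2 s1 s2 (1 *: u + 1 *: v).
rewrite (wedge_lin w) !(wedge_lin2 w) !w.2 !mul1r addr0 add0r => /eqP.
by rewrite addrC addr_eq0 => /eqP.
Qed.

Lemma wedge_pair D (w : wedge_like D) s1 s2 (a b c d : F) u v :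
  D (s1 ++ (a *: u + b *: v) :: (c *: u + d *: v) :: s2) =
  (a * d - b * c) * D (s1 ++ u :: v :: s2).
Proof.
rewrite (wedge_lin w) !(wedge_lin2 w) !w.2.
rewrite (wedge_swap w s1 s2 u v); ring.
Qed.

Lemma wedge0 D (w : wedge_like D) s1 s2 : D (s1 ++ 0 :: s2) = 0.
Proof.
have := wedge_lin w s1 s2 0 0 0 0.
by rewrite !scale0r addr0 !mul0r addr0.
Qed.

Section RowWedge.
Variables (b1 b2 c1 c2 : nat -> F) (hh : nat -> 'rV[F]_n) (ev : 'rV[F]_n).

(** What a horizontal path entering column [i] becomes: at each column it turns up ([c2]) or passes
    ([b2]), and after crossing all [m] columns it contributes the exit vector [ev]. *)
Fixpoint path_vec (i m : nat) : 'rV[F]_n :=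
  if m is m'.+1 then c2 i *: hh i + b2 i *: path_vec i.+1 m' else ev.

Definition transfer_vec (e a : nat) : 'rV[F]_n :=
  b1 a *: hh a + c1 a *: path_vec a.+1 (e - a.+1).

(** Induction on the columns, with [P] collecting the vectors already emitted. A path in transit is
    stored as one more vector, placed before the images of the columns still to be read; each vertex
    then expands at most two adjacent vectors by multilinearity. *)
Lemma row_wedge D (w : wedge_like D) i h bot P Sf :
  let Z := row_weight (ff_weight b1 b2 c1 c2) in
  sum_bits (size bot) (fun top =>
     Z i h bot top false * D (P ++ map hh (true_pos i top) ++ Sf) +
     Z i h bot top true * D (P ++ map hh (true_pos i top) ++ ev :: Sf)) =
  D (P ++ (if h then [:: path_vec i (size bot)] else [::]) ++
     map (transfer_vec (i + size bot)) (true_pos i bot) ++ Sf).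
Proof.
move=> Z; elim: bot i h P => [|b bot IH] i h P.
  by rewrite /=; case: h; rewrite /= ?mul0r ?mul1r ?addr0 ?add0r.
have IH0 h' P' := IH i.+1 h' P'.
rewrite /= addnS -addSn.
have e x : sum_bits (size bot) (fun top =>
   Z i h (b :: bot) (x :: top) false * D (P ++ map hh (true_pos i (x :: top)) ++ Sf) +
   Z i h (b :: bot) (x :: top) true * D (P ++ map hh (true_pos i (x :: top)) ++ ev :: Sf)) =
  let P' := if x then rcons P (hh i) else P in
   ff_weight b1 b2 c1 c2 i b h x false *
     D (P' ++ map (transfer_vec (i.+1 + size bot)) (true_pos i.+1 bot) ++ Sf) +
   ff_weight b1 b2 c1 c2 i b h x true *
     D (P' ++ path_vec i.+1 (size bot) ::
        map (transfer_vec (i.+1 + size bot)) (true_pos i.+1 bot) ++ Sf).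
  rewrite /= -[in RHS](IH0 false) /= -[in RHS](IH0 true) -!sum_bitsZ -sum_bitsD.
  apply: eq_sum_bits => top _.
  by case: x; rewrite /= ?cat_rcons; ring.
rewrite !e /= {e}.
have tv : transfer_vec (i.+1 + size bot) i =
  b1 i *: hh i + c1 i *: path_vec i.+1 (size bot).
  by rewrite /transfer_vec; congr (_ + _ *: path_vec _ _); lia.
case: b; case: h; rewrite /= ?mul0r ?add0r ?addr0 ?mul1r //=.
(* Two paths meet: the minor of their expansions is exactly the weight of the full vertex. *)
- rewrite tv (wedge_pair w) cat_rcons; congr (_ * _); ring.
- by rewrite tv (wedge_lin w) cat_rcons addrC.
- by rewrite (wedge_lin w) cat_rcons addrC.
Qed.

End RowWedge.

(** The value 0 on lists of the wrong length lets sums run over all Boolean rows: those with another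
    number of paths drop out. *)
Definition wdet l : F :=
  if size l == n then \det (\matrix_(i < n) nth 0 l i) else 0.

Lemma nth_mid l1 l2 x i :
  nth 0 (l1 ++ x :: l2) i =
  if i == size l1 then x else nth 0 (l1 ++ 0 :: l2) i.
Proof.
rewrite !nth_cat; case: ltngtP => // [lt|->]; last by rewrite subnn.
case E: (i - size l1)%N => //.
by move/eqP: E; rewrite subn_eq0 leqNgt lt.
Qed.

(** The list is reversed because positions are read off a row in increasing order, whereas [sigS] is
    decreasing. *)
Lemma wdet_wedge pre suf : wedge_like (fun l => wdet (pre ++ rev l ++ suf)).
Proof.
have revE s1 s2 x : pre ++ rev (s1 ++ x :: s2) ++ suf =
    (pre ++ rev s2) ++ x :: (rev s1 ++ suf).
  by rewrite rev_cat rev_cons cat_rcons -!catA.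
split=> [s1 s2 a b u v|s1 s2 u].
  rewrite !revE; set l1 := pre ++ _; set l2 := rev s1 ++ _.
  rewrite /wdet !(size_cat l1) /=.
  case: eqP => [sz|_]; last by rewrite !mulr0 addr0.
  have k_lt : (size l1 < n)%N.
    by apply: leq_trans _ (eq_leq sz); rewrite -addSnnS; exact: leq_addr.
  pose k := Ordinal k_lt.
  have [g nk] : exists g, forall x (i : 'I_n),
      nth 0 (l1 ++ x :: l2) i = if i == k then x else g i.
    by exists (nth 0 (l1 ++ 0 :: l2)) => x i; rewrite nth_mid.
  apply: (@determinant_multilinear _ _ _ _ _ k).
  - by apply/rowP => j; rewrite !mxE !nk eqxx /= !mxE.
  - apply/matrixP => i j; rewrite !mxE !nk.
    by rewrite eq_sym (negPf (neq_lift k i)).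
  - apply/matrixP => i j; rewrite !mxE !nk.
    by rewrite eq_sym (negPf (neq_lift k i)).
rewrite revE rev_cons -rcons_cat cat_rcons.
set l1 := pre ++ _; set l2 := _ ++ suf.
rewrite /wdet (size_cat l1) /=.
case: eqP => // sz.
have lt1 : (size l1 < n)%N by apply: leq_trans _ (eq_leq sz); rewrite -addSnnS; exact: leq_addr.
have lt2 : ((size l1).+1 < n)%N by apply: leq_trans _ (eq_leq sz); rewrite -!addSnnS; exact: leq_addr.
apply: (@determinant_alternate _ _ _ (Ordinal lt1) (Ordinal lt2)).
  by apply/eqP => /(congr1 val) /= /eqP; rewrite ltn_eqF.
by move=> j; rewrite !mxE /= !nth_cat ltnn ltnNge leqnSn /= subnn subSnn.
Qed.

End Wedge.

Section PathSum.
Variables (F : fieldType) (Y : finType).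

Definition path_sum (k : nat) (w : 'I_k -> Y -> Y -> F) (a b : Y) : F :=
  \sum_(v : {ffun 'I_k.+1 -> Y} | (v ord0 == a) && (v ord_max == b))
    \prod_(j < k) w j (v (widen_ord (leqnSn k) j)) (v (lift ord0 j)).

Lemma path_sum0 (w : 'I_0 -> Y -> Y -> F) a b : path_sum w a b = (a == b)%:R.
Proof.
rewrite /path_sum; under eq_bigr do rewrite big_ord0.
rewrite sumr_const; congr (_%:R).
case: eqP => [<-|ab].
  apply: (@fintype.eq_card1 _ [ffun=> a]) => v.
  rewrite !inE; apply/andP/eqP => [[/eqP v0 _]|->]; last by rewrite !ffunE.
  by apply/ffunP => i; rewrite ffunE (ord1 i).
apply: eq_card0 => v; rewrite !inE; apply/negP => /andP[/eqP v0 /eqP v1].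
by case: ab; rewrite -v0 -v1; congr (v _); apply/val_inj.
Qed.

Definition fcons k (p : Y * {ffun 'I_k -> Y}) : {ffun 'I_k.+1 -> Y} :=
  [ffun i => if unlift ord0 i is Some j then p.2 j else p.1].

Lemma fcons_bij k : bijective (@fcons k).
Proof.
exists (fun v : {ffun 'I_k.+1 -> Y} => (v ord0, [ffun j => v (lift ord0 j)])).
  move=> [a v]; congr pair; first by rewrite ffunE unlift_none.
  by apply/ffunP => j; rewrite !ffunE liftK.
move=> v; apply/ffunP => i; rewrite !ffunE.
by case: unliftP => [j ->|->] //=; rewrite ffunE.
Qed.

Lemma path_sumS k (w : 'I_k.+1 -> Y -> Y -> F) a b :
  path_sum w a b =
  \sum_c w ord0 a c * path_sum (fun j => w (lift ord0 j)) c b.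
Proof.
rewrite /path_sum (reindex (@fcons k.+1)) /=; last exact/onW_bij/fcons_bij.
have f0 p : fcons p ord0 = p.1 :> Y by rewrite ffunE unlift_none.
have fS n (p : Y * {ffun 'I_n -> Y}) j : fcons p (lift ord0 j) = p.2 j.
  by rewrite ffunE liftK.
have om : ord_max = lift ord0 ord_max :> 'I_k.+2 by apply/val_inj.
have wl (i : 'I_k) : widen_ord (leqnSn k.+1) (lift ord0 i) =
   lift ord0 (widen_ord (leqnSn k) i) by apply/val_inj.
have w0 : widen_ord (leqnSn k.+1) ord0 = ord0 by apply/val_inj.
transitivity (\sum_(p : Y * {ffun 'I_k.+1 -> Y} |
     (p.1 == a) && (p.2 ord_max == b)) w ord0 p.1 (p.2 ord0) *
   \prod_(j < k) w (lift ord0 j) (p.2 (widen_ord (leqnSn k) j)) (p.2 (lift ord0 j))).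
  apply: eq_big => [p|p _]; first by rewrite f0 om fS.
  rewrite big_ord_recl w0 f0 fS; congr (_ * _).
  by apply: eq_bigr => j _; rewrite wl !fS.
rewrite -(pair_big_dep (fun c => c == a) (fun _ (v : {ffun 'I_k.+1 -> Y}) => v ord_max == b)
  (fun c (v : {ffun 'I_k.+1 -> Y}) => w ord0 c (v ord0) *
   \prod_(j < k) w (lift ord0 j) (v (widen_ord (leqnSn k) j)) (v (lift ord0 j)))) /=.
rewrite big_pred1_eq (partition_big (fun v : {ffun 'I_k.+1 -> Y} => v ord0) predT) //=.
apply: eq_bigr => c _; rewrite big_distrr /=; apply: eq_big => [v|v /andP[_ /eqP <-]] //.
by rewrite andbC.
Qed.

Lemma path_sum1 (w : 'I_1 -> Y -> Y -> F) a b : path_sum w a b = w ord0 a b.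
Proof.
rewrite path_sumS (bigD1 b) //= path_sum0 eqxx mulr1 big1 ?addr0 // => c cb.
by rewrite path_sum0 (negPf cb) mulr0.
Qed.

End PathSum.

Section RowWeightE.
Variable (F : fieldType).

Lemma row_weightE (U : nat -> bool -> bool -> bool -> bool -> F) i h n
    (al be : n.-tuple bool) out :
  row_weight U i h al be out =
  \sum_(eta : n.-tuple bool) (last h eta == out)%:R *
    \prod_(m < n) U (i + m)%N (nth false al m) (nth out (h :: eta) m)
       (nth false be m) (nth out eta m).
Proof.
rewrite -(sum_bitsE n (fun eta => (last h eta == out)%:R *
    \prod_(m < n) U (i + m)%N (nth false al m) (nth out (h :: eta) m)
       (nth false be m) (nth out eta m))).
case: al be => [al /= /eqP sa] [be /= /eqP sb].
elim: n i h al be sa sb => [|n IH] i h [|a al] [|b be] //= sa sb.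
  by rewrite big_ord0 mulr1.
case: sa => sa; case: sb => sb.
rewrite !(IH _ _ al be) // -!sum_bitsZ; congr (_ + _); apply: eq_sum_bits => e _;
 rewrite /= big_ord_recl /= addn0 mulrCA; congr (_ * (_ * _));
 by apply: eq_bigr => j _; rewrite addSnnS.
Qed.

(** Relates the weights W and What, whose ratio depends only on the column. *)
Lemma row_weight_scale (c : nat -> F) U U' i h al be out :
  (forall p a b a' b', U' p a b a' b' = c p * U p a b a' b') ->
  size al = size be ->
  row_weight U' i h al be out =
    (\prod_(m < size al) c (i + m)%N) * row_weight U i h al be out.
Proof.
move=> UU; elim: al be i h => [|a al IH] [|b be] i h //= => [_|[sab]].
  by rewrite big_ord0 mul1r.
rewrite !IH // !UU big_ord_recl /= addn0.
have -> : \prod_(m < size al) c (i.+1 + m)%N =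
          \prod_(m < size al) c (i + bump 0 m)%N.
  by apply: eq_bigr => m _; rewrite /bump add1n addSnnS.
ring.
Qed.

End RowWeightE.

(** * Divided differences *)

Section NewtonRows.
Variables (R : fieldType) (n : nat).
Local Notation N := n.+1.
Variable x : 'I_N -> R.

(** For [i <= j] the entry [(i, j)] of a polynomial in this matrix is the divided difference at the
    nodes [x_i, ..., x_j]. *)
Definition jordan : 'M[R]_N :=
  \matrix_(i, j) (if i == j then x i else (j == i.+1 :> nat)%:R).

Local Notation hJ := (horner_mx jordan).

(* The coefficients of the Newton interpolation of [p] at the nodes [x], that is
   its divided differences at [x_0, ..., x_k]. *)
Definition newton_row (p : {poly R}) : 'rV[R]_N := row ord0 (hJ p).

Definition newton_poly (k : nat) : {poly R} := \prod_(i < N | (i < k)%N) ('X - (x i)%:P).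

Definition nonvanishing (q : {poly R}) : Prop := forall k, q.[x k] != 0.

Lemma nonvanishingM p q : nonvanishing p -> nonvanishing q -> nonvanishing (p * q).
Proof. by move=> hp hq k; rewrite hornerM mulf_neq0. Qed.

Lemma nonvanishing1 : nonvanishing 1.
Proof. by move=> k; rewrite hornerC oner_neq0. Qed.

Lemma nonvanishingXsubC a : (forall k, x k != a) -> nonvanishing ('X - a%:P).
Proof. by move=> h k; rewrite hornerXsubC subr_eq0. Qed.

Lemma nonvanishing_prod (I : Type) (s : seq I) (P : pred I) (F : I -> {poly R}) :
  (forall i, P i -> nonvanishing (F i)) -> nonvanishing (\prod_(i <- s | P i) F i).
Proof.
move=> h; elim/big_ind: _ => //; first exact: nonvanishing1.
exact: nonvanishingM.
Qed.

Lemma hJ_upper p (i j : 'I_N) : (j < i)%N -> hJ p i j = 0.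
Proof.
elim/poly_ind: p i j => [|p c IH] i j ji; first by rewrite rmorph0 mxE.
rewrite rmorphD rmorphM /= horner_mx_C horner_mx_X !mxE big1 => [|k _].
  by rewrite add0r; case: eqP ji => [->|]; rewrite ?ltnn ?mulr0n.
case: (ltnP k i) => ki; first by rewrite IH ?mul0r.
rewrite mxE; case: eqP => [kj|_]; first by move: ji ki; rewrite kj; lia.
by rewrite (_ : (j == k.+1 :> nat) = false) ?mulr0 //; apply/eqP; lia.
Qed.

Lemma hJ_diag p i : hJ p i i = p.[x i].
Proof.
elim/poly_ind: p => [|p c IH]; first by rewrite rmorph0 mxE horner0.
rewrite rmorphD rmorphM /= horner_mx_C horner_mx_X hornerMXaddC !mxE eqxx mulr1n.
rewrite (bigD1 i) //= IH mxE eqxx big1 ?addr0 // => k ki.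
case: (ltnP k i) => ki'; first by rewrite hJ_upper ?mul0r.
rewrite mxE (negPf ki) (_ : (i == k.+1 :> nat) = false) ?mulr0 //.
by apply/eqP; lia.
Qed.

Lemma det_upper (A : 'M[R]_N) : (forall i j : 'I_N, (j < i)%N -> A i j = 0) ->
  \det A = \prod_i A i i.
Proof.
move=> up; rewrite -det_tr det_trig; first by apply: eq_bigr => i _; rewrite mxE.
by apply/is_trig_mxP => i j ij; rewrite mxE up.
Qed.

Lemma det_hJ p : \det (hJ p) = \prod_k p.[x k].
Proof.
rewrite det_upper; last by move=> i j; exact: hJ_upper.
by apply: eq_bigr => i _; rewrite hJ_diag.
Qed.

Lemma hJ_unit q : nonvanishing q -> hJ q \in unitmx.
Proof.
by move=> gq; rewrite unitmxE det_hJ unitfE; apply/prodf_neq0 => k _.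
Qed.

Lemma newton_rowM p q : newton_row (p * q) = newton_row p *m hJ q.
Proof. by rewrite /newton_row rmorphM /= row_mul. Qed.

Lemma newton_rowD p q : newton_row (p + q) = newton_row p + newton_row q.
Proof. by rewrite /newton_row rmorphD /= linearD. Qed.

Lemma newton_rowZ c p : newton_row (c *: p) = c *: newton_row p.
Proof. by rewrite /newton_row linearZ /= linearZ. Qed.

Lemma newton_polyS (k : 'I_N) : newton_poly k.+1 = newton_poly k * ('X - (x k)%:P).
Proof.
rewrite /newton_poly (bigD1 k) //= mulrC; congr (_ * _).
by apply: eq_bigl => i; rewrite -val_eqE /= ltnS; case: ltngtP.
Qed.

Lemma newton_row_poly (k : 'I_N) : newton_row (newton_poly k) = delta_mx 0 k.
Proof.
case: k; elim=> [|k IH] kN.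
  rewrite /newton_poly big_pred0 // /newton_row rmorph1.
  apply/rowP => j; rewrite !mxE /= eq_sym (_ : Ordinal kN = ord0) //.
  exact/val_inj.
have kN' := ltnW kN.
rewrite (newton_polyS (Ordinal kN')) newton_rowM IH rmorphB /= horner_mx_C horner_mx_X.
rewrite -rowE; apply/rowP => j; rewrite !mxE eqxx /=.
case: eqP => [<-|ne].
  by rewrite mulr1n subrr -val_eqE /= ltn_eqF.
by rewrite mulr0n subr0 -val_eqE.
Qed.

Lemma newton_row_annihil : newton_row (newton_poly N) = 0.
Proof.
rewrite (newton_polyS ord_max) newton_rowM newton_row_poly rmorphB /= horner_mx_C horner_mx_X.
rewrite -rowE; apply/rowP => j; rewrite !mxE.
case: eqP => [_|ne]; first by rewrite mulr1n subrr.
by rewrite mulr0n subr0 ltn_eqF.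
Qed.

Lemma newton_row_shift (k : 'I_N) p : newton_row (newton_poly k * p) = row k (hJ p).
Proof. by rewrite newton_rowM newton_row_poly -rowE. Qed.

(** Row [k] is the first row for the product with [newton_poly k], and the two factors commute, so
    the vanishing of the first row suffices. *)
Lemma hJ_annihil : hJ (newton_poly N) = 0.
Proof.
apply/row_matrixP => k.
by rewrite -newton_row_shift mulrC newton_rowM newton_row_annihil mul0mx row0.
Qed.

(** Bezout modulo the annihilating polynomial: the inverse is again a polynomial in the matrix, so
    triangularity and diagonal values carry over from polynomials to fractions. *)
Lemma nonvanishing_inv q : nonvanishing q ->
  exists a, invmx (hJ q) = hJ a /\ forall k, a.[x k] = (q.[x k])^-1.
Proof.
move=> gq.
have : coprimep q (newton_poly N).
  rewrite /newton_poly; elim/big_ind: _ => [|p p' hp hp'|i _]; first exact: coprimep1.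
    by rewrite coprimepMr hp.
  by rewrite coprimep_XsubC rootE gq.
case/Bezout_eq1_coprimepP => -[a b] /= ab.
have nx k : (newton_poly N).[x k] = 0.
  rewrite /newton_poly horner_prod; apply/eqP/prodf_eq0; exists k => //.
  by rewrite hornerXsubC subrr.
have qa : hJ q *m hJ a = 1%:M.
  have := congr1 hJ ab; rewrite rmorphD !rmorphM /= hJ_annihil mulr0 addr0 rmorph1.
  by rewrite -[_ * _](comm_horner_mx2 jordan q a).
exists a; split; first by rewrite -[LHS]mulmx1 -qa mulKmx ?hJ_unit.
move=> k; have := congr1 (horner^~ (x k)) ab.
rewrite hornerD !hornerM nx mulr0 addr0 hornerC => e.
by apply: (mulIf (gq k)); rewrite e mulVf.
Qed.

Definition newton_frac (p q : {poly R}) : 'rV[R]_N := newton_row p *m invmx (hJ q).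

Lemma newton_fracMr p q r : nonvanishing q ->
  newton_frac p q *m hJ r = newton_frac (p * r) q.
Proof.
move=> gq; rewrite /newton_frac newton_rowM -!mulmxA; congr (_ *m _).
apply: (can_inj (mulKmx (hJ_unit gq))).
rewrite mulKVmx ?hJ_unit // mulmxA -[hJ q *m hJ r](comm_horner_mx2 jordan r q).
by rewrite -[_ * _ *m _]mulmxA mulmxV ?hJ_unit // mulmx1.
Qed.

Lemma newton_frac_eq p q p' q' : nonvanishing q -> nonvanishing q' ->
  p * q' = p' * q -> newton_frac p q = newton_frac p' q'.
Proof.
move=> gq gq' e.
apply: (can_inj (mulmxK (hJ_unit gq'))); rewrite newton_fracMr // e.
by rewrite /newton_frac newton_rowM mulmxK ?hJ_unit // mulmxKV ?hJ_unit.
Qed.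

Lemma newton_fracD p p' q : newton_frac (p + p') q = newton_frac p q + newton_frac p' q.
Proof. by rewrite /newton_frac newton_rowD mulmxDl. Qed.

Lemma newton_fracZ c p q : newton_frac (c *: p) q = c *: newton_frac p q.
Proof. by rewrite /newton_frac newton_rowZ scalemxAl. Qed.

Lemma newton_frac1 p : newton_frac p 1 = newton_row p.
Proof. by rewrite /newton_frac rmorph1 invmx1 mulmx1. Qed.

(** A function with the factor [newton_poly k] has zero divided differences up to the node before
    [x_k]. These zeros make the rows in the computation of F triangular. *)
Lemma newton_frac_shift (k : 'I_N) p q : nonvanishing q ->
  (forall j : 'I_N, (j < k)%N -> newton_frac (newton_poly k * p) q ord0 j = 0) /\
  newton_frac (newton_poly k * p) q ord0 k = p.[x k] / q.[x k].
Proof.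
move=> gq; have [a [aE ax]] := nonvanishing_inv gq.
rewrite /newton_frac aE -newton_rowM -mulrA newton_row_shift; split.
  by move=> j jk; rewrite mxE hJ_upper.
by rewrite mxE hJ_diag hornerM ax.
Qed.

Section Columns.
Variables (y S : nat -> R).

(* phi_a = colN (a - 1) / colD a is the single-particle function, and
   colN M / colD M the eigenvalue of the vacuum on M columns. *)
Definition colN (a : nat) : {poly R} := \prod_(1 <= j < a.+1) ('X - (S j)%:P).
Definition colD (a : nat) : {poly R} := \prod_(1 <= j < a.+1) ('X - (y j)%:P).

Lemma colNS a : colN a.+1 = colN a * ('X - (S a.+1)%:P).
Proof. by rewrite /colN big_nat_recr. Qed.

Lemma colDS a : colD a.+1 = colD a * ('X - (y a.+1)%:P).
Proof. by rewrite /colD big_nat_recr. Qed.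

Hypothesis yx : forall p k, (1 <= p)%N -> x k != y p.

Lemma nonvanishing_colD a : nonvanishing (colD a).
Proof.
elim: a => [|a IH]; first by rewrite /colD big_geq //; exact: nonvanishing1.
by rewrite colDS; apply: nonvanishingM => //; apply: nonvanishingXsubC => k; exact: yx.
Qed.

Variables (w om : R).
Hypothesis Sw : forall p, (1 <= p)%N -> S p != w.

Let b1 p := (S p - om) / (S p - w).
Let b2 p := (y p - w) / (S p - w).
Let c1 p := (om - w) / (S p - w).
Let c2 p := (S p - y p) / (S p - w).

Definition pass_weight (i m : nat) : R :=
  \prod_(i <= j < i + m) ((y j - w) / (S j - w)).

Variables (g d : {poly R}) (ev : 'rV[R]_N).
Hypothesis gd : nonvanishing d.

Let hh b := newton_frac (g * ('X - w%:P) * colN b.-1) (colD b * d).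

(** The identity [c2 (X - w) + b2 (X - S) = X - y] makes the sum over turning columns telescope,
    leaving a boundary term at the last column. The factor [X - w] is put into the numerator of
    [hh], so that the result needs no division by it. *)
Lemma path_vecE i m : (1 <= i)%N ->
  path_vec b2 c2 hh ev i m = newton_frac (g * colN i.-1) (colD i.-1 * d)
    - pass_weight i m *: (newton_frac (g * colN (i + m).-1) (colD (i + m).-1 * d) - ev).
Proof.
have gD a : nonvanishing (colD a * d) by apply: nonvanishingM => //; exact: nonvanishing_colD.
elim: m i => [|m IH] i i1 /=.
  by rewrite /pass_weight addn0 big_geq // scale1r opprB addrC subrK.
have -> : pass_weight i m.+1 = b2 i * pass_weight i.+1 m.
  by rewrite /pass_weight addSnnS big_ltn // -[ltnLHS]addn0 ltn_add2l.
rewrite IH // addSnnS -scalerA scalerBr addrA; congr (_ - _).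
case: i i1 => // i _ /=; rewrite /hh /=.
have -> : newton_frac (g * colN i) (colD i * d) =
    newton_frac (g * colN i * ('X - (y i.+1)%:P)) (colD i.+1 * d).
  by apply: newton_frac_eq => //; rewrite colDS; ring.
rewrite -!newton_fracZ -newton_fracD; congr (newton_frac _ _).
rewrite colNS.
have e : c2 i.+1 *: ('X - w%:P) + b2 i.+1 *: ('X - (S i.+1)%:P) = 'X - (y i.+1)%:P.
  have nz : S i.+1 - w != 0 by rewrite subr_eq0 Sw.
  rewrite !scalerBr addrACA -scalerDl -opprD.
  have -> : c2 i.+1 + b2 i.+1 = 1 by rewrite /c2 /b2; field.
  rewrite scale1r -!mul_polyC -!polyCM -polyCD; congr (_ - _%:P).
  by rewrite /c2 /b2; field.
rewrite -e -!mul_polyC; ring.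
Qed.

(** Going straight up and turning right combine through [b1 (X - w) + c1 (X - S) = X - om]; the
    boundary term of [path_vecE] persists. *)
Lemma transfer_vecE M a : (1 <= a)%N -> (a <= M)%N ->
  transfer_vec b1 b2 c1 c2 hh ev M.+1 a =
  newton_frac (g * ('X - om%:P) * colN a.-1) (colD a * d)
  - (c1 a * pass_weight a.+1 (M - a)) *: (newton_frac (g * colN M) (colD M * d) - ev).
Proof.
have gD b : nonvanishing (colD b * d) by apply: nonvanishingM => //; exact: nonvanishing_colD.
move=> a1 aM; rewrite /transfer_vec path_vecE // subSS.
have -> : (a.+1 + (M - a)).-1 = M by lia.
rewrite scalerBr addrA scalerA; congr (_ - _).
case: a a1 aM => // a _ _ /=; rewrite /hh /=.
rewrite -!newton_fracZ -newton_fracD; congr (newton_frac _ _).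
rewrite colNS.
have e : b1 a.+1 *: ('X - w%:P) + c1 a.+1 *: ('X - (S a.+1)%:P) = 'X - om%:P.
  have nz : S a.+1 - w != 0 by rewrite subr_eq0 Sw.
  rewrite !scalerBr addrACA -scalerDl -opprD.
  have -> : b1 a.+1 + c1 a.+1 = 1 by rewrite /c1 /b1; field.
  rewrite scale1r -!mul_polyC -!polyCM -polyCD; congr (_ - _%:P).
  by rewrite /c1 /b1; field.
rewrite -e -!mul_polyC; ring.
Qed.

(** At [w] the passing weight and the vacuum factor of a column are inverse to each other. The
    coefficient of the boundary term is therefore a multiple of [phi_a(w)], hence linear in the
    single-particle function. *)
Lemma exit_weightE M a : (1 <= a)%N -> (a <= M)%N ->
  (forall p, (1 <= p)%N -> y p != w) ->
  c1 a * pass_weight a.+1 (M - a) * ((colN M).[w] / (colD M).[w]) =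
  - ((om - w) * ((colN a.-1).[w] / (colD a).[w])).
Proof.
move=> a1 aM yw.
have nyw p : (1 <= p)%N -> w - y p != 0 by move=> p1; rewrite subr_eq0 eq_sym yw.
have nSw p : (1 <= p)%N -> S p - w != 0 by move=> p1; rewrite subr_eq0 Sw.
have nD b : (colD b).[w] != 0.
  elim: b => [|b IH]; first by rewrite /colD big_geq // hornerC oner_neq0.
  by rewrite colDS hornerM hornerXsubC mulf_neq0 ?nyw.
have ratio m : pass_weight a.+1 m * ((colN (a + m)).[w] / (colD (a + m)).[w]) =
    (colN a).[w] / (colD a).[w].
  elim: m => [|m IH]; first by rewrite /pass_weight addn0 big_geq ?mul1r // addn0.
  rewrite -IH addnS /pass_weight addnS big_nat_recr ?ltnS ?leq_addr //= addSn.
  rewrite colNS colDS !hornerM !hornerXsubC.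
  have h1 := nyw (a + m).+1 isT; have h2 := nSw (a + m).+1 isT; have h3 := nD (a + m)%N.
  have h4 : w - S (a + m).+1 != 0 by rewrite -opprB oppr_eq0.
  by rewrite -[y _ - w]opprB -[S _ - w]opprB; field; rewrite ?oppr_eq0 ?h1 ?h3 ?h4.
have := ratio (M - a)%N; rewrite subnKC // => e.
rewrite -mulrA e; case: a a1 aM ratio e => // a _ _ _ _ /=.
have h1 := nyw a.+1 isT; have h2 := nSw a.+1 isT; have h3 := nD a.
rewrite colNS colDS !hornerM !hornerXsubC /c1.
have h4 : w - S a.+1 != 0 by rewrite -opprB oppr_eq0.
by rewrite -[S _ - w]opprB; field; rewrite ?oppr_eq0 ?h1 ?h3 ?h4.
Qed.

End Columns.
End NewtonRows.

Local Open Scope classical_set_scope.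
Local Open Scope ring_scope.

(** * Configurations as iterated row sums *)

Section FiniteColumns.
Variables (R : realType) (k : nat).
Variables (V : R -> R -> R -> R -> bool -> bool -> bool -> bool -> R).
Variables (x : 'I_k -> R) (y : nat -> R) (r : 'I_k -> R) (s : nat -> R).
Variables (M : nat) (bot top : pred nat) (out : bool).

Let U j p := V (x j) (y p) (r j) (s p).

Hypothesis conservation : forall j p a b c d,
  U j p a b c d != 0 -> (a + b = c + d)%N.
Hypothesis vacuum : forall j p, (M < p)%N -> U j p false out false out = 1.
Hypothesis bot_bounded : forall p, (M < p)%N -> bot p = false.
Hypothesis top_bounded : forall p, (M < p)%N -> top p = false.

Definition bits (P : pred nat) : M.-tuple bool := [tuple P i.+1 | i < M].

Let box : Type := ({ffun 'I_k.+1 -> M.-tuple bool} * {ffun 'I_k -> M.-tuple bool})%type.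

Let emb (p : box) : config k :=
  (fun i j => nth false (p.1 j) i, fun i j => nth out (false :: p.2 j) i).

Let box_bnd (p : box) : bool :=
  (p.1 ord0 == bits bot) && (p.1 ord_max == bits top) &&
  [forall j, last false (p.2 j) == out].

Lemma emb_inj : injective emb.
Proof.
move=> [v h] [v' h'] [] /funeqP vv /funeqP hh; congr pair; apply/ffunP => j.
  apply/val_inj/(@eq_from_nth _ false); first by rewrite !size_tuple.
  by move=> i _; have /funeqP /(_ j) := vv i.
apply/val_inj/(@eq_from_nth _ out); first by rewrite !size_tuple.
by move=> i _; have /funeqP /(_ j) := hh i.+1.
Qed.

Lemma nth_bits P i : (i < M)%N -> nth false (bits P) i = P i.+1.
Proof. by move=> iM; rewrite (nth_map (Ordinal iM)) ?size_enum_ord ?nth_enum_ord. Qed.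

Lemma emb_bnd p : box_bnd p -> config_bnd bot top out (emb p).
Proof.
case: p => v h /andP[/andP[/eqP /= v0 /eqP v1] /forallP hl]; split => /=.
- move=> i; rewrite v0; case: (ltnP i M) => iM; first by rewrite nth_bits.
  by rewrite nth_default ?size_tuple ?bot_bounded.
- move=> i; rewrite v1; case: (ltnP i M) => iM; first by rewrite nth_bits.
  by rewrite nth_default ?size_tuple ?top_bounded.
- by [].
- exists M => // i /= Mi j.
  move: Mi; rewrite leq_eqVlt => /orP[/eqP <-|Mi].
    have := hl j; rewrite (last_nth out) size_tuple => /eqP <-.
    by apply: set_nth_default; rewrite /= size_tuple.
  by rewrite nth_default //= size_tuple.
Qed.

Lemma emb_weight p : box_bnd p -> config_weight V x y r s (emb p) =
  \prod_(j < k) \prod_(m < M) U j m.+1 (nth false (p.1 (widen_ord (leqnSn k) j)) m)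
     (nth out (false :: p.2 j) m) (nth false (p.1 (lift ord0 j)) m) (nth out (p.2 j) m).
Proof.
move=> /andP[_ /forallP hl].
rewrite exchange_big /= /config_weight.
apply: lim_near_cst => //.
exists M => // n /= Mn.
rewrite (big_cat_nat (leq0n M) Mn) /= [X in _ * X]big1_seq ?mulr1; last first.
  move=> i /= /[!mem_index_iota] /andP[Mi _].
  rewrite big1 // => j _; rewrite /vert /horiz /emb /=.
  have v0 q : nth false (p.1 q) i = false by rewrite nth_default ?size_tuple.
  have h1 : nth out (p.2 j) i = out by rewrite nth_default ?size_tuple.
  suff h0 : nth out (false :: p.2 j) i = out by rewrite !v0 h0 h1; exact: vacuum.
  move: Mi; rewrite leq_eqVlt => /orP[/eqP <-|Mi]; last by rewrite nth_default //= size_tuple.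
  have /eqP {2}<- := hl j; rewrite (last_nth out) size_tuple.
  by apply: set_nth_default; rewrite /= size_tuple.
by rewrite big_mkord.
Qed.

(** No factor of a nonzero weight vanishes, since one zero factor makes the partial products
    eventually 0. So paths are conserved at every vertex, and this freezes all columns past [M]. *)
Lemma supp_emb c : config_bnd bot top out c -> config_weight V x y r s c != 0 ->
  exists2 p, box_bnd p & emb p = c.
Proof.
case: c => v h [/= v0 v1 h0 [n0 _ hn]] wn0.
pose Uc i j := U j i.+1 (v i (widen_ord (leqnSn k) j)) (h i j) (v i (lift ord0 j)) (h i.+1 j).
have Un0 i j : Uc i j != 0.
  apply: contraNneq wn0 => U0; apply/eqP; apply: lim_near_cst => //.
  exists i.+1 => // n /= ilt; rewrite big_mkord (bigD1 (Ordinal ilt)) //= (bigD1 j) //=.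
  by rewrite -/(U _ _) /vert /horiz /= -/(Uc i j) U0 !mul0r.
have cons i j : (v i (widen_ord (leqnSn k) j) + h i j =
   v i (lift ord0 j) + h i.+1 j)%N by exact: (conservation (Un0 i j)).
(* [H i] counts the paths passing from column [i] to column [i + 1]. Past [M] none enters at the
   bottom or leaves at the top, so [H] is constant there and equal to its eventual value, 0 or [k];
   either extreme determines every edge. *)
pose H i := (\sum_(j < k) h i j)%N.
have HS i : (M <= i)%N -> H i = H i.+1.
  move=> Mi.
  have : (\sum_(j < k) (v i (widen_ord (leqnSn k) j) + h i j) =
     \sum_(j < k) (v i (lift ord0 j) + h i.+1 j))%N by apply: eq_bigr => j _.
  rewrite !big_split /= -/(H i) -/(H i.+1).
  have : (\sum_(j < k.+1) v i j = \sum_(j < k) v i (widen_ord (leqnSn k) j) + v i ord_max)%N.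
    by rewrite big_ord_recr.
  rewrite big_ord_recl v0 v1 bot_bounded ?top_bounded ?ltnS // add0n addn0 => ->.
  by move/eqP; rewrite eqn_add2l => /eqP.
have HM i : (M <= i)%N -> H i = (k * out)%N.
  move=> Mi; have -> : H i = H (i + n0)%N.
    by elim: n0 {hn} => [|n IH]; rewrite ?addn0 // IH addnS; apply: HS; lia.
  rewrite /H (eq_bigr (fun=> out : nat)) ?sum_nat_const ?card_ord //.
  by move=> j _; rewrite hn //= leq_addl.
have hM i j : (M <= i)%N -> h i j = out.
  move=> /HM; rewrite /H; case: out => //=; last first.
    by rewrite muln0 => /eqP; rewrite sum_nat_eq0 => /forallP /(_ j) /=; case: (h i j).
  move=> e; have : (\sum_(j < k) (h i j + ~~ h i j) = k)%N.
    by rewrite (eq_bigr (fun=> 1%N)) ?sum1_card ?card_ord // => l _; case: (h i l).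
  rewrite big_split /= e => /eqP; rewrite muln1 -[X in _ == X]addn0 eqn_add2l.
  by rewrite sum_nat_eq0 => /forallP /(_ j) /=; case: (h i j).
have vM i j : (M <= i)%N -> v i j = false.
  move=> Mi; case: j => j; elim: j => [|j IH] jk.
    by rewrite (_ : Ordinal jk = ord0) ?v0 ?bot_bounded //; apply/val_inj.
  have jk' : (j < k)%N by [].
  have := cons i (Ordinal jk'); rewrite !hM //; last by lia.
  rewrite (_ : widen_ord _ _ = Ordinal (ltnW jk)); last exact/val_inj.
  rewrite IH (_ : lift _ _ = Ordinal jk); last exact/val_inj.
  by case: (v i _) => //; lia.
exists ([ffun j => [tuple v i j | i < M]], [ffun j => [tuple h i.+1 j | i < M]]).
  apply/andP; split; first apply/andP; first split.
  - by apply/eqP/eq_from_tnth => i; rewrite ffunE !tnth_mktuple v0.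
  - by apply/eqP/eq_from_tnth => i; rewrite ffunE !tnth_mktuple v1.
  - apply/forallP => j; rewrite ffunE (last_nth out) size_tuple.
    suff : forall m, m = M -> nth out (false :: [tuple h i.+1 j | i < M]) m == out by exact.
    case=> [|m] mM /=; first by rewrite -(h0 j) hM // -mM.
    have mM' : (m < M)%N by rewrite -mM.
    by rewrite (nth_map (Ordinal mM')) ?size_enum_ord // nth_enum_ord // hM // -mM.
rewrite /emb /=; congr pair; apply/funext => i; apply/funext => j; rewrite ffunE.
  case: (ltnP i M) => iM; last by rewrite nth_default ?size_tuple ?vM.
  by rewrite (nth_map (Ordinal iM)) ?size_enum_ord // nth_enum_ord.
case: i => [|i] /=; first by rewrite h0.
case: (ltnP i M) => iM; last by rewrite (hM i.+1) ?(leqW iM) // nth_default // size_map size_enum_ord.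
by rewrite (nth_map (Ordinal iM)) ?size_enum_ord // nth_enum_ord.
Qed.

Lemma sum_config_finite :
  \sum_(c \in [set c : config k | config_bnd bot top out c]) config_weight V x y r s c =
  path_sum (fun j (a b : M.-tuple bool) => row_weight (U j) 1 false a b out)
    (bits bot) (bits top).
Proof.
rewrite -(fsbig_widen (emb @` [set p | box_bnd p])); first last.
- move=> c /= [bc nc]; apply/eqP/negPn/negP => wc; apply: nc.
  by have [p bp <-] := supp_emb bc wc; exists p.
- by move=> _ [p bp <-]; exact: emb_bnd.
rewrite fsbig_image; last by move=> p q _ _; exact: emb_inj.
rewrite (fsbigE (enum [pred p | box_bnd p])) ?enum_uniq //; first last.
- by move=> p bp; rewrite mem_enum inE bp.
- by move=> p /=; rewrite mem_enum inE.
rewrite big_enum_cond /=.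
under eq_bigl do rewrite !inE mem_setE /= andbb.
(* The right boundary condition moves from the index set into one indicator per row, so that the sum
   over horizontal states factors over the rows. *)
transitivity (\sum_(p : box | (p.1 ord0 == bits bot) && (p.1 ord_max == bits top) && true)
  \prod_(j < k) ((last false (p.2 j) == out)%:R *
    \prod_(m < M) U j m.+1 (nth false (p.1 (widen_ord (leqnSn k) j)) m)
     (nth out (false :: p.2 j) m) (nth false (p.1 (lift ord0 j)) m) (nth out (p.2 j) m))).
  under [RHS]eq_bigl do rewrite andbT.
  rewrite [RHS](bigID (fun p : box => [forall j, last false (p.2 j) == out])) /=.
  rewrite [X in _ + X]big1 ?addr0; last first.
    move=> p /andP[_]; rewrite negb_forall => /existsP[j /negPf jp].
    by rewrite (bigD1 j) //= jp !mul0r.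
  apply: eq_bigr => p bp; rewrite emb_weight //; apply: eq_bigr => j _.
  by move: bp => /andP[_ /forallP /(_ j) ->]; rewrite mul1r.
rewrite -(pair_big_dep (fun v : {ffun 'I_k.+1 -> M.-tuple bool} =>
   (v ord0 == bits bot) && (v ord_max == bits top)) (fun _ _ => true)
  (fun v (h : {ffun 'I_k -> M.-tuple bool}) => \prod_(j < k) ((last false (h j) == out)%:R *
    \prod_(m < M) U j m.+1 (nth false (v (widen_ord (leqnSn k) j)) m)
     (nth out (false :: h j) m) (nth false (v (lift ord0 j)) m) (nth out (h j) m)))) /=.
apply: eq_bigr => v _.
rewrite -(bigA_distr_bigA (fun j (eta : M.-tuple bool) => (last false eta == out)%:R *
    \prod_(m < M) U j m.+1 (nth false (v (widen_ord (leqnSn k) j)) m)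
     (nth out (false :: eta) m) (nth false (v (lift ord0 j)) m) (nth out eta m))).
by apply: eq_bigr => j _; rewrite row_weightE.
Qed.

End FiniteColumns.

(** * Signatures as Boolean rows *)

Section SignatureBits.
Variable N : nat.
Implicit Types lam mu : signature N.

Lemma size_sigS lam : size (sigS lam) = N.
Proof. by rewrite size_map size_enum_ord. Qed.

Lemma nth_sigS lam i : (i < N)%N ->
  nth 0%N (sigS lam) i = (nth 0%N (val lam) i + (N - i))%N.
Proof.
move=> iN; rewrite (nth_map (Ordinal iN)) ?size_enum_ord //.
by rewrite nth_enum_ord // (tnth_nth 0%N) /= nth_enum_ord.
Qed.

Lemma sigS_sorted lam : sorted gtn (sigS lam).
Proof.
apply/(sortedP 0%N) => i; rewrite size_sigS => iN.
rewrite !nth_sigS ?(ltnW iN) //=.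
have := valP lam => /(sortedP 0%N) /(_ i); rewrite size_tuple iN /geq /= => /(_ isT).
by move=> h; lia.
Qed.

Lemma sigS_gt0 lam p : p \in sigS lam -> (0 < p)%N.
Proof. by move=> /mapP[j _ ->]; rewrite addn_gt0 subn_gt0 ltn_ord orbT. Qed.

Definition sig_le (M : nat) lam : bool := all (fun p => p <= M)%N (sigS lam).

Lemma sig_leS M M' lam : (M <= M')%N -> sig_le M lam -> sig_le M' lam.
Proof. by move=> MM /allP h; apply/allP => p /h /leq_trans; apply. Qed.

Lemma sig_le_max lam : sig_le (\max_(p <- sigS lam) p) lam.
Proof. by apply/allP => p ps; exact: leq_bigmax_seq. Qed.

Lemma true_posE i b : true_pos i b = [seq p <- iota i (size b) | nth false b (p - i)].
Proof.
elim: b i => [|x b IH] i //=; rewrite subnn.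
have -> : [seq p <- iota i.+1 (size b) | nth false (x :: b) (p - i)] = true_pos i.+1 b.
  rewrite IH; apply: eq_in_filter => p; rewrite mem_iota => /andP[ip _].
  by rewrite -[(p - i)%N](subnSK ip).
by case: x.
Qed.

Lemma size_bits M P : size (bits M P) = M.
Proof. exact: size_tuple (bits M P). Qed.

Lemma true_pos_bits M (P : pred nat) :
  true_pos 1 (bits M P) = [seq p <- iota 1 M | P p].
Proof.
rewrite true_posE size_tuple; apply: eq_in_filter => p.
rewrite mem_iota => /andP[p0 pM]; rewrite nth_bits; last by lia.
by rewrite subn1 prednK.
Qed.

Lemma true_pos_sig M lam : sig_le M lam ->
  rev (true_pos 1 (bits M (mem (sigS lam)))) = sigS lam.
Proof.
move=> /allP lamM; rewrite true_pos_bits.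
apply: (@irr_sorted_eq _ gtn).
- by move=> a b c /= h1 h2; exact: ltn_trans h2 h1.
- by move=> a /=; exact: ltnn.
- rewrite rev_sorted; apply: sorted_filter; last exact: iota_ltn_sorted.
  exact: ltn_trans.
- exact: sigS_sorted.
- move=> p; rewrite mem_rev mem_filter mem_iota /=.
  case ps: (p \in sigS lam) => //=.
  by rewrite (sigS_gt0 ps) /= add1n ltnS lamM.
Qed.

Lemma sig_eq lam mu : sigS lam = sigS mu -> lam = mu.
Proof.
move=> e; apply/val_inj/val_inj/(@eq_from_nth _ 0%N); rewrite ?size_tuple // => i iN.
by have := nth_sigS lam iN; rewrite e nth_sigS // => /addIn.
Qed.

Lemma sig_of_seq (p : seq nat) : size p = N -> sorted gtn p ->
  all (fun i => 0 < i)%N p -> exists lam, sigS lam = p.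
Proof.
move=> sp /(sortedP 0%N) ps /allP p0.
(* The entry followed by [k - 1] others is at least [k], so the truncated subtraction of [N - i]
   below is exact. *)
have pge k i : (i + k = N)%N -> (0 < k)%N -> (k <= nth 0 p i)%N.
  elim: k i => // -[|k] IH i.
    by move=> ik _; apply: p0; apply: mem_nth; rewrite sp; lia.
  move=> ik _; have := ps i; rewrite sp => /(_ ltac:(lia)) /=.
  have := IH i.+1 ltac:(lia) isT; lia.
pose l := [tuple (nth 0 p i - (N - i))%N | i < N].
have nl i : (i < N)%N -> nth 0%N l i = (nth 0 p i - (N - i))%N.
  by move=> iN; rewrite (nth_map (Ordinal iN)) ?size_enum_ord ?nth_enum_ord.
have ls : sorted geq l.
  apply/(sortedP 0%N) => i; rewrite size_tuple => iN.
  rewrite !nl ?(ltnW iN) //= /geq /=.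
  have := ps i; rewrite sp => /(_ iN) /=; lia.
exists (exist _ l ls); apply: (@eq_from_nth _ 0%N); rewrite size_sigS ?sp // => i iN.
by rewrite nth_sigS //= nl // subnK // pge //; lia.
Qed.

Lemma bits_bij M : set_bij [set lam | sig_le M lam]
  [set b : M.-tuple bool | count id b = N] (fun lam => bits M (mem (sigS lam))).
Proof.
have sz (b : M.-tuple bool) : size (true_pos 1 b) = count id b.
  case: b => b /= _; elim: b (1%N) => //= x b IH i.
  by case: x; rewrite /= IH.
split.
- move=> lam lamM; have := sz (bits M (mem (sigS lam))).
  by rewrite -size_rev true_pos_sig // size_sigS => /esym.
- move=> lam mu /[!inE] /= lamM muM e; apply: sig_eq.
  by rewrite -(true_pos_sig lamM) e true_pos_sig.
- move=> b /= bN.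
  have s1 : size (rev (true_pos 1 b)) = N by rewrite size_rev sz bN.
  have s2 : sorted gtn (rev (true_pos 1 b)).
    rewrite rev_sorted true_posE; apply: sorted_filter; last exact: iota_ltn_sorted.
    exact: ltn_trans.
  have s3 : all (fun i => 0 < i)%N (rev (true_pos 1 b)).
    by apply/allP => p; rewrite mem_rev true_posE mem_filter mem_iota => /andP[_ /andP[]].
  have [lam lamE] := sig_of_seq s1 s2 s3.
  have lamM : sig_le M lam.
    apply/allP => p; rewrite lamE mem_rev true_posE mem_filter mem_iota size_tuple.
    by move=> /andP[_ /andP[_]].
  exists lam => //; apply/eq_from_tnth => i; rewrite tnth_mktuple lamE.
  rewrite topredE mem_rev true_posE mem_filter mem_iota size_tuple subn1 /=.
  by rewrite add1n ltnS ltn_ord andbT (tnth_nth false).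
Qed.

End SignatureBits.

(** * The weights of the model in free-fermionic form, and one row of G *)

Section VertexFreeFermion.
Variables (R : realType) (y s : nat -> R) (w th : R).

Definition colS p := s p ^- 2 * y p.
Definition wb1 p := (colS p - th ^- 2 * w) / (colS p - w).
Definition wb2 p := (y p - w) / (colS p - w).
Definition wc1 p := (th ^- 2 * w - w) / (colS p - w).
Definition wc2 p := (colS p - y p) / (colS p - w).

Lemma vertexW_ff p a b c d : colS p != w ->
  vertexW w (y p) th (s p) a b c d = ff_weight wb1 wb2 wc1 wc2 p a b c d.
Proof.
rewrite -subr_eq0 => Sw; rewrite /ff_weight /vertexW /wb1 /wb2 /wc1 /wc2 -!/(colS p).
case: a; case: b; case: c; case: d => //.
- by set o := th ^- 2 * w; field.
- by congr (_ / _); ring.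
- by congr (_ / _); rewrite /colS; ring.
Qed.

Lemma vertexW_conservation p a b c d :
  vertexW w (y p) th (s p) a b c d != 0 -> (a + b = c + d)%N.
Proof. by case: a; case: b; case: c; case: d; rewrite //= eqxx. Qed.

Lemma vertexWhat_conservation p a b c d :
  vertexWhat w (y p) th (s p) a b c d != 0 -> (a + b = c + d)%N.
Proof. by case: a; case: b; case: c; case: d; rewrite /vertexWhat //= mul0r eqxx. Qed.

End VertexFreeFermion.

Lemma eq_row_weight (F : fieldType) (U U' : nat -> bool -> bool -> bool -> bool -> F)
    i h al be out :
  (forall p a b c d, (i <= p)%N -> U p a b c d = U' p a b c d) ->
  row_weight U i h al be out = row_weight U' i h al be out.
Proof.
elim: al be i h => [|a al IH] [|b be] i h //= UU.
by rewrite !UU // !IH // => p *; apply: UU; exact: ltnW.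
Qed.

Section TransferStep.
Variables (R : realType) (N m : nat) (y s : nat -> R) (w th : R).
Hypothesis Sw : forall p, (1 <= p)%N -> colS y s p != w.

Lemma FG_G_row M (lam mu : signature N) : sig_le M lam -> sig_le M mu ->
  FG_G lam mu (fun _ : 'I_1 => w) y (fun _ => th) s =
  row_weight (ff_weight (wb1 y s w th) (wb2 y s w) (wc1 y s w th) (wc2 y s w)) 1 false
    (bits M (mem (sigS mu))) (bits M (mem (sigS lam))) false.
Proof.
move=> /allP lamM /allP muM; rewrite /FG_G (@sum_config_finite _ _ _ _ _ _ _ M).
- rewrite path_sum1; apply: eq_row_weight => p *; rewrite vertexW_ff //; exact: Sw.
- by move=> j p a b c d; exact: vertexW_conservation.
- by [].
- by move=> p Mp; apply/negbTE/negP => /muM; rewrite leqNgt Mp.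
- by move=> p Mp; apply/negbTE/negP => /lamM; rewrite leqNgt Mp.
Qed.

(** With exit vector 0, determinants containing an escaped path vanish, which expresses the empty
    right boundary of G. Rows with a wrong number of particles vanish by their length. The rows
    [Srows] are carried along untouched, for the bordering. *)
Lemma FG_G_transfer M (mu : signature N) (h : nat -> 'rV[R]_(N + m)) Srows :
  sig_le M mu -> size Srows = m ->
  \sum_(lam \in [set lam : signature N | sig_le M lam])
     FG_G lam mu (fun _ : 'I_1 => w) y (fun _ => th) s *
       wdet (map h (sigS lam) ++ Srows) =
  wdet (map (transfer_vec (wb1 y s w th) (wb2 y s w) (wc1 y s w th) (wc2 y s w) h 0 M.+1)
     (sigS mu) ++ Srows).
Proof.
move=> muM sS.
set tv := transfer_vec _ _ _ _ _ _ _.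
have := row_wedge (wb1 y s w th) (wb2 y s w) (wc1 y s w th) (wc2 y s w) h 0
  (wdet_wedge [::] Srows) 1 false (bits M (mem (sigS mu))) [::] [::].
rewrite /= !cats0 size_bits add1n -/tv -map_rev true_pos_sig // => <-.
rewrite sum_bitsE.
set W := ff_weight _ _ _ _.
transitivity (\sum_(b \in [set b : M.-tuple bool | count id b = N])
   row_weight W 1 false (bits M (mem (sigS mu))) b false *
     wdet (rev (map h (true_pos 1 b)) ++ Srows)).
  rewrite (reindex_fsbig _ _ _ _ (bits_bij N M)); apply: eq_fsbigr => lam.
  by rewrite inE /= => lamM; rewrite (FG_G_row lamM muM) -map_rev true_pos_sig.
rewrite (fsbigE (enum [pred b : M.-tuple bool | count id b == N])) ?enum_uniq //; first last.
- by move=> b /= bN; rewrite mem_enum inE /= bN eqxx.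
- by move=> b /=; rewrite mem_enum inE => /eqP.
rewrite big_enum_cond /= big_mkcond /=; apply: eq_bigr => b _.
have -> : wdet (rev ([seq h i | i <- true_pos 1 b] ++ [:: 0]) ++ Srows) = 0.
  exact: (wedge0 (wdet_wedge [::] Srows)).
rewrite mulr0 addr0.
rewrite !inE /=.
rewrite cats0; case: (eqVneq (count id b) N) => bN.
  by rewrite (@mem_set _ [set b0 : M.-tuple bool | count id b0 = N] b bN).
rewrite /=.
rewrite /wdet size_cat size_rev size_map sS.
have -> : size (true_pos 1 b) = count id b.
  case: b {bN} => b /= _; elim: b (1%N) => //= x b IH i.
  by case: x; rewrite /= IH.
by rewrite eqn_add2r (negPf bN) mulr0.
Qed.

End TransferStep.

Lemma wdet_mulmx (F : fieldType) n (l : seq 'rV[F]_n) (A : 'M[F]_n) :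
  wdet (map (fun v => v *m A) l) = wdet l * \det A.
Proof.
rewrite /wdet size_map; case: eqP => [sl|_]; last by rewrite mul0r.
rewrite -det_mulmx; congr (\det _); apply/row_matrixP => i.
by rewrite row_mul !rowK (nth_map 0) // sl.
Qed.

Lemma wdet_col0 (F : fieldType) n (l : seq 'rV[F]_n) (j : 'I_n) :
  all (fun v : 'rV[F]_n => v ord0 j == 0) l -> wdet l = 0.
Proof.
move=> /(all_nthP 0) l0; rewrite /wdet; case: eqP => // sl.
rewrite (expand_det_col _ j) big1 // => i _.
by rewrite mxE (eqP (l0 i _)) ?mul0r // sl.
Qed.

(** * Evaluation of F *)

Section FDeterminant.
Variables (R : realType) (n : nat).
Local Notation N := n.+1.
Variables (x r : 'I_N -> R) (y s : nat -> R).
Local Notation S := (colS y s).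
Hypothesis Sx : forall p k, (1 <= p)%N -> S p != x k.
Hypothesis yx : forall p k, (1 <= p)%N -> y p != x k.

Definition phi (a : nat) : 'rV[R]_N := newton_frac x (colN S a.-1) (colD y a).

(** Row [j] contributes one factor for every node [i >= j], that is, for every node not consumed by
    an earlier row. *)
Definition F_const : R :=
  \prod_(j < N) \prod_(i < N | (j <= i)%N) (x i - r j ^- 2 * x j).

(** The state above the first [j] rows: [pre j] fills the first [j] coordinates with unit vectors,
    one for each escaped path, and [hh j] lives on the other coordinates, where it consists of
    divided differences at the remaining nodes. *)
Let hh (j b : nat) : 'rV[R]_N := newton_frac x (newton_poly x j * colN S b.-1) (colD y b).
Let pre (j : nat) : seq 'rV[R]_N := [seq newton_row x (newton_poly x i) | i <- iota 0 j].
Let om (j : 'I_N) := r j ^- 2 * x j.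

Let gD a : nonvanishing x (colD y a).
Proof. by apply: nonvanishing_colD => p k p1; rewrite eq_sym yx. Qed.

Let EM M (j : 'I_N) := (colN S M).[x j] / (colD y M).[x j].

Let EM_neq0 M j : EM M j != 0.
Proof.
rewrite /EM mulf_neq0 ?invr_eq0 ?gD //.
elim: M => [|M IH]; first by rewrite /colN big_geq // hornerC oner_neq0.
by rewrite colNS hornerM hornerXsubC mulf_neq0 // subr_eq0 eq_sym Sx.
Qed.

(** The escaping path is given the unit vector at [j]. The boundary term is linear in [hh j], so the
    whole row acts by a single upper triangular matrix, and its determinant supplies the factor. *)
Lemma row_step M (j : 'I_N) (al : M.-tuple bool) :
  \sum_(ga : M.-tuple bool)
    row_weight (fun p => vertexWhat (x j) (y p) (r j) (s p)) 1 false al ga true *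
      wdet (pre j.+1 ++ rev (map (hh j.+1) (true_pos 1 ga))) =
  (\prod_(i < N | (j <= i)%N) (x i - om j)) *
    wdet (pre j ++ rev (map (hh j) (true_pos 1 al))).
Proof.
have Sxj p : (1 <= p)%N -> S p != x j by move=> p1; exact: Sx.
set b1 := wb1 y s (x j) (r j); set b2 := wb2 y s (x j).
set c1 := wc1 y s (x j) (r j); set c2 := wc2 y s (x j).
pose ev : 'rV[R]_N := delta_mx 0 j.
set Z := row_weight (ff_weight b1 b2 c1 c2).
(* The normalization of What gathers into the vacuum eigenvalue at [x_j]. *)
have hat (ga : M.-tuple bool) :
    row_weight (fun p => vertexWhat (x j) (y p) (r j) (s p)) 1 false al ga true =
    EM M j * Z 1%N false al ga true.
  pose c p := (S p - x j) / (y p - x j).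
  rewrite (@row_weight_scale _ c (fun p => vertexW (x j) (y p) (r j) (s p))); first last.
  - by rewrite !size_tuple.
  - move=> p a b a' b'; rewrite /vertexWhat mulrC; congr (_ * _).
    by rewrite /c /= invf_div.
  congr (_ * _); last by apply: eq_row_weight => p *; rewrite vertexW_ff ?Sxj.
  rewrite size_tuple /EM; elim: (M) => [|m IH].
    by rewrite big_ord0 /colN /colD !big_geq // !hornerC divr1.
  rewrite big_ord_recr /= IH colNS colDS !hornerM !hornerXsubC add1n /c mulf_div.
  by rewrite -[S _ - _]opprB -[y _ - _]opprB !mulrN mulNr invrN mulrN opprK.
(* Without an escaping path column [j] is zero: [hh j.+1] contains the factor [X - x_j], and [pre j]
   does not reach this coordinate. *)
have lin0 (ga : M.-tuple bool) : wdet (pre j ++ rev (map (hh j.+1) (true_pos 1 ga))) = 0.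
  apply: (@wdet_col0 _ _ _ j); rewrite all_cat all_rev !all_map.
  apply/andP; split; apply/allP => i /=.
    rewrite mem_iota add0n => /andP[_ ij].
    by rewrite (newton_row_poly x (Ordinal (ltn_trans ij (ltn_ord j)))) mxE eqxx -val_eqE /= gtn_eqF.
  move=> _; rewrite /hh newton_polyS -mulrA.
  have [_ ->] := newton_frac_shift j (('X - (x j)%:P) * colN S i.-1) (gD i).
  by rewrite hornerM hornerXsubC subrr !mul0r eqxx.
have preS l : wdet (pre j.+1 ++ rev l) = wdet (pre j ++ rev (l ++ [:: ev])).
  rewrite /pre -[j.+1]addn1 iotaD map_cat -catA rev_cat; congr (wdet (_ ++ _ :: _)).
  by rewrite add0n newton_row_poly.
pose hj := fun b => newton_frac x (newton_poly x j * ('X - (x j)%:P) * colN S b.-1) (colD y b * 1).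
have hjE : hh j.+1 =1 hj by move=> b; rewrite /hh /hj newton_polyS mulr1.
have := row_wedge b1 b2 c1 c2 hj ev (wdet_wedge (pre j) [::]) 1 false al [::] [::].
rewrite /= !cats0 size_tuple sum_bitsE add1n -/Z => rw.
transitivity (EM M j * wdet (pre j ++ rev
    [seq transfer_vec b1 b2 c1 c2 hj ev M.+1 i | i <- true_pos 1 al])).
  rewrite -rw big_distrr /=; apply: eq_bigr => ga _.
  by rewrite hat preS !cats0 -(eq_map hjE) lin0 mulr0 add0r mulrA.
(* By [exit_weightE] the exit weight from [a] is [- ka / EM M j] times coordinate [j] of [hh j a].
   The boundary term is thus a rank-one map sending the unit vector at [j] to [xi]; [L] adds it to
   multiplication by [X - om j] and fixes the first [j] unit vectors. *)
pose ka := om j - x j.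
pose xi : 'rV[R]_N := (ka / EM M j) *:
   (newton_frac x (newton_poly x j * colN S M) (colD y M) - ev).
pose L : 'M[R]_N := \matrix_(i, k)
   (if (i < j)%N then (i == k)%:R
    else horner_mx (jordan x) ('X - (om j)%:P) i k + (i == j)%:R * xi ord0 k).
have [xi0 xij] := newton_frac_shift j (colN S M) (gD M).
have xi_lt (k : 'I_N) : (k < j)%N -> xi ord0 k = 0.
  move=> kj; rewrite /xi mxE [X in _ * X]mxE xi0 // !mxE sub0r (_ : (k == j) = false) ?oppr0 ?mulr0 //.
  by rewrite -val_eqE /= ltn_eqF.
have xi_j : xi ord0 j = ka / EM M j * (EM M j - 1).
  by rewrite /xi mxE [X in _ * X]mxE xij !mxE !eqxx.
(* Coordinate [j] of [xi] turns the diagonal entry [x_j - om_j] into its quotient by [EM M j], which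
   cancels the normalization of What. *)
have detL : \det L = (EM M j)^-1 * \prod_(i < N | (j <= i)%N) (x i - om j).
  rewrite det_upper => [|i k ki]; last first.
    rewrite mxE; case: ifP => ij.
      by rewrite -val_eqE /= gtn_eqF.
    rewrite hJ_upper // add0r; case: eqP => [ij'|_]; last by rewrite mul0r.
    by rewrite xi_lt ?mulr0 // -ij'.
  rewrite (bigID (fun i : 'I_N => (i < j)%N)) /= big1 => [|i ij]; last first.
    by rewrite mxE ij eqxx.
  rewrite mul1r; under eq_bigl do rewrite -leqNgt.
  rewrite (bigD1 j) //= [in RHS](bigD1 j) //= mulrA; congr (_ * _).
    rewrite mxE ltnn eqxx hJ_diag hornerXsubC xi_j mul1r /ka.
    have := EM_neq0 M j; set E := EM M j => E0.
    by field.
  apply: eq_bigr => i /andP[ji ij]; rewrite mxE ltnNge ji /= hJ_diag hornerXsubC.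
  by rewrite (negPf ij) mul0r addr0.
have rows : pre j ++ rev [seq transfer_vec b1 b2 c1 c2 hj ev M.+1 i | i <- true_pos 1 al] =
   map (fun v => v *m L) (pre j ++ rev (map (hh j) (true_pos 1 al))).
  rewrite map_cat map_rev -map_comp; congr (_ ++ rev _).
    rewrite /pre -?map_comp; apply/eq_in_map => i; rewrite mem_iota add0n => /andP[_ ij] /=.
    rewrite (newton_row_poly x (Ordinal (ltn_trans ij (ltn_ord j)))).
    by rewrite -rowE; apply/rowP => k; rewrite !mxE /= ij ?eqxx /= eq_sym.
  rewrite -?map_comp; apply/eq_in_map => a;
  rewrite true_posE mem_filter mem_iota size_tuple => /andP[_ /andP[a1 aM]] /=.
  rewrite add1n ltnS in aM.
  have yxj p k : (1 <= p)%N -> x k != y p by move=> p1; rewrite eq_sym yx.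
  rewrite (@transfer_vecE _ _ x y S yxj (x j) (om j) Sxj (newton_poly x j) 1 ev
    (@nonvanishing1 _ _ x) M a a1 aM) !mulr1.
  have [v0 vj] := newton_frac_shift j (colN S a.-1) (gD a).
  rewrite -/(hh j a) in v0 vj *.
  have -> : newton_frac x (newton_poly x j * ('X - (om j)%:P) * colN S a.-1) (colD y a) =
      hh j a *m horner_mx (jordan x) ('X - (om j)%:P).
    by rewrite newton_fracMr //; congr (newton_frac _ _ _); rewrite -!mulrA [_ * colN _ _]mulrC.
  have ew := @exit_weightE _ y S (x j) (om j) Sxj M a a1 aM (fun p p1 => yx j p1).
  have -> : c1 a * pass_weight y S (x j) a.+1 (M - a) = - (ka / EM M j * hh j a ord0 j).
    rewrite vj; apply: (mulIf (EM_neq0 M j)); rewrite ew -/ka.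
    by rewrite mulNr mulrAC divfK ?EM_neq0.
  rewrite scaleNr opprK.
  apply/rowP => k; rewrite [in RHS]mxE.
  under [RHS]eq_bigr => i _.
    have -> : hh j a ord0 i * L i k = hh j a ord0 i * horner_mx (jordan x) ('X - (om j)%:P) i k +
        (if i == j then hh j a ord0 i * xi ord0 k else 0).
      rewrite [L i k]mxE; case: ifP => ij; first by rewrite v0 // !mul0r if_same addr0.
      by case: eqP => _; rewrite ?mul1r ?mul0r ?addr0 // mulrDr.
    over.
  rewrite big_split /= -big_mkcond big_pred1_eq [LHS]mxE [X in X + _]mxE; congr (_ + _).
  rewrite [LHS]mxE /xi [X in _ = _ * X]mxE; ring.
rewrite rows wdet_mulmx detL.
have := EM_neq0 M j; set E := EM M j => E0.
by rewrite mulrCA [E * _]mulrA mulfV // mul1r mulrC.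
Qed.

Lemma FG_F_path (lam : signature N) M : sig_le M lam ->
  FG_F lam x y r s =
  path_sum (fun (j : 'I_N) (a b : M.-tuple bool) =>
      row_weight (fun p => vertexWhat (x j) (y p) (r j) (s p)) 1 false a b true)
    (bits M (mem (sigS lam))) (bits M pred0).
Proof.
move=> lamM; rewrite /FG_F (@sum_config_finite _ _ _ _ _ _ _ M) //.
- by move=> j p a b c d; exact: vertexWhat_conservation.
- move=> j p Mp; rewrite /vertexWhat divff //= mulf_neq0 ?invr_eq0 // subr_eq0 ?yx //.
  + by apply: leq_ltn_trans Mp.
  + by apply: Sx; apply: leq_ltn_trans Mp.
- move=> p Mp; apply/negbTE/negP => ps; move/allP: lamM => /(_ _ ps).
  by rewrite leqNgt Mp.
Qed.

Lemma FG_F_det (lam : signature N) :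
  FG_F lam x y r s = F_const * wdet (map phi (sigS lam)).
Proof.
pose M := \max_(p <- sigS lam) p.
have lamM : sig_le M lam by exact: sig_le_max.
rewrite (FG_F_path lamM).
pose rw (j : nat) (a b : M.-tuple bool) :=
  row_weight (fun p => vertexWhat (x (inord j)) (y p) (r (inord j)) (s p)) 1 false a b true.
(* [k] counts the top rows already summed. For [k = 0] only the empty state contributes, with the
   determinant of the identity; any other state gives a list that is too long. *)
suff H k : (k <= N)%N -> forall al : M.-tuple bool,
    path_sum (fun j : 'I_k => rw (N - k + j)%N) al (bits M pred0) =
    (\prod_(j < N | (N - k <= j)%N) \prod_(i < N | (j <= i)%N) (x i - r j ^- 2 * x j)) *
      wdet (pre (N - k)%N ++ rev (map (hh (N - k)%N) (true_pos 1 al))).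
  have := H N (leqnn N) (bits M (mem (sigS lam))).
  rewrite subnn /= -map_rev true_pos_sig // => e.
  transitivity (path_sum (fun j : 'I_N => rw (0 + j)%N) (bits M (mem (sigS lam))) (bits M pred0)).
    by apply: eq_bigr => v _; apply: eq_bigr => j _; rewrite /rw add0n inord_val.
  rewrite e /F_const; congr (_ * wdet _); apply: eq_map => a.
  by rewrite /hh /phi /newton_poly big_pred0 // mul1r.
elim: k => [|k IH] kN al.
  rewrite path_sum0 subn0 big_pred0 ?mul1r; last by move=> j; rewrite leqNgt ltn_ord.
  have -> : (al == bits M pred0) = (size (true_pos 1 al) == 0)%N.
    apply/eqP/eqP => [->|].
      by rewrite true_pos_bits; elim: (iota 1 M).
    case: al => al sal /= h; apply/val_inj/(@eq_from_nth _ false) => /=.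
      by rewrite size_map size_enum_ord (eqP sal).
    move=> i; rewrite (eqP sal) => iM.
    rewrite (nth_map (Ordinal iM)) ?size_enum_ord //=.
    apply/negbTE/negP => ti; move/eqP: h; apply/negP; rewrite -lt0n -has_predT.
    by apply/hasP; exists i.+1 => //; rewrite true_posE mem_filter subn1 ti mem_iota (eqP sal) /= add1n ltnS.
  case: (posnP (size (true_pos 1 al))) => sz.
    move/size0nil: sz => ->; rewrite (_ : rev _ = [::]) // cats0 /wdet /pre size_map size_iota eqxx.
    rewrite (_ : \matrix_i _ = 1%:M) ?det1 //.
    apply/row_matrixP => i; rewrite rowK (nth_map 0%N) ?size_iota // nth_iota // add0n.
    by rewrite newton_row_poly row1.
  rewrite /wdet size_cat /pre size_rev !size_map size_iota.
  by rewrite -[X in _ == X]addn0 eqn_add2l gtn_eqF.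
have kN' : (k <= N)%N by exact: ltnW.
have jN : (N - k.+1 < N)%N by lia.
pose j := Ordinal jN.
have jS : (N - k = j.+1)%N by rewrite /=; lia.
rewrite path_sumS.
have -> : \prod_(j0 < N | (N - k.+1 <= j0)%N) \prod_(i < N | (j0 <= i)%N) (x i - r j0 ^- 2 * x j0) =
   (\prod_(i < N | (j <= i)%N) (x i - om j)) *
   \prod_(j0 < N | (N - k <= j0)%N) \prod_(i < N | (j0 <= i)%N) (x i - r j0 ^- 2 * x j0).
  rewrite (bigD1 j) ?leqnn //=; congr (_ * _); apply: eq_bigl => i.
  by rewrite -val_eqE jS /=; case: ltngtP.
have rs := row_step j al; rewrite -jS in rs.
rewrite mulrAC -rs mulrC {rs}.
rewrite big_distrr /=; apply: eq_bigr => ga _.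
rewrite addn0 /rw (_ : inord (N - k.+1) = j); last by apply/val_inj; rewrite /= inordK.
rewrite mulrCA; congr (_ * _); apply: (etrans _ (IH kN' ga)).
apply: eq_bigr => v _; apply: eq_bigr => i _.
by rewrite /rw /= (_ : N - k.+1 + bump 0 i = N - k + i)%N // /bump /=; lia.
Qed.

End FDeterminant.

(** * Infinite sums *)

Section Limits.
Variable R : realType.
Implicit Types u v : nat -> R.

(** The error term is there because each higher divided difference of the vacuum is driven by the
    one before it. *)
Lemma cvg_contraction u e (q : R) : 0 <= q < 1 ->
  (forall M, `|u M.+1| <= q * `|u M| + e M) ->
  e @ \oo --> 0 -> u @ \oo --> 0.
Proof.
move=> /andP[q0 q1] ue e0; apply/cvgr0Pnorm_le => eps eps0.
have q1' : 0 < 1 - q by rewrite subr_gt0.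
have : \forall M \near \oo, `|e M| <= eps / 2 * (1 - q).
  by move/cvgr0Pnorm_le: e0; apply; rewrite mulr_gt0 // divr_gt0.
case=> M0 _ hM0.
have bound k : `|u (M0 + k)%N| <= eps / 2 + q ^+ k * `|u M0|.
  elim: k => [|k IH]; first by rewrite addn0 expr0 mul1r; lra.
  rewrite addnS; apply: (le_trans (ue _)).
  have := hM0 (M0 + k)%N (leq_addr _ _); rewrite /= ler_norml => /andP[_ h].
  have : q * `|u (M0 + k)%N| <= q * (eps / 2 + q ^+ k * `|u M0|) by rewrite ler_wpM2l.
  rewrite mulrDr mulrA -exprS => h'.
  by lra.
have qk : (fun k => q ^+ k * `|u M0|) @ \oo --> 0.
  rewrite -[X in _ --> X](mul0r `|u M0|); apply: cvgMl.
  by apply: cvg_expr; rewrite ger0_norm.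
have : \forall k \near \oo, `|q ^+ k * `|u M0| | <= eps / 2.
  by move/cvgr0Pnorm_le: qk; apply; rewrite divr_gt0.
case=> k0 _ hk0.
exists (M0 + k0)%N => // M /= MM.
have kM : (k0 <= M - M0)%N by lia.
have := bound (M - M0)%N; rewrite subnKC; last by lia.
move=> /le_trans; apply.
by have := hk0 _ kM; rewrite /= ler_norml => /andP[_]; lra.
Qed.

Lemma cvg_sum_seq (I : Type) (s : seq I) (P : pred I) (f : nat -> I -> R) (l : I -> R) :
  (forall i, P i -> f ^~ i @ \oo --> l i) ->
  (fun M => \sum_(i <- s | P i) f M i) @ \oo --> \sum_(i <- s | P i) l i.
Proof. by move=> h; apply: cvg_big => //; exact: add_continuous. Qed.

Lemma cvg_prod_seq (I : Type) (s : seq I) (P : pred I) (f : nat -> I -> R) (l : I -> R) :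
  (forall i, P i -> f ^~ i @ \oo --> l i) ->
  (fun M => \prod_(i <- s | P i) f M i) @ \oo --> \prod_(i <- s | P i) l i.
Proof. by move=> h; apply: cvg_big => //; exact: mul_continuous. Qed.

Lemma cvg_det n (A : nat -> 'M[R]_n) (B : 'M[R]_n) :
  (forall i j, (fun M => A M i j) @ \oo --> B i j) ->
  (fun M => \det (A M)) @ \oo --> \det B.
Proof.
move=> AB; apply: cvg_sum_seq => s _; apply: cvgMr.
by apply: cvg_prod_seq => i _; exact: AB.
Qed.

Lemma cvg_mulmx m n p (A : nat -> 'M[R]_(m, n)) (B : 'M[R]_(m, n)) (C : 'M[R]_(n, p)) :
  (forall i j, (fun M => A M i j) @ \oo --> B i j) ->
  forall i j, (fun M => (A M *m C) i j) @ \oo --> (B *m C) i j.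
Proof.
move=> AB i j; rewrite mxE; under eq_cvg do rewrite mxE.
by apply: cvg_sum_seq => k _; apply: cvgMl; exact: AB.
Qed.

End Limits.

Section Esum.
Variable R : realType.

Lemma esum_exhaust (I : choiceType) (a : I -> R) (X : nat -> set I) (L : R) :
  (forall i, 0 <= a i) -> (forall M, finite_set (X M)) ->
  (forall M M', (M <= M')%N -> X M `<=` X M') -> (forall i, exists M, X M i) ->
  (fun M => \sum_(i \in X M) a i) @ \oo --> L ->
  \esum_(i in [set: I]) (a i)%:E = L%:E.
Proof.
move=> a0 Xfin Xmono Xcov aL.
have nd : {homo (fun M => \sum_(i \in X M) a i) : m n / (m <= n)%N >-> m <= n}.
  move=> m n mn; rewrite -lee_fin -!fsumEFin //.
  apply: lee_fsum_nneg_subset => //; last by move=> i _; rewrite lee_fin.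
  by move=> i; rewrite !inE; exact: Xmono.
have leL M : \sum_(i \in X M) a i <= L.
  by rewrite -(cvg_lim _ aL) //; apply: nondecreasing_cvgn_le => //; apply/cvg_ex; exists L.
apply/eqP; rewrite eq_le; apply/andP; split.
  apply: ge_ereal_sup => /= _ [F [finF _] <-].
  have [M FM] : exists M, F `<=` X M.
    have [f hf] := choice Xcov.
    have /finite_seqP[sF FE] := finF.
    exists (\max_(i <- sF) f i) => i; rewrite FE /= => Fi.
    by apply: (Xmono (f i)) => //; apply: leq_bigmax_seq.
  rewrite fsumEFin // lee_fin; apply: le_trans (leL M).
  rewrite -lee_fin -!fsumEFin //.
  apply: lee_fsum_nneg_subset => //; last by move=> i _; rewrite lee_fin.
  by move=> i; rewrite !inE; exact: FM.
have leM M : ((\sum_(i \in X M) a i)%:E <= \esum_(i in [set: I]) (a i)%:E)%E.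
  by apply: esum_ge; exists (X M); [split|rewrite fsumEFin].
case: (\esum_(i in _) _) leM => [K leM|leM|leM]; last 2 first.
- by rewrite leey.
- by have := leM 0%N.
rewrite lee_fin -(cvg_lim _ aL) //; apply: limr_le; first by apply/cvg_ex; exists L.
by apply: nearW => M; rewrite -lee_fin.
Qed.

Lemma esumZ (I : choiceType) (a : I -> R) (c L : R) : 0 <= c ->
  (forall i, 0 <= a i) ->
  \esum_(i in [set: I]) (a i)%:E = L%:E ->
  \esum_(i in [set: I]) (c * a i)%:E = (c * L)%:E.
Proof.
move=> c0 a0 aL.
have sub (b : I -> R) d K : 0 <= d -> (forall i, 0 <= b i) ->
    \esum_(i in [set: I]) (b i)%:E = K%:E ->
    (\esum_(i in [set: I]) (d * b i)%:E <= (d * K)%:E)%E.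
  move=> d0 b0 bK; apply: ge_ereal_sup => /= _ [F [finF FT] <-].
  rewrite fsumEFin // lee_fin -mulr_fsumr ler_wpM2l // -lee_fin -bK.
  by apply: esum_ge; exists F => //; rewrite fsumEFin.
have [c_eq0|c_neq0] := eqVneq c 0.
  by rewrite c_eq0 mul0r; apply: esum1 => i _; rewrite mul0r.
have le1 := sub a c L c0 a0 aL.
have ca0 i : 0 <= c * a i by exact: mulr_ge0.
have ge0 : (0 <= \esum_(i in [set: I]) (c * a i)%:E)%E.
  by apply: esum_ge0 => i _; rewrite lee_fin.
have [K cK] : exists K, \esum_(i in [set: I]) (c * a i)%:E = K%:E.
  by move: ge0 le1; case: (\esum_(i in _) _) => // K _ _; exists K.
have := sub (fun i => c * a i) c^-1 K; rewrite invr_ge0 => /(_ c0 ca0 cK).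
under eq_esum do rewrite mulrA mulVf // mul1r.
rewrite aL lee_fin => le2; apply/eqP; rewrite cK; apply/eqP; congr (_%:E).
apply/eqP; rewrite eq_le; rewrite cK lee_fin in le1; rewrite le1 /=.
by rewrite -ler_pdivlMl // lt0r c_neq0.
Qed.

(** [V t i] is the total weight of the continuations from state [i] at time [t]. Nonnegativity
    allows the tail of the sequence to be summed before its first state. *)
Lemma esum_chain (I : choiceType) (i0 : I) (T : nat) (st : nat -> I -> I -> R)
    (F : I -> R) (V : nat -> I -> R) (i : I) :
  (forall t i j, 0 <= st t i j) -> (forall i, 0 <= F i) -> V T =1 F ->
  (forall t i, (t < T)%N ->
     \esum_(j in [set: I]) (st t i j * V t.+1 j)%:E = (V t i)%:E) ->
  \esum_(l in [set: T.-tuple I])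
     (\prod_(t < T) st t (nth i0 (i :: l) t) (tnth l t) * F (last i l))%:E = (V 0%N i)%:E.
Proof.
move=> st0 F0.
elim: T st V st0 i => [|T IH] st V st0 i VF stV.
  rewrite (_ : [set: 0.-tuple I] = [set [tuple]]); last first.
    by apply/seteqP; split => // l _; exact: tuple0.
  by rewrite esum_set1 ?big_ord0 ?mul1r ?VF // lee_fin.
pose cons (p : I * T.-tuple I) : T.+1.-tuple I := [tuple of p.1 :: p.2].
rewrite (reindex_esum [set: I * T.-tuple I] _ cons); last first.
  split=> //.
    by move=> [a l] [b l'] _ _ [] -> /val_inj ->.
  move=> l _; exists (thead l, [tuple of behead l]) => //.
  by rewrite [RHS]tuple_eta.
have -> : [set: I * T.-tuple I] = [set: I] `*`` (fun=> [set: T.-tuple I]).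
  by apply/seteqP.
pose f j (l : T.-tuple I) := st 0%N i j *
   (\prod_(t < T) st t.+1 (nth i0 (j :: l) t) (tnth l t) * F (last j l)).
transitivity (\esum_(p in [set: I] `*`` (fun=> [set: T.-tuple I])) (f p.1 p.2)%:E).
  apply: eq_esum => -[j l] _; congr (_%:E).
  rewrite big_ord_recl /f /= -!mulrA; congr (_ * (_ * _)).
  by apply: eq_bigr => t _; congr (st _ _ _); rewrite !(tnth_nth i0).
rewrite -(esum_esum (a := fun j l => (f j l)%:E)); last first.
  move=> j l _ _; rewrite lee_fin /f !mulr_ge0 // prodr_ge0 //.
rewrite -stV //; apply: eq_esum => j _.
apply: esumZ => //; first by move=> l; rewrite mulr_ge0 // prodr_ge0.
apply: (IH (fun t => st t.+1) (fun t => V t.+1)) => //.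
by move=> t j' tT; apply: stV.
Qed.

End Esum.

(** * One-particle weights, positivity and the limit of infinitely many columns *)

Section Hop.
Variables (F : fieldType) (b1 b2 c1 c2 : nat -> F).

Definition hop (a c : nat) : F :=
  if c == a then b1 a
  else if (a < c)%N then c1 a * (\prod_(a.+1 <= j < c) b2 j) * c2 c else 0.

Lemma path_vec_hop n (hh : nat -> 'rV[F]_n) i m :
  path_vec b2 c2 hh 0 i m =
  \sum_(i <= c < i + m) ((\prod_(i <= j < c) b2 j) * c2 c) *: hh c.
Proof.
elim: m i => [|m IH] i /=; first by rewrite addn0 big_geq.
rewrite IH addnS big_ltn ?leq_addr // big_geq // mul1r addSn.
congr (_ + _); rewrite scaler_sumr; apply: eq_big_nat => c /andP[ic _].
by rewrite scalerA mulrA [in RHS]big_ltn.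
Qed.

Lemma transfer_vec_hop n (hh : nat -> 'rV[F]_n) M a : (a <= M)%N ->
  transfer_vec b1 b2 c1 c2 hh 0 M.+1 a = \sum_(a <= c < M.+1) hop a c *: hh c.
Proof.
move=> aM; rewrite /transfer_vec path_vec_hop subSS [RHS]big_ltn // /hop eqxx.
congr (_ + _); rewrite scaler_sumr (_ : a.+1 + (M - a) = M.+1)%N; last by lia.
apply: eq_big_nat => c /andP[ac _].
by rewrite gtn_eqF // ac scalerA mulrA.
Qed.

End Hop.

Section Nonnegativity.
Variables (R : realType) (y s : nat -> R).
Local Notation S := (colS y s).

Lemma row_weight_ge0 (U : nat -> bool -> bool -> bool -> bool -> R) i h al be out :
  (forall p a b c d, (i <= p)%N -> 0 <= U p a b c d) -> 0 <= row_weight U i h al be out.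
Proof.
elim: al be i h => [|a al IH] [|b be] i h //= U0; rewrite ?ler0n //.
by rewrite addr_ge0 ?mulr_ge0 ?U0 ?IH // => p *; apply: U0; exact: ltnW.
Qed.

Section Vertex.
Variables (w th : R).
Hypothesis ineq : forall p, (1 <= p)%N -> [/\ w < y p, y p < th ^- 2 * w & th ^- 2 * w < S p].

Lemma vertexW_ge0 p a b c d : (1 <= p)%N -> 0 <= vertexW w (y p) th (s p) a b c d.
Proof.
move=> /ineq[h1 h2 h3]; rewrite /vertexW -!/(colS y s p).
have e1 : w * (th ^- 2 - 1) = th ^- 2 * w - w by ring.
have e2 : y p * (s p ^- 2 - 1) = S p - y p by rewrite /colS; ring.
by case: a; case: b; case: c; case: d => //; rewrite ?e1 ?e2 divr_ge0 //; lra.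
Qed.

Lemma vertexWhat_ge0 p a b c d : (1 <= p)%N -> 0 <= vertexWhat w (y p) th (s p) a b c d.
Proof. by move=> p1; rewrite /vertexWhat divr_ge0 // vertexW_ge0. Qed.

Lemma colS_neq p : (1 <= p)%N -> S p != w.
Proof. by move=> /ineq[h1 h2 h3]; apply/eqP; lra. Qed.

Lemma FG_G_ge0 N (lam mu : signature N) :
  0 <= FG_G lam mu (fun _ : 'I_1 => w) y (fun _ => th) s.
Proof.
pose M := maxn (\max_(p <- sigS lam) p) (\max_(p <- sigS mu) p).
rewrite (@FG_G_row _ _ _ _ _ _ colS_neq M).
- apply: row_weight_ge0 => p a b c d p1; rewrite -vertexW_ff ?colS_neq //.
  exact: vertexW_ge0.
- by apply: (sig_leS (leq_maxl _ _)); exact: sig_le_max.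
- by apply: (sig_leS (leq_maxr _ _)); exact: sig_le_max.
Qed.

End Vertex.
End Nonnegativity.

Section TransferLimit.
Variables (R : realType) (n : nat).
Local Notation N := n.+1.
Variables (x : 'I_N -> R) (y s : nat -> R) (w q : R).
Local Notation S := (colS y s).
Hypothesis xw : forall k, x k < w.
Hypothesis wy : forall p, (1 <= p)%N -> w < y p.
Hypothesis yS : forall p, (1 <= p)%N -> y p < S p.
Hypothesis q01 : 0 <= q < 1.
Hypothesis ratio : forall k p, (1 <= p)%N ->
  `|(S p - x k) / (y p - x k) * ((y p - w) / (S p - w))| <= q.

Let yx p k : (1 <= p)%N -> x k != y p.
Proof. by move=> p1; rewrite lt_eqF // (lt_trans (xw k)) ?wy. Qed.

Let Sw p : (1 <= p)%N -> S p != w.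
Proof. by move=> p1; rewrite gt_eqF // (lt_trans (wy p1)) ?yS. Qed.

Lemma mulmx_hJ_XsubC (v : 'rV[R]_N) c (j : 'I_N) :
  (v *m horner_mx (jordan x) ('X - c%:P)) ord0 j =
  v ord0 j * (x j - c) + \sum_(k < N | j == k.+1 :> nat) v ord0 k.
Proof.
rewrite rmorphB /= horner_mx_X horner_mx_C mulmxBr mul_mx_scalar !mxE.
rewrite mulrBr [c * _]mulrC addrAC; congr (_ - _).
rewrite (bigD1 j) //= mxE eqxx; congr (_ + _).
rewrite [RHS]big_mkcond [RHS](bigD1 j) //= ifF ?add0r; last by rewrite ltn_eqF.
apply: eq_bigr => k kj; rewrite mxE (negPf kj).
by case: eqP; rewrite ?mulr1 ?mulr0.
Qed.

Let H M : 'rV[R]_N := pass_weight y S w 1 M *: newton_frac x (colN S M) (colD y M).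

Let gD a : nonvanishing x (colD y a).
Proof. exact: nonvanishing_colD. Qed.

Lemma H_rec M : H M.+1 *m horner_mx (jordan x) ('X - (y M.+1)%:P) =
  ((y M.+1 - w) / (S M.+1 - w)) *: (H M *m horner_mx (jordan x) ('X - (S M.+1)%:P)).
Proof.
rewrite /H -!scalemxAl !newton_fracMr // scalerA; congr (_ *: _).
  by rewrite /pass_weight addnS big_nat_recr //= mulrC.
by apply: newton_frac_eq => //; rewrite colNS colDS; ring.
Qed.

(** [H_rec], read in one coordinate, is a recursion in [M]: contraction by the ratio of the
    hypothesis, plus terms in the previous coordinate, already known to tend to 0. *)
Lemma vacuum_cvg0 (j : 'I_N) : (fun M => H M ord0 j) @ \oo --> 0.
Proof.
case: j => j; elim: j => [|j IH] jN.
  apply: (@cvg_contraction _ _ (fun=> 0) q) => //; last exact: cvg_cst.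
  move=> M; have := congr1 (fun v : 'rV[R]_N => v ord0 (Ordinal jN)) (H_rec M).
  rewrite /= [RHS]mxE !mulmx_hJ_XsubC !big_pred0 ?addr0; try by move=> k; rewrite eq_sym.
  have yn : x (Ordinal jN) - y M.+1 != 0 by rewrite subr_eq0 yx.
  move=> e; have -> : H M.+1 ord0 (Ordinal jN) =
     ((S M.+1 - x (Ordinal jN)) / (y M.+1 - x (Ordinal jN)) * ((y M.+1 - w) / (S M.+1 - w)))
     * H M ord0 (Ordinal jN).
    apply: (mulIf yn); rewrite e.
    have Sn : S M.+1 - w != 0 by rewrite subr_eq0 Sw.
    have yn' : y M.+1 - x (Ordinal jN) != 0 by rewrite subr_eq0 eq_sym yx.
    by field; rewrite Sn yn'.
  by rewrite normrM ler_wpM2r // ratio.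
have jN' := ltnW jN.
have cu := IH jN'.
set j0 := Ordinal jN' in cu; set j1 := Ordinal jN.
(* Since [x_j < w < y_p], this bounds the inverse of [y_p - x_j] uniformly in [p]. *)
pose C := (w - x j1)^-1.
have C0 : 0 < C by rewrite invr_gt0 subr_gt0.
apply: (@cvg_contraction _ _ (fun M => C * (`|H M ord0 j0| + `|H M.+1 ord0 j0|)) q) => //; last first.
  rewrite -[X in _ --> X](mulr0 C); apply: cvgMr.
  rewrite -[X in _ --> X]addr0; apply: cvgD.
    by rewrite -[X in _ --> X](normr0 R); apply: cvg_norm.
  by rewrite -[X in _ --> X](normr0 R); apply: cvg_norm; rewrite (cvg_shiftS (fun M => H M ord0 j0)).
move=> M; have := congr1 (fun v : 'rV[R]_N => v ord0 j1) (H_rec M).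
have single (f : 'I_N -> R) : \sum_(k < N | j1 == k.+1 :> nat) f k = f j0.
  rewrite (big_pred1 j0) // => k /=; by rewrite eqSS eq_sym -val_eqE.
rewrite /= [RHS]mxE !mulmx_hJ_XsubC !single.
have xy : x j1 < y M.+1 by rewrite (lt_trans (xw _)) ?wy.
have yn : x j1 - y M.+1 != 0 by rewrite subr_eq0 yx.
have Sn : S M.+1 - w != 0 by rewrite subr_eq0 Sw.
have yn' : y M.+1 - x j1 != 0 by rewrite subr_eq0 eq_sym yx.
pose al := (y M.+1 - w) / (S M.+1 - w).
move=> e; have -> : H M.+1 ord0 j1 =
   ((S M.+1 - x j1) / (y M.+1 - x j1) * ((y M.+1 - w) / (S M.+1 - w))) * H M ord0 j1
   + (y M.+1 - x j1)^-1 * (H M.+1 ord0 j0 - al * H M ord0 j0).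
  apply: (mulIf yn); apply: (addIr (H M.+1 ord0 j0)); rewrite e /al.
  by field; rewrite Sn yn'.
apply: (le_trans (ler_normD _ _)); apply: lerD.
  by rewrite normrM ler_wpM2r // ratio.
rewrite normrM ler_pM //.
  have yx0 : 0 < y M.+1 - x j1 by rewrite subr_gt0.
  rewrite gtr0_norm ?invr_gt0 // /C lef_pV2 ?posrE ?subr_gt0 //.
  by rewrite lerD2r ltW // wy.
apply: (le_trans (ler_normB _ _)); rewrite addrC lerD2r normrM ler_piMl //.
have wyM : w < y M.+1 by exact: wy.
have ySM : y M.+1 < S M.+1 by exact: yS.
rewrite ger0_norm; first by rewrite ler_pdivrMr ?mul1r; lra.
by rewrite divr_ge0 //; lra.
Qed.

Lemma newton_frac_split p q' p' q'' : nonvanishing x q' -> nonvanishing x q'' ->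
  newton_frac x (p * p') (q' * q'') =
  newton_frac x p q' *m (horner_mx (jordan x) p' *m invmx (horner_mx (jordan x) q'')).
Proof.
move=> g1 g2; apply: (can_inj (mulmxK (hJ_unit g2))).
rewrite mulmxA mulmxKV ?hJ_unit // [LHS]newton_fracMr; last exact: nonvanishingM.
rewrite newton_fracMr //; apply: newton_frac_eq => //; try exact: nonvanishingM.
by ring.
Qed.

Lemma transfer_cvg (th : R) (g d : {poly R}) a (j : 'I_N) : (1 <= a)%N ->
  nonvanishing x d ->
  (fun M => transfer_vec (wb1 y s w th) (wb2 y s w) (wc1 y s w th) (wc2 y s w)
     (fun b => newton_frac x (g * colN S b.-1) (colD y b * d)) 0 M.+1 a ord0 j) @ \oo -->
  newton_frac x (g * ('X - (th ^- 2 * w)%:P) * colN S a.-1)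
    (colD y a * (d * ('X - w%:P))) ord0 j.
Proof.
move=> a1 gd.
have gw : nonvanishing x ('X - w%:P).
  by apply: nonvanishingXsubC => k; rewrite lt_eqF.
have gdw : nonvanishing x (d * ('X - w%:P)) by exact: nonvanishingM.
(* Expanding the fraction by [X - w] brings it to the form required by [transfer_vecE]. *)
have hE : (fun b => newton_frac x (g * colN S b.-1) (colD y b * d)) =
   (fun b => newton_frac x (g * ('X - w%:P) * colN S b.-1) (colD y b * (d * ('X - w%:P)))).
  apply/funext => b; apply: newton_frac_eq; try exact: nonvanishingM.
  by ring.
rewrite hE.
(* The boundary term crosses only the columns [a + 1] to [M], whereas [H M] contains all columns
   from 1 on; [K] divides by the excess. *)
pose K := wc1 y s w th a / pass_weight y S w 1 a.
pose Q := horner_mx (jordan x) g *m invmx (horner_mx (jordan x) (d * ('X - w%:P))).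
have lim : (fun M => newton_frac x (g * ('X - (th ^- 2 * w)%:P) * colN S a.-1)
    (colD y a * (d * ('X - w%:P))) ord0 j - K * (H M *m Q) ord0 j) @ \oo -->
    newton_frac x (g * ('X - (th ^- 2 * w)%:P) * colN S a.-1)
    (colD y a * (d * ('X - w%:P))) ord0 j.
  rewrite -[X in _ --> X]subr0; apply: cvgB; first exact: cvg_cst.
  rewrite -(mulr0 K); apply: cvgMr.
  have -> : 0 = ((0 : 'rV[R]_N) *m Q) ord0 j by rewrite mul0mx mxE.
  apply: cvg_mulmx => i k; rewrite mxE (ord1 i); exact: vacuum_cvg0.
apply: cvg_trans lim.
apply: near_eq_cvg; near=> M.
  have aM : (a <= M)%N by near: M; exists a.
  rewrite (@transfer_vecE _ _ x y S yx w (th ^- 2 * w) Sw g _ 0 gdw) // subr0.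
  apply/esym; rewrite [LHS]mxE; congr (_ + _); rewrite [LHS]mxE; congr (- _).
  rewrite [g * colN S M]mulrC newton_frac_split // -/Q /H -scalemxAl.
  rewrite [LHS]mxE [X in _ = _ * X]mxE mulrA -/(wc1 y s w th a); congr (_ * _).
  have pw i m : (1 <= i)%N -> pass_weight y S w i m != 0.
    move=> i1; rewrite /pass_weight prodf_seq_neq0; apply/allP => l.
    rewrite mem_index_iota => /andP[il _] /=.
    have l1 := leq_trans i1 il.
    by rewrite mulf_neq0 ?invr_eq0 ?subr_eq0 ?Sw // gt_eqF ?wy.
  rewrite /K; have -> : pass_weight y S w 1 M = pass_weight y S w 1 a * pass_weight y S w a.+1 (M - a).
    rewrite /pass_weight !add1n (_ : a.+1 + (M - a) = M.+1)%N; last by lia.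
    by rewrite -big_cat_nat.
  by rewrite mulrA divfK ?pw.
Unshelve. all: by end_near.
Qed.

End TransferLimit.

Lemma finite_sig_le N M : finite_set [set lam : signature N | sig_le M lam].
Proof.
have /card_set_bijP/eq_finite_set -> : exists f, set_bij [set lam : signature N | sig_le M lam]
  [set b : M.-tuple bool | count id b = N] f by exists (fun lam => bits M (mem (sigS lam))); exact: bits_bij.
exact: finite_finset.
Qed.

Lemma wdet_col_mx (F : fieldType) N m (l : seq 'rV[F]_(N + m)) (r : 'I_m -> 'rV[F]_(N + m)) :
  size l = N ->
  wdet (l ++ [seq r k | k <- enum 'I_m]) =
  \det (col_mx (\matrix_(i < N) nth 0 l i) (\matrix_k r k)).
Proof.
move=> sl; rewrite /wdet size_cat size_map size_enum_ord sl eqxx; congr (\det _).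
apply/row_matrixP => i; rewrite rowK nth_cat sl.
case: (split_ordP i) => j ->.
  by rewrite rowKu rowK.
rewrite /= addKn rowKd rowK (nth_map j) ?size_enum_ord //.
by rewrite nth_ord_enum.
Qed.

Section EsumTransfer.
Variables (R : realType) (N m : nat) (y s : nat -> R) (w th : R).
Hypothesis ineq : forall p, (1 <= p)%N ->
  [/\ w < y p, y p < th ^- 2 * w & th ^- 2 * w < colS y s p].

(** The constant [C] stays inside because nonnegativity is available for its product with the
    determinant, not for the determinant alone. *)
Lemma esum_transfer (C : R) (mu : signature N) (h gh : nat -> 'rV[R]_(N + m)) Srows :
  size Srows = m ->
  (forall a j, (1 <= a)%N -> (fun M => transfer_vec (wb1 y s w th) (wb2 y s w) (wc1 y s w th)
       (wc2 y s w) h 0 M.+1 a ord0 j) @ \oo --> gh a ord0 j) ->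
  (forall lam : signature N, 0 <= FG_G lam mu (fun _ : 'I_1 => w) y (fun _ => th) s *
     (C * wdet (map h (sigS lam) ++ Srows))) ->
  \esum_(lam in [set: signature N])
     (FG_G lam mu (fun _ : 'I_1 => w) y (fun _ => th) s *
       (C * wdet (map h (sigS lam) ++ Srows)))%:E =
  (C * wdet (map gh (sigS mu) ++ Srows))%:E.
Proof.
move=> sS hgh ge0; apply: (@esum_exhaust _ _ _ (fun M => [set lam | sig_le M lam])) => //.
- exact: finite_sig_le.
- by move=> M M' MM lam; exact: sig_leS.
- by move=> lam; exists (\max_(p <- sigS lam) p); exact: sig_le_max.
have lim : (fun M => wdet (map (transfer_vec (wb1 y s w th) (wb2 y s w) (wc1 y s w th)
   (wc2 y s w) h 0 M.+1) (sigS mu) ++ Srows)) @ \oo --> wdet (map gh (sigS mu) ++ Srows).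
  rewrite /wdet size_cat size_map size_sigS sS eqxx.
  under eq_cvg do rewrite size_cat size_map size_sigS sS eqxx.
  have entry (f : nat -> 'rV[R]_(N + m)) (i j : 'I_(N + m)) :
      (\matrix_(i < N + m) nth 0 (map f (sigS mu) ++ Srows) i) i j =
      if (i < N)%N then f (nth 0%N (sigS mu) i) ord0 j else nth 0 Srows (i - N) ord0 j.
    rewrite mxE nth_cat size_map size_sigS; case: ltnP => // iN.
    by rewrite (nth_map 0%N) ?size_sigS.
  apply: cvg_det => i j; rewrite entry; under eq_cvg do rewrite entry.
  case: ltnP => iN; last exact: cvg_cst.
  by apply: hgh; apply: (@sigS_gt0 _ mu); apply: mem_nth; rewrite size_sigS.
apply: cvg_trans (cvgMr (a := C) lim); apply: near_eq_cvg; near=> M.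
have muM : sig_le M mu.
  by apply: sig_leS (sig_le_max mu); near: M; exists (\max_(p <- sigS mu) p).
rewrite -(@FG_G_transfer _ _ _ _ _ _ _ (colS_neq ineq) M mu h Srows muM sS) mulr_fsumr.
by apply: eq_fsbigr => lam _; rewrite mulrCA.
Unshelve. all: by end_near.
Qed.

End EsumTransfer.

Section Insertion.
Variables (F : fieldType) (N m : nat).

(** [U] marks which particle, a row of [A], occupies each point of [P]; its columns are orthonormal
    because distinct points are occupied by distinct particles. Marks are subtracted from the
    particles while the unit row of each point is traded for the row of its particle. *)
Lemma det_insert (A A' : 'M[F]_(N, N + m)) (S S' : 'M[F]_(m, N + m)) (P : pred 'I_m)
    (U : 'M[F]_(N, m)) :
  (forall k, P k -> row k S = row_mx 0 (delta_mx 0 k)) ->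
  (forall k, P k -> row k S' = row k (U^T *m A)) ->
  (forall k, ~~ P k -> row k S' = row k S) ->
  (forall k i, ~~ P k -> U i k = 0) ->
  (forall k k', P k -> P k' -> (U^T *m U) k k' = (k == k')%:R) ->
  A' = A - row_mx 0 U ->
  \det (col_mx A' S') = \det (col_mx A S).
Proof.
move=> SP SP' SnP UnP UU ->.
(* The rows change by the left factor [[1, -U], [U^T, D]], of determinant 1. *)
pose D : 'M[F]_m := \matrix_(k, k') ((k == k') && ~~ P k)%:R.
have e : col_mx (A - row_mx 0 U) S' = block_mx 1%:M (- U) U^T D *m col_mx A S.
  rewrite mul_block_col mul1mx mulNmx; congr (col_mx (_ - _) _).
    have -> : row_mx 0 U = U *m (row_mx 0 1%:M : 'M[F]_(m, N + m)).
      by rewrite mul_mx_row mulmx0 mulmx1.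
    apply/matrixP => i l; rewrite [LHS]mxE [RHS]mxE; apply: eq_bigr => k _.
    case: (boolP (P k)) => Pk; last by rewrite UnP // !mul0r.
    congr (_ * _); have : row k S = row k (row_mx 0 1%:M).
      by rewrite SP // row_row_mx row0 row1.
    by move/rowP/(_ l); rewrite [LHS]mxE [RHS]mxE.
  apply/row_matrixP => k; rewrite linearD /=.
  have DS : row k (D *m S) = (~~ P k)%:R *: row k S.
    rewrite row_mul mulmx_sum_row (bigD1 k) //= big1 ?addr0 => [|k' kk'].
      by rewrite !mxE eqxx.
    by rewrite !mxE eq_sym (negPf kk') scale0r.
  rewrite DS; case: (boolP (P k)) => Pk; first by rewrite scale0r addr0 SP'.
  rewrite scale1r SnP // row_mul [row k U^T](_ : _ = 0) ?mul0mx ?add0r //.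
  by apply/rowP => i; rewrite !mxE UnP.
rewrite e det_mulmx.
have -> : \det (block_mx 1%:M (- U) U^T D) = 1; last by rewrite mul1r.
have e2 : block_mx 1%:M 0 (- U^T) 1%:M *m block_mx 1%:M (- U) U^T D =
   block_mx 1%:M (- U) 0 1%:M :> 'M[F]_(N + m).
  rewrite mulmx_block !mul1mx !mul0mx !mulmx1 !addr0 addNr mulmxN mulNmx opprK.
  congr (block_mx _ _ _ _); apply/matrixP => k k'; rewrite [LHS]mxE [D k k']mxE [RHS]mxE.
  case: (boolP (P k)) => Pk /=.
    case: (boolP (P k')) => Pk'; first by rewrite UU // andbF addr0.
    rewrite andbF addr0 mxE big1 => [|i _]; last by rewrite UnP ?mulr0.
    by case: eqP Pk' => [<-|//]; rewrite Pk.
  by rewrite andbT mxE big1 ?add0r // => i _; rewrite mxE UnP ?mul0r.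
have := congr1 determinant e2.
by rewrite det_mulmx det_lblock det_ublock !det1 !mul1r.
Qed.

End Insertion.

Lemma transfer_vec_row (F : fieldType) N m b1 b2 c1 c2 (f : nat -> 'rV[F]_N)
    (g : nat -> 'rV[F]_m) e a :
  transfer_vec b1 b2 c1 c2 (fun b => row_mx (f b) (g b)) 0 e a =
  row_mx (transfer_vec b1 b2 c1 c2 f 0 e a) (transfer_vec b1 b2 c1 c2 g 0 e a).
Proof.
have pv i k : path_vec b2 c2 (fun b => row_mx (f b) (g b)) 0 i k =
    row_mx (path_vec b2 c2 f 0 i k) (path_vec b2 c2 g 0 i k).
  elim: k i => [|k IH] i /=; first by rewrite row_mx0.
  by rewrite IH !scale_row_mx add_row_mx.
by rewrite /transfer_vec pv !scale_row_mx add_row_mx.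
Qed.

(** * Inserting the points of the configuration *)

Section ManyStep.
Variables (F : fieldType) (y S : nat -> F) (w om : nat -> F).

(* One-particle transition weights of the row with parameters (w_t, om_t), and
   of the n consecutive rows t, ..., t + n - 1. *)
Definition hop_at (t : nat) : nat -> nat -> F :=
  hop (fun p => (S p - om t) / (S p - w t)) (fun p => (y p - w t) / (S p - w t))
      (fun p => (om t - w t) / (S p - w t)) (fun p => (S p - y p) / (S p - w t)).

Fixpoint hops (t n a b : nat) : F :=
  if n is n'.+1 then \sum_(a <= c < b.+1) hop_at t a c * hops t.+1 n' c b
  else (a == b)%:R.

Lemma hops_gt t n a b : (b < a)%N -> hops t n a b = 0.
Proof. by case: n => [|n] ba /=; [rewrite gtn_eqF|rewrite big_geq]. Qed.

End ManyStep.

Section Chain.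
Variables (R : realType) (n m T : nat).
Local Notation N := n.+1.
Variables (x r : 'I_N -> R) (w th : nat -> R) (y s : nat -> R).
Variables (pt pa : 'I_m -> nat).
Local Notation S := (colS y s).
Let om t := th t ^- 2 * w t.

Hypothesis ineq_x : forall k p, (1 <= p)%N ->
  [/\ x k < y p, y p < r k ^- 2 * x k & r k ^- 2 * x k < S p].
Hypothesis ineq_w : forall t p, (1 <= p)%N ->
  [/\ w t < y p, y p < om t & om t < S p].
Hypothesis xw : forall k t, x k < w t.
Variable q : nat -> R.
Hypothesis q01 : forall t, 0 <= q t < 1.
Hypothesis ratio : forall k t p, (1 <= p)%N ->
  `|(S p - x k) / (y p - x k) * ((y p - w t) / (S p - w t))| <= q t.
Hypothesis pt_lt : forall k, (pt k < T)%N.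
Hypothesis pt_inj : forall k k', pt k = pt k' -> pa k = pa k' -> k = k'.

(** Numerator of the factor that the rows [t, ..., T - 1], still to come at time [t], put on the
    single-particle functions. *)
Definition tau_num (t : nat) : {poly R} := \prod_(t <= d < T) ('X - (om d)%:P).
Definition tau_den (t : nat) : {poly R} := \prod_(t <= d < T) ('X - (w d)%:P).

Definition phi_at (t b : nat) : 'rV[R]_N :=
  newton_frac x (tau_num t * colN S b.-1) (colD y b * tau_den t).

Definition hops_at : nat -> nat -> nat -> nat -> R := hops y S w om.

(** Minus the transition weights to the points after time [t]. [later_eq] includes the points at
    time [t] itself, where zero rows give an indicator; the difference of the two is the marking
    subtracted in [det_insert]. A point with [pt k = t] belongs to the signature after row [t],
    hence the successor. *)
Definition later (t b : nat) : 'rV[R]_m :=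
  \row_k (if (t <= pt k)%N then - hops_at t ((pt k).+1 - t) b (pa k) else 0).
Definition later_eq (t b : nat) : 'rV[R]_m :=
  \row_k (if (t <= (pt k).+1)%N then - hops_at t ((pt k).+1 - t) b (pa k) else 0).

Definition ext_vec (t b : nat) : 'rV[R]_(N + m) := row_mx (phi_at t b) (later t b).
Definition ext_vec_eq (t b : nat) : 'rV[R]_(N + m) := row_mx (phi_at t b) (later_eq t b).

(* The row bordering [ext_det t] for the point [k]: a unit row once the time of
   the point has been summed over. *)
Definition ext_row (t : nat) (k : 'I_m) : 'rV[R]_(N + m) :=
  if (t <= pt k)%N then ext_vec (pt k).+1 (pa k) else row_mx 0 (delta_mx 0 k).

Definition ext_det (t : nat) (mu : signature N) : R :=
  wdet (map (ext_vec t) (sigS mu) ++ [seq ext_row t k | k <- enum 'I_m]).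

Definition hits (t : nat) (lam : signature N) : bool :=
  [forall k, (pt k == t) ==> (pa k \in sigS lam)].

Let Sx p k : (1 <= p)%N -> S p != x k.
Proof. by move=> p1; have [h1 h2 h3] := ineq_x k p1; apply/eqP; lra. Qed.
Let yx p k : (1 <= p)%N -> y p != x k.
Proof. by move=> p1; have [h1 h2 h3] := ineq_x k p1; apply/eqP; lra. Qed.
Let wy t p : (1 <= p)%N -> w t < y p.
Proof. by move=> p1; case: (ineq_w t p1). Qed.
Let yS p : (1 <= p)%N -> y p < S p.
Proof. by move=> p1; have [h1 h2 h3] := ineq_w 0 p1; lra. Qed.

Lemma nonvanishing_tau_den t : nonvanishing x (tau_den t).
Proof.
apply: nonvanishing_prod => d _; apply: nonvanishingXsubC => k.
by rewrite lt_eqF.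
Qed.

Lemma phi_at_cvg t a j : (t < T)%N -> (1 <= a)%N ->
  (fun M => transfer_vec (wb1 y s (w t) (th t)) (wb2 y s (w t)) (wc1 y s (w t) (th t))
     (wc2 y s (w t)) (phi_at t.+1) 0 M.+1 a ord0 j) @ \oo --> phi_at t a ord0 j.
Proof.
move=> tT a1.
have -> : phi_at t a = newton_frac x (tau_num t.+1 * ('X - (om t)%:P) * colN S a.-1)
    (colD y a * (tau_den t.+1 * ('X - (w t)%:P))).
  rewrite /phi_at /tau_num /tau_den (@big_ltn _ _ _ t) // (@big_ltn _ _ _ t) //.
  by congr newton_frac; ring.
exact: (@transfer_cvg _ _ x y s (w t) (q t) (fun k => xw k t) (@wy t) yS (q01 t)
  (fun k p => @ratio k t p) (th t) (tau_num t.+1) _ a j a1 (nonvanishing_tau_den t.+1)).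
Qed.

(** In the bordering coordinates the sums stabilize: paths only move to the right, so columns past
    [pa k] contribute 0 and the value is constant once [M] has reached [a] and [pa k]. *)
Lemma ext_vec_cvg t a j : (t < T)%N -> (1 <= a)%N ->
  (fun M => transfer_vec (wb1 y s (w t) (th t)) (wb2 y s (w t)) (wc1 y s (w t) (th t))
     (wc2 y s (w t)) (ext_vec_eq t.+1) 0 M.+1 a ord0 j) @ \oo --> ext_vec t a ord0 j.
Proof.
move=> tT a1.
pose tv M : 'rV[R]_(N + m) := transfer_vec (wb1 y s (w t) (th t)) (wb2 y s (w t))
  (wc1 y s (w t) (th t)) (wc2 y s (w t)) (ext_vec_eq t.+1) 0 M.+1 a.
suff [H1 H2] : (forall k, (fun M => tv M ord0 (lshift m k)) @ \oo --> phi_at t a ord0 k) /\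
    (forall k, (fun M => tv M ord0 (rshift N k)) @ \oo --> later t a ord0 k).
  rewrite -/tv /ext_vec; case: (split_ordP j) => k ->.
    by rewrite row_mxEl; exact: H1.
  by rewrite row_mxEr; exact: H2.
split=> k; rewrite /tv; under eq_cvg do rewrite transfer_vec_row ?row_mxEl ?row_mxEr.
  exact: phi_at_cvg.
apply: cvg_near_cst; near=> M.
have aM : (a <= M)%N by near: M; exists a.
have pM : (pa k <= M)%N by near: M; exists (pa k).
rewrite transfer_vec_hop // summxE mxE.
under eq_bigr do rewrite !mxE ltnS.
case: ifP => tk; last by rewrite big1 // => c _; rewrite mulr0.
under eq_bigr do rewrite subSS.
rewrite (subSn tk) /hops_at /= -sumrN.
case: (leqP a (pa k)) => ak; last first.
  rewrite [RHS]big_geq // big_nat_cond big1 // => c /andP[/andP[ac _] _].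
  by rewrite hops_gt ?oppr0 ?mulr0 // (leq_trans ak).
rewrite (@big_cat_nat _ _ _ (pa k).+1) ?ltnS //=; last by apply: leqW.
rewrite [X in _ + X]big_nat_cond [X in _ + X]big1 ?addr0 => [|c /andP[/andP[ac _] _]]; last first.
  by rewrite hops_gt ?oppr0 ?mulr0.
by apply: eq_bigr => c _; rewrite mulrN.
Unshelve. all: by end_near.
Qed.

Lemma ext_det_insert t lam : (t < T)%N ->
  (hits t lam)%:R * ext_det t.+1 lam =
  wdet (map (ext_vec_eq t.+1) (sigS lam) ++ [seq ext_row t k | k <- enum 'I_m]).
Proof.
move=> tT.
have neq_lt k : pt k != t -> (t < pt k)%N = (t <= pt k)%N.
  by move=> kt; rewrite ltn_neqAle eq_sym kt.
case: (boolP (hits t lam)) => [/forallP hit|]; last first.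
  rewrite negb_forall => /existsP[k]; rewrite negb_imply => /andP[/eqP kt kl].
  (* If the point [k] is missed, its extra column is zero: no particle sits at [pa k], and the unit
     row of [k] is not yet present. *)
  rewrite mul0r; apply/esym/(@wdet_col0 _ _ _ (rshift N k)).
  rewrite all_cat; apply/andP; split; rewrite all_map; apply/allP => b /=.
    move=> bl; rewrite row_mxEr mxE kt leqnn subnn /hops_at /=.
    rewrite (_ : (b == pa k) = false) ?oppr0 //.
    by apply: contraNF kl => /eqP <-.
  move=> _; rewrite /ext_row; case: ifP => tb.
    by rewrite row_mxEr mxE kt ltnNge tb /=.
  rewrite row_mxEr mxE (_ : (k == b) = false) ?andbF //.
  by apply: contraFF tb => /eqP <-; rewrite kt.
rewrite mul1r /ext_det !wdet_col_mx; try by rewrite size_map size_sigS.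
pose U : 'M[R]_(N, m) := \matrix_(i, k) ((pt k == t) && (nth 0%N (sigS lam) i == pa k))%:R.
have uniqS : uniq (sigS lam).
  by apply: (sorted_uniq (leT := gtn)) (sigS_sorted lam) => [a b c /= h1 h2|a /=];
    [exact: ltn_trans h2 h1|exact: ltnn].
have pos k : pt k = t -> {i : 'I_N | nth 0%N (sigS lam) i = pa k}.
  move=> kt; have kl : pa k \in sigS lam by have := hit k; rewrite kt eqxx.
  have il : (index (pa k) (sigS lam) < N)%N by rewrite -index_mem size_sigS in kl.
  by exists (Ordinal il); rewrite nth_index.
have posE k (kt : pt k = t) (i : 'I_N) :
    (nth 0%N (sigS lam) i == pa k) = (i == sval (pos k kt)).
  move=> /=; case: (pos k kt) => i0 /= <-.
  by rewrite (nth_uniq 0%N _ _ uniqS) ?size_sigS.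
apply/esym; apply: (@det_insert _ _ _ _ _ _ _ [pred k | pt k == t] U).
- by move=> k /= /eqP kt; rewrite rowK /ext_row kt ltnn.
- move=> k /= /eqP kt; rewrite rowK /ext_row kt leqnn row_mul mulmx_sum_row.
  rewrite (bigD1 (sval (pos k kt))) //= big1 ?addr0 => [|i ik].
    rewrite !mxE kt eqxx posE eqxx scale1r rowK (nth_map 0%N) ?size_sigS //.
    by case: (pos k kt) => i /= ->.
  by rewrite !mxE posE (negPf ik) andbF scale0r.
- by move=> k /= kt; rewrite !rowK /ext_row neq_lt.
- by move=> k i /= kt; rewrite mxE (negPf kt).
- move=> k k' /= /eqP kt /eqP kt'; rewrite mxE.
  rewrite (bigD1 (sval (pos k kt))) //= big1 ?addr0 => [|i ik]; last first.
    by rewrite !mxE posE (negPf ik) andbF mul0r.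
  rewrite !mxE kt kt' eqxx posE eqxx mul1r /=; congr ((nat_of_bool _)%:R).
  case: (pos k kt) => i /= ->; case: (eqVneq k k') => [->|kk]; first by rewrite eqxx.
  by apply/negbTE; apply: contra kk => /eqP e; apply/eqP/pt_inj; rewrite ?kt ?kt'.
- apply/row_matrixP => i; rewrite linearB /= !rowK !(nth_map 0%N) ?size_sigS //.
  rewrite row_row_mx row0 /ext_vec_eq /ext_vec opp_row_mx add_row_mx oppr0 addr0.
  congr row_mx; apply/rowP => k; rewrite !mxE ltnS.
  case: (eqVneq (pt k) t) => [kt|kt].
    by rewrite kt leqnn ltnn subnn /hops_at /= sub0r.
  by rewrite neq_lt // subr0.
Qed.

Lemma ext_det_last lam : ext_det T lam = wdet (map (phi x y s) (sigS lam)).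
Proof.
rewrite /ext_det wdet_col_mx; last by rewrite size_map size_sigS.
have tau1 b : phi_at T b = phi x y s b.
  by rewrite /phi_at /phi /tau_num /tau_den !big_geq // mul1r mulr1.
have lT b : later T b = 0.
  by apply/rowP => k; rewrite !mxE leqNgt pt_lt.
have -> : \matrix_(i < N) nth 0 (map (ext_vec T) (sigS lam)) i =
    row_mx (\matrix_(i < N) nth 0 (map (phi x y s) (sigS lam)) i) 0.
  apply/row_matrixP => i; rewrite row_row_mx !rowK !(nth_map 0%N) ?size_sigS // row0.
  by rewrite /ext_vec tau1 lT.
have -> : \matrix_k ext_row T k = row_mx 0 1%:M.
  apply/row_matrixP => k; rewrite row_row_mx rowK row0 row1.
  by rewrite /ext_row leqNgt pt_lt.
by rewrite -/(block_mx _ _ _ _) det_lblock det1 mulr1 /wdet size_map size_sigS eqxx.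
Qed.

Lemma FG_F_ge0 (lam : signature N) : 0 <= FG_F lam x y r s.
Proof.
pose M := \max_(p <- sigS lam) p.
rewrite (@FG_F_path _ _ x r y s Sx yx lam M (sig_le_max lam)).
apply: sumr_ge0 => v _; apply: prodr_ge0 => j _; apply: row_weight_ge0 => p a b c d p1.
by apply: vertexWhat_ge0 p1 => p' p1'; exact: ineq_x.
Qed.

Let step t (mu lam : signature N) : R :=
  FG_G lam mu (fun _ : 'I_1 => w t) y (fun _ => th t) s * (hits t lam)%:R.

Lemma step_ge0 t mu lam : 0 <= step t mu lam.
Proof. by rewrite mulr_ge0 ?ler0n // FG_G_ge0 // => p p1; exact: ineq_w. Qed.

Lemma esum_step t mu : (t < T)%N ->
  (forall lam, 0 <= F_const x r * ext_det t.+1 lam) ->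
  \esum_(lam in [set: signature N]) (step t mu lam * (F_const x r * ext_det t.+1 lam))%:E =
  (F_const x r * ext_det t mu)%:E.
Proof.
move=> tT V0.
have stE lam : step t mu lam * (F_const x r * ext_det t.+1 lam) =
   FG_G lam mu (fun _ : 'I_1 => w t) y (fun _ => th t) s * (F_const x r *
     wdet (map (ext_vec_eq t.+1) (sigS lam) ++ [seq ext_row t k | k <- enum 'I_m])).
  by rewrite -ext_det_insert // /step; ring.
under eq_esum do rewrite stE.
apply: (@esum_transfer _ _ _ y s (w t) (th t) (@ineq_w t)).
- by rewrite size_map size_enum_ord.
- by move=> a j a1; exact: ext_vec_cvg.
- by move=> lam; rewrite -stE mulr_ge0 // step_ge0.
Qed.

(** Backward induction from F: each bordered determinant, multiplied by [F_const], is a sum of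
    nonnegative terms built from the next one. This positivity is what permits the summation over
    all signatures. *)
Lemma ext_det_ge0 t mu : (t <= T)%N -> 0 <= F_const x r * ext_det t mu.
Proof.
move=> tT; rewrite -(subKn tT); elim: (T - t)%N (leq_subr t T) mu => [|d IH] dT mu.
  by rewrite subn0 ext_det_last -(FG_F_det r Sx yx) FG_F_ge0.
have e : (T - d = (T - d.+1).+1)%N by lia.
rewrite -lee_fin -esum_step; [|lia|].
  apply: esum_ge0 => lam _; rewrite lee_fin mulr_ge0 ?step_ge0 // -e.
  by apply: IH; exact: ltnW.
by move=> lam; rewrite -e; apply: IH; exact: ltnW.
Qed.

Lemma esum_process :
  \esum_(l in [set: T.-tuple (signature N)])
    (\prod_(t < T) step t (nth (sig0 N) (sig0 N :: l) t) (tnth l t) *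
      FG_F (last (sig0 N) l) x y r s)%:E = (F_const x r * ext_det 0 (sig0 N))%:E.
Proof.
apply: (@esum_chain _ _ (sig0 N) T step (fun lam => FG_F lam x y r s)
  (fun t mu => F_const x r * ext_det t mu)).
- exact: step_ge0.
- exact: FG_F_ge0.
- by move=> lam; rewrite ext_det_last FG_F_det.
- by move=> t mu tT; apply: esum_step => // lam; exact: ext_det_ge0.
Qed.

End Chain.

Lemma det_schur (F : fieldType) N m (Q : 'M[F]_N) (E : 'M[F]_(N, m)) (X : 'M[F]_(m, N))
    (G : 'M[F]_m) : Q \in unitmx ->
  \det (block_mx Q E X G) = \det Q * \det (G - X *m invmx Q *m E).
Proof.
move=> uQ.
have e : block_mx 1%:M 0 (- (X *m invmx Q)) 1%:M *m block_mx Q E X G =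
   block_mx Q E 0 (G - X *m invmx Q *m E).
  rewrite mulmx_block !mul1mx !mul0mx !addr0 mulNmx mulmxKV // addNr.
  by rewrite mulNmx [- _ + _]addrC.
have := congr1 determinant e.
by rewrite det_mulmx det_lblock det_ublock !det1 !mul1r.
Qed.

(** * The correlation determinant *)

Section NewtonDet.
Variables (R : fieldType) (n : nat).
Local Notation N := n.+1.

Lemma monic_newton_poly (x : 'I_N -> R) k : newton_poly x k \is monic.
Proof. exact: monic_prod_XsubC. Qed.

Lemma size_newton_poly (x : 'I_N -> R) k : (k <= N)%N -> size (newton_poly x k) = k.+1.
Proof.
elim: k => [|k IH] kN; first by rewrite /newton_poly big_pred0 // size_poly1.
rewrite (newton_polyS x (Ordinal kN)) size_Mmonic ?monicXsubC //; last first.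
  exact: monic_neq0 (monic_newton_poly x k).
by rewrite size_XsubC IH ?(ltnW kN) // addn2.
Qed.

Lemma size_colN (S : nat -> R) a : size (colN S a) = a.+1.
Proof. by rewrite /colN size_prod_XsubC size_iota subSS subn0. Qed.

Lemma newton_row_coef (x : 'I_N -> R) (p : {poly R}) : (size p <= N)%N ->
  newton_row x p = poly_rV p *m \matrix_(k < N) newton_row x 'X^k.
Proof.
move=> sp; have {1}-> : p = \sum_(k < N) p`_k *: 'X^k.
  apply/polyP => i; rewrite coef_sum.
  under eq_bigr do rewrite coefZ coefXn.
  case: (ltnP i N) => iN.
    rewrite (bigD1 (Ordinal iN)) //= eqxx mulr1 big1 ?addr0 // => j ji.
    by rewrite eq_sym (_ : (j == i :> nat) = false) ?mulr0 //; move: ji; rewrite -val_eqE => /negbTE.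
  rewrite big1 ?nth_default ?(leq_trans sp) // => j _.
  by rewrite gtn_eqF ?mulr0 // (leq_trans (ltn_ord j)).
rewrite mulmx_sum_row /newton_row !linear_sum /=; apply: eq_bigr => k _.
by rewrite rowK mxE !linearZ.
Qed.

(** The determinant does not depend on the nodes: monomials and Newton polynomials are related by a
    unitriangular matrix. *)
Lemma det_newton_row_coef (x : 'I_N -> R) (p : 'I_N -> {poly R}) :
  (forall i, size (p i) <= N)%N ->
  \det (\matrix_i newton_row x (p i)) = \det (\matrix_i (poly_rV (p i) : 'rV_N)).
Proof.
have mul (p' : 'I_N -> {poly R}) : (forall i, size (p' i) <= N)%N ->
    \matrix_i newton_row x (p' i) =
    \matrix_i (poly_rV (p' i) : 'rV_N) *m \matrix_(k < N) newton_row x 'X^k.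
  move=> sp; apply/row_matrixP => i.
  by rewrite row_mul !rowK newton_row_coef.
move=> sp; rewrite mul // det_mulmx.
have sN (i : 'I_N) : (size (newton_poly x i) <= N)%N.
  by rewrite size_newton_poly // ltnW.
have := congr1 determinant (mul (fun i => newton_poly x i) sN).
rewrite (_ : \matrix_i newton_row x (newton_poly x i) = 1%:M); last first.
  by apply/row_matrixP => i; rewrite rowK newton_row_poly row1.
rewrite det1 det_mulmx -det_tr det_upper => [|i j ji]; last first.
  by rewrite !mxE nth_default // size_newton_poly // ltnW.
rewrite big1 ?mul1r => [<-|i _]; first by rewrite mulr1.
rewrite !mxE; have := monicP (monic_newton_poly x i).
by rewrite lead_coefE size_newton_poly // ltnW.
Qed.

Variables (y S : nat -> R).

Let nodes (k : 'I_N) : R := y (N - k)%N.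

(** The numerator of [phi_(N - i)] over the common denominator [colD y N], in Newton form for the
    nodes [y_N, ..., y_1]. *)
Definition vac_poly (i : 'I_N) : {poly R} := newton_poly nodes i * colN S (N - i).-1.

Lemma colD_nodes k : (k <= N)%N -> colD y (N - k) * newton_poly nodes k = colD y N.
Proof.
elim: k => [|k IH] kN; first by rewrite subn0 /newton_poly big_pred0 // mulr1.
rewrite (newton_polyS nodes (Ordinal kN)) /= -(IH (ltnW kN)) mulrA mulrAC; congr (_ * _).
rewrite (_ : N - k = (N - k.+1).+1)%N; last by lia.
by rewrite colDS /nodes /= (_ : (N - k.+1).+1 = N - k)%N; last lia.
Qed.

(** Independence of the nodes allows them to be moved from [x] to [y_N, ..., y_1], where the matrix
    is triangular. *)
Lemma det_vac_poly (x : 'I_N -> R) :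
  \det (\matrix_i newton_row x (vac_poly i)) =
  \prod_(i < N) \prod_(j < N | (j < i)%N) (y i.+1 - S j.+1).
Proof.
have sz i : (size (vac_poly i) <= N)%N.
  rewrite size_Mmonic ?monic_prod_XsubC //; last first.
    exact: monic_neq0 (monic_newton_poly nodes i).
  rewrite size_newton_poly ?size_colN ?(ltnW (ltn_ord i)) //.
  by have := ltn_ord i; lia.
rewrite (det_newton_row_coef x sz) -(det_newton_row_coef nodes sz) det_upper; last first.
  by move=> i j ji; rewrite mxE newton_row_shift mxE hJ_upper.
rewrite (reindex_inj rev_ord_inj) /=; apply: eq_bigr => i _.
rewrite mxE newton_row_shift mxE hJ_diag /colN horner_prod /nodes.
have -> : (N - rev_ord i)%N = i.+1 by rewrite /=; have := ltn_ord i; lia.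
rewrite /= big_add1 /= big_mkord.
transitivity (\prod_(j < i) (y i.+1 - S j.+1)).
  by apply: eq_bigr => j _; rewrite hornerXsubC.
rewrite (big_ord_widen N (fun j => y i.+1 - S j.+1)) //.
exact: ltnW.
Qed.

End NewtonDet.

Lemma prod_pairs (F : fieldType) N (f g : 'I_N -> 'I_N -> F) :
  (\prod_(i < N) \prod_(j < N | (i <= j)%N) f i j) *
  (\prod_(i < N) \prod_(j < N | (j < i)%N) g i j) =
  \prod_(i < N) \prod_(j < N) (if (i <= j)%N then f i j else g i j).
Proof.
rewrite -big_split; apply: eq_bigr => i _ /=.
rewrite [RHS](bigID (fun j : 'I_N => (i <= j)%N)) /=; congr (_ * _).
  by apply: eq_bigr => j ->.
by apply: eq_big => j; rewrite ltnNge // => /negPf ->.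
Qed.

Section Initial.
Variables (R : realType) (n m T : nat).
Local Notation N := n.+1.
Variables (x r : 'I_N -> R) (w th : nat -> R) (y s : nat -> R).
Local Notation S := (colS y s).
Hypothesis yx : forall p k, (1 <= p)%N -> y p != x k.
Hypothesis xw : forall k t, x k < w t.

Definition init_mx : 'M[R]_N := \matrix_(i < N) phi_at T x w th y s 0 (N - i).

Let gD a : nonvanishing x (colD y a).
Proof. by apply: nonvanishing_colD => p k p1; rewrite eq_sym yx. Qed.

Lemma det_init_mx : \det init_mx =
  (\prod_(i < N) \prod_(j < N | (j < i)%N) (y i.+1 - S j.+1)) *
  \prod_k ((tau_num T w th 0).[x k] / ((colD y N).[x k] * (tau_den T w 0).[x k])).
Proof.
have gt := nonvanishing_tau_den T xw 0.
have gDt : nonvanishing x (colD y N * tau_den T w 0) by exact: nonvanishingM.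
set A := horner_mx (jordan x) (tau_num T w th 0) *m
   invmx (horner_mx (jordan x) (colD y N * tau_den T w 0)).
have -> : init_mx = (\matrix_i newton_row x (vac_poly y S i)) *m A.
  apply/row_matrixP => i; rewrite row_mul !rowK /phi_at -newton_frac1.
  rewrite -newton_frac_split //; last exact: nonvanishing1.
  apply: newton_frac_eq; try exact: nonvanishingM.
    by apply: nonvanishingM => //; exact: nonvanishing1.
  by rewrite -(colD_nodes y (ltnW (ltn_ord i))) /vac_poly; ring.
rewrite det_mulmx det_vac_poly /A det_mulmx det_inv !det_hJ -prodf_div.
by congr (_ * _); apply: eq_bigr => k _; rewrite hornerM.
Qed.

Lemma F_const_det_init :
  F_const x r * \det init_mx =
  ascFG_Z x r (fun j : 'I_T => w j) (fun j : 'I_T => th j) y s.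
Proof.
rewrite det_init_mx /F_const /ascFG_Z.
have -> : \prod_k ((tau_num T w th 0).[x k] / ((colD y N).[x k] * (tau_den T w 0).[x k])) =
  (\prod_(i < N) \prod_(j < N) (x j - y i.+1))^-1 *
  \prod_(i < N) \prod_(j < T) ((x i - th j ^- 2 * w j) / (x i - w j)).
  rewrite exchange_big -prodfV -big_split; apply: eq_bigr => k _ /=.
  rewrite /tau_num /tau_den /colD !horner_prod big_add1 !big_mkord prodf_div.
  have e (I : finType) (f : I -> R) : \prod_i ('X - (f i)%:P).[x k] = \prod_i (x k - f i).
    by apply: eq_bigr => i _; rewrite hornerXsubC.
  by rewrite !e invfM mulrCA.
rewrite !mulrA; congr (_ * _).
have -> : \prod_(i < N) \prod_(j < N | (i < j)%N) (s i.+1 ^- 2 * y i.+1 - y j.+1) =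
   \prod_(i < N) \prod_(j < N | (j < i)%N) (S j.+1 - y i.+1).
  by rewrite (exchange_big_dep predT).
rewrite !prod_pairs.
have div (f g : 'I_N -> 'I_N -> R) : (\prod_(i < N) \prod_(j < N) f i j) *
  (\prod_(i < N) \prod_(j < N) g i j)^-1 = \prod_(i < N) \prod_(j < N) (f i j / g i j).
  by rewrite -prodf_div; apply: eq_bigr => i _; rewrite prodf_div.
rewrite !div; apply: eq_bigr => i _; apply: eq_bigr => j _.
rewrite -[x j - y _]opprB invrN mulrN -mulNr; congr (_ / _).
by case: ifP => _; rewrite opprB.
Qed.

Lemma ascFG_Z_gt0 :
  (forall k p, (1 <= p)%N -> y p < r k ^- 2 * x k /\ r k ^- 2 * x k < S p) ->
  (forall k p, (1 <= p)%N -> x k < y p) ->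
  (forall t p, (1 <= p)%N -> y p < th t ^- 2 * w t) ->
  0 < ascFG_Z x r (fun j : 'I_T => w j) (fun j : 'I_T => th j) y s.
Proof.
move=> h1 h2 h3; rewrite /ascFG_Z.
have e (i : 'I_N) (j : 'I_T) : 0 < (x i - th j ^- 2 * w j) / (x i - w j).
  have := h2 i 1%N isT; have := h3 j 1%N isT; have := xw i j => *.
  by rewrite -mulrNN -invrN divr_gt0 //; lra.
rewrite !(mulr_gt0, invr_gt0, prodr_gt0) // => i _; rewrite prodr_gt0 // => j _; rewrite subr_gt0.
- by have := h1 i 1%N isT; have := h2 j 1%N isT; lra.
- have := h1 ord0 i.+1 isT; have := h1 ord0 j.+1 isT; rewrite /colS; lra.
- exact: h2.
Qed.

Variables (pt pa : 'I_m -> nat).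
Hypothesis pt_lt : forall k, (pt k < T)%N.

Definition event_mx : 'M[R]_(m, N) :=
  \matrix_(k < m) phi_at T x w th y s (pt k).+1 (pa k).

(* The transpose of the kernel of the theorem, with the contour integrals
   evaluated. *)
Definition process_kernel : 'M[R]_m := \matrix_(k, k')
  (\sum_(i < N) (event_mx *m invmx init_mx) k i *
     hops_at w th y s 0 (pt k').+1 (N - i) (pa k')
   - (if (pt k < pt k')%N then hops_at w th y s (pt k).+1 (pt k' - pt k) (pa k) (pa k')
      else 0)).

Lemma ext_det0 : init_mx \in unitmx ->
  ext_det T x w th y s pt pa 0 (sig0 N) = \det init_mx * \det process_kernel.
Proof.
move=> uQ; rewrite /ext_det wdet_col_mx; last by rewrite size_map size_sigS.
have nth0 (i : 'I_N) : nth 0%N (sigS (sig0 N)) i = (N - i)%N.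
  by rewrite nth_sigS // nth_nseq ltn_ord.
have -> : \matrix_(i < N) nth 0 (map (ext_vec T x w th y s pt pa 0) (sigS (sig0 N))) i =
    row_mx init_mx (\matrix_(i < N) later w th y s pt pa 0 (N - i)).
  apply/row_matrixP => i; rewrite row_row_mx !rowK (nth_map 0%N) ?size_sigS //.
  by rewrite nth0.
have -> : \matrix_k ext_row T x w th y s pt pa 0 k =
    row_mx event_mx (\matrix_k later w th y s pt pa (pt k).+1 (pa k)).
  by apply/row_matrixP => k; rewrite row_row_mx !rowK.
rewrite -/(block_mx _ _ _ _) det_schur //; congr (_ * \det _).
apply/matrixP => k k'; rewrite [LHS]mxE addrC [RHS]mxE; congr (_ + _).
  rewrite !mxE -sumrN; apply: eq_bigr => i _; rewrite !mxE /= ?subn0.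
  by rewrite mulrN opprK; congr (_ * _); rewrite !mxE.
by rewrite !mxE subSS; case: ifP => // _; rewrite oppr0.
Qed.

End Initial.

Local Open Scope complex_scope.

(** * Contour integrals of rational functions *)

Section PartialFractions.
Variable F : fieldType.
Implicit Types (s : seq F) (p : {poly F}).

Definition root_poly s : {poly F} := \prod_(a <- s) ('X - a%:P).

Lemma size_root_poly s : size (root_poly s) = (size s).+1.
Proof. by rewrite /root_poly size_prod_XsubC. Qed.

Lemma root_poly_neq0 s : root_poly s != 0.
Proof. by rewrite -size_poly_eq0 size_root_poly. Qed.

Lemma monic_root_poly s : root_poly s \is monic.
Proof. exact: monic_prod_XsubC. Qed.

Lemma root_poly_cat s t : root_poly (s ++ t) = root_poly s * root_poly t.
Proof. exact: big_cat. Qed.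

Lemma root_poly_horner_neq0 s z : z \notin s -> (root_poly s).[z] != 0.
Proof. by rewrite -[_ != 0]/(~~ root _ _) root_prod_XsubC. Qed.

(** Only the part with poles in [s1] has to be proper; [B] absorbs the polynomial part. *)
Lemma partial_fraction p s1 s2 : (forall a, a \in s1 -> a \notin s2) ->
  exists A B : {poly F}, (size A <= size s1)%N /\ p = A * root_poly s2 + B * root_poly s1.
Proof.
move=> dis; have : coprimep (root_poly s1) (root_poly s2).
  rewrite /root_poly; elim: s1 dis => [|a s1 IH] dis.
    by rewrite big_nil coprime1p.
  rewrite big_cons coprimepMl IH ?andbT; last by move=> b bs; apply: dis; rewrite inE bs orbT.
  by rewrite coprimep_sym coprimep_XsubC root_prod_XsubC dis ?mem_head.
case/Bezout_eq1_coprimepP => -[u1 u2] /= e.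
exists ((p * u2) %% root_poly s1), ((p * u2) %/ root_poly s1 * root_poly s2 + p * u1); split.
  have := ltn_modp (p * u2) (root_poly s1).
  by rewrite root_poly_neq0 size_root_poly ltnS.
have d := divp_eq (p * u2) (root_poly s1).
rewrite -{1}[p]mulr1 -e; set r := root_poly s1 in d *; set t := root_poly s2.
rewrite (_ : p * _ = p * u1 * r + p * u2 * t); last by ring.
by rewrite {1}d; ring.
Qed.

End PartialFractions.

(** * Integration over a circle by moments *)

Section ComplexIntegral.
Variable R : realType.
Implicit Types f g : R -> R[i].
Local Notation Re := (@complex.Re R).
Local Notation Im := (@complex.Im R).

Lemma ReM (a b : R[i]) : Re (a * b) = Re a * Re b - Im a * Im b.
Proof. by case: a b => [? ?] [? ?]. Qed.
Lemma ImM (a b : R[i]) : Im (a * b) = Re a * Im b + Im a * Re b.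
Proof. by case: a b => [? ?] [? ?]. Qed.
Lemma ReD (a b : R[i]) : Re (a + b) = Re a + Re b.
Proof. by case: a b => [? ?] [? ?]. Qed.
Lemma ImD (a b : R[i]) : Im (a + b) = Im a + Im b.
Proof. by case: a b => [? ?] [? ?]. Qed.
Lemma ReV (a : R[i]) : Re a^-1 = Re a / (Re a ^+ 2 + Im a ^+ 2).
Proof. by case: a. Qed.
Lemma ImV (a : R[i]) : Im a^-1 = - (Im a / (Re a ^+ 2 + Im a ^+ 2)).
Proof. by case: a. Qed.

(** Continuity is taken componentwise, like the integral. *)
Definition ccontinuous f := continuous (Re \o f) /\ continuous (Im \o f).

Lemma ccontinuous_cst c : ccontinuous (fun=> c).
Proof. by split => t; exact: cst_continuous. Qed.

Lemma ccontinuousD f g : ccontinuous f -> ccontinuous g -> ccontinuous (fun t => f t + g t).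
Proof.
move=> [f1 f2] [g1 g2]; split.
  rewrite (_ : _ \o _ = (Re \o f) \+ (Re \o g)); last by apply/funext => t /=; rewrite ReD.
  by move=> t; apply: continuousD; [exact: f1|exact: g1].
rewrite (_ : _ \o _ = (Im \o f) \+ (Im \o g)); last by apply/funext => t /=; rewrite ImD.
by move=> t; apply: continuousD; [exact: f2|exact: g2].
Qed.

Lemma ccontinuousM f g : ccontinuous f -> ccontinuous g -> ccontinuous (fun t => f t * g t).
Proof.
move=> [f1 f2] [g1 g2]; split.
  rewrite (_ : _ \o _ = (Re \o f) \* (Re \o g) \- (Im \o f) \* (Im \o g)); last first.
    by apply/funext => t /=; rewrite ReM.
  by move=> t; apply: continuousB; apply: continuousM; [exact: f1|exact: g1|exact: f2|exact: g2].
rewrite (_ : _ \o _ = (Re \o f) \* (Im \o g) \+ (Im \o f) \* (Re \o g)); last first.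
  by apply/funext => t /=; rewrite ImM.
by move=> t; apply: continuousD; apply: continuousM; [exact: f1|exact: g2|exact: f2|exact: g1].
Qed.

Lemma ccontinuousV f : (forall t, f t != 0) -> ccontinuous f -> ccontinuous (fun t => (f t)^-1).
Proof.
move=> f0 [f1 f2].
have n0 t : Re (f t) ^+ 2 + Im (f t) ^+ 2 != 0.
  apply: contra (f0 t); rewrite paddr_eq0 ?sqr_ge0 // !sqrf_eq0 => /andP[/eqP h1 /eqP h2].
  by rewrite eq_complex h1 h2 !eqxx.
have nc : continuous (fun t => Re (f t) ^+ 2 + Im (f t) ^+ 2).
  rewrite (_ : (fun t => _) = ((Re \o f) \* (Re \o f)) \+ ((Im \o f) \* (Im \o f))); last first.
    by apply/funext => t /=; rewrite !expr2.
  by move=> t; apply: continuousD; apply: continuousM; [exact: f1|exact: f1|exact: f2|exact: f2].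
have ic : continuous (fun t => (Re (f t) ^+ 2 + Im (f t) ^+ 2)^-1).
  by move=> t; apply: cvgV; [exact: n0|exact: nc].
split.
  rewrite (_ : _ \o _ = (Re \o f) \* (fun t => (Re (f t) ^+ 2 + Im (f t) ^+ 2)^-1)); last first.
    by apply/funext => t /=; rewrite ReV.
  by move=> t; apply: continuousM; [exact: f1|exact: ic].
rewrite (_ : _ \o _ = \- ((Im \o f) \* (fun t => (Re (f t) ^+ 2 + Im (f t) ^+ 2)^-1))); last first.
  by apply/funext => t /=; rewrite ImV.
by move=> t; apply: continuousN; apply: continuousM; [exact: f2|exact: ic].
Qed.

Lemma ccontinuousX f k : ccontinuous f -> ccontinuous (fun t => f t ^+ k).
Proof.
move=> cf; elim: k => [|k IH].
  by under eq_fun do rewrite expr0; exact: ccontinuous_cst.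
by under eq_fun do rewrite exprS; exact: ccontinuousM.
Qed.

Local Notation mu := lebesgue_measure.
Local Notation CI := (complex_integral (0 : R) (2 * pi)).
Let I02 : set R := [set` `[(0 : R), 2 * pi]].

Let integ (h : R -> R) : continuous h -> mu.-integrable I02 (EFin \o h).
Proof.
move=> ch; apply: continuous_compact_integrable; first exact: segment_compact.
exact: continuous_subspaceT.
Qed.

Lemma complex_integralD f g : ccontinuous f -> ccontinuous g ->
  CI (fun t => f t + g t) = CI f + CI g.
Proof.
move=> [f1 f2] [g1 g2]; rewrite /complex_integral.
have -> : (\int[mu]_(t in I02) Re (f t + g t) =
  \int[mu]_(t in I02) Re (f t) + \int[mu]_(t in I02) Re (g t))%R.
  rewrite -RintegralD //; try exact: measurable_itv; try exact: integ.
  by apply: eq_Rintegral => t _; rewrite ReD.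
have -> : (\int[mu]_(t in I02) Im (f t + g t) =
  \int[mu]_(t in I02) Im (f t) + \int[mu]_(t in I02) Im (g t))%R.
  rewrite -RintegralD //; try exact: measurable_itv; try exact: integ.
  by apply: eq_Rintegral => t _; rewrite ImD.
by [].
Qed.

Lemma complex_integralZ c f : ccontinuous f -> CI (fun t => c * f t) = c * CI f.
Proof.
move=> [f1 f2]; rewrite /complex_integral.
have Zc (a : R) (h : R -> R) : continuous h -> continuous (fun t => a * h t).
  by move=> ch t; apply: continuousM; [exact: cst_continuous|exact: ch].
have -> : (\int[mu]_(t in I02) Re (c * f t) =
  Re c * \int[mu]_(t in I02) Re (f t) - Im c * \int[mu]_(t in I02) Im (f t))%R.
  rewrite -!RintegralZl //; try exact: measurable_itv; try exact: integ.
  rewrite -RintegralB //; try exact: measurable_itv; try by apply: integ; exact: Zc.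
  by apply: eq_Rintegral => t _; rewrite ReM.
have -> : (\int[mu]_(t in I02) Im (c * f t) =
  Re c * \int[mu]_(t in I02) Im (f t) + Im c * \int[mu]_(t in I02) Re (f t))%R.
  rewrite -!RintegralZl //; try exact: measurable_itv; try exact: integ.
  rewrite -RintegralD //; try exact: measurable_itv; try by apply: integ; exact: Zc.
  by apply: eq_Rintegral => t _; rewrite ImM.
by apply/eqP; rewrite eq_complex ReM ImM /= !eqxx.
Qed.

Lemma eq_complex_integral f g : f =1 g -> CI f = CI g.
Proof. by move=> /funext ->. Qed.

Lemma bounded_Rintegral (h : R -> R) B : continuous h ->
  (forall t, t \in `[0, 2 * pi] -> `|h t| <= B) ->
  `|\int[mu]_(t in I02) h t| <= B * (2 * pi).
Proof.
move=> ch hB.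
have H : `|\int[mu]_(t in I02) h t| <= \int[mu]_(t in I02) `|h t|.
  by apply: le_normr_Rintegral; [exact: measurable_itv|exact: integ].
apply: (le_trans H).
have -> : B * (2 * pi) = \int[mu]_(t in I02) (cst B) t.
  rewrite Rintegral_cst; last exact: measurable_itv.
  have muI : lebesgue_measure I02 = (2 * pi)%:E.
    by rewrite lebesgue_measure_itv /= lte_fin mulr_gt0 ?pi_gt0 // oppr0 adde0.
  by congr (_ * _); exact: (esym (congr1 fine muI)).
apply: le_Rintegral => //.
- exact: measurable_itv.
- by apply: integ => t; apply: continuous_comp; [exact: ch|exact: norm_continuous].
- by apply: integ => t; exact: cst_continuous.
Qed.

Local Notation normc := ComplexField.Normc.normc.

Lemma normc_ReIm (a : R[i]) : (`|Re a| <= normc a) * (`|Im a| <= normc a) *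
  (normc a <= `|Re a| + `|Im a|).
Proof.
case: a => a b /=; split; first split.
- by rewrite -sqrtr_sqr ler_sqrt ?addr_ge0 ?sqr_ge0 // lerDl sqr_ge0.
- by rewrite -sqrtr_sqr ler_sqrt ?addr_ge0 ?sqr_ge0 // lerDr sqr_ge0.
rewrite -[leRHS](ger0_norm _) ?addr_ge0 // -sqrtr_sqr ler_sqrt ?sqr_ge0 //.
by rewrite sqrrD !real_normK ?num_real // -addrA lerD2l lerDr mulrn_wge0 ?mulr_ge0.
Qed.

Lemma normc_complex_integral f B : ccontinuous f ->
  (forall t, t \in `[0, 2 * pi] -> normc (f t) <= B) ->
  normc (CI f) <= B * (4 * pi).
Proof.
move=> [f1 f2] fB; apply: (le_trans (normc_ReIm _).2); rewrite /complex_integral /=.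
have -> : B * (4 * pi) = B * (2 * pi) + B * (2 * pi) :> R by ring.
apply: lerD; apply: bounded_Rintegral => // t tI.
  exact: le_trans (normc_ReIm _).1.1 (fB t tI).
exact: le_trans (normc_ReIm _).1.2 (fB t tI).
Qed.

Lemma normc_ge0 (a : R[i]) : 0 <= normc a.
Proof. by case: a => a b; exact: sqrtr_ge0. Qed.

Lemma normcX (a : R[i]) k : normc (a ^+ k) = normc a ^+ k.
Proof.
elim: k => [|k IH]; first by rewrite !expr0 ComplexField.Normc.normc1.
by rewrite !exprS ComplexField.Normc.normcM IH.
Qed.

Lemma geometric_eq0 (a : R[i]) (K q : R) : 0 <= q < 1 ->
  (forall k, normc a <= K * q ^+ k) -> a = 0.
Proof.
move=> /andP[q0 q1] h; apply: ComplexField.Normc.eq0_normc.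
apply/eqP; rewrite eq_le normc_ge0 andbT.
have lim : (fun k => K * q ^+ k) @ \oo --> 0.
  rewrite -[X in _ --> X](mulr0 K); apply: cvgMr.
  by apply: cvg_expr; rewrite ger0_norm.
rewrite -(cvg_lim _ lim) //; apply: limr_ge; first by apply/cvg_ex; exists 0.
exact: nearW.
Qed.

Definition cis (t : R) : R[i] := cos t +i* sin t.

Lemma cisX t k : cis t ^+ k = cis (t *+ k).
Proof.
elim: k => [|k IH]; first by rewrite expr0 mulr0n /cis cos0 sin0.
rewrite exprS IH mulrS /cis cosD sinD.
by apply/eqP; rewrite eq_complex ReM ImM /= eqxx [X in _ == X]addrC eqxx.
Qed.

Lemma ccontinuous_cis : ccontinuous cis.
Proof. by split=> t; [exact: continuous_cos|exact: continuous_sin]. Qed.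

Lemma normc_cis t : normc (cis t) = 1.
Proof. by rewrite /= cos2Dsin2 sqrtr1. Qed.

Lemma cis_neq0 t : cis t != 0.
Proof.
by apply/eqP => c0; have := normc_cis t; rewrite c0 ComplexField.Normc.normc0 => /esym/eqP; rewrite oner_eq0.
Qed.

Lemma Rintegral_trig (k : nat) : (0 < k)%N ->
  \int[mu]_(t in I02) cos (t *+ k) = 0 /\ \int[mu]_(t in I02) sin (t *+ k) = 0.
Proof.
move=> k0.
have kR : (k%:R : R) != 0 by rewrite pnatr_eq0 -lt0n.
have pi2 : 0 < 2 * pi :> R by rewrite mulr_gt0 ?pi_gt0.
have FTC (f F : R -> R) : continuous f -> (forall t : R, is_derive t (1 : R) F (f t)) ->
    F (2 * pi) = F 0 -> \int[mu]_(t in I02) f t = 0.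
  move=> cf dF FF.
  have cF : continuous F.
    move=> t; apply: differentiable_continuous; apply/derivable1_diffP.
    by have [] := dF t.
  rewrite /Rintegral (@continuous_FTC2 _ f F) //.
  - by rewrite FF -EFinB subrr.
  - exact: continuous_subspaceT.
  - split.
    + by move=> t _; have [] := dF t.
    + by apply: cvg_at_right_filter; exact: cF.
    + by apply: cvg_at_left_filter; exact: cF.
  - by move=> t _; rewrite derive1E; have [_ ->] := dF t.
have mulnE (t : R) : t *+ k = k%:R * t by rewrite mulr_natl.
have per : 2 * pi *+ k = 0 + pi *+ 2 *+ k :> R by rewrite add0r mulr_natl.
have cM (h : R -> R) : continuous h -> continuous (fun t : R => h (t *+ k)).
  move=> ch t; apply: continuous_comp; last exact: ch.
  rewrite (_ : (fun t : R => t *+ k) = (fun t => k%:R * t)); last by apply/funext.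
  by apply: continuousM; [exact: cst_continuous|exact: id].
have dg (t : R) : is_derive t (1 : R) (fun t : R => t *+ k) k%:R.
  rewrite (_ : (fun t : R => t *+ k) = (k%:R \*: (@id R))); last first.
    by apply/funext => u /=; rewrite mulnE.
  by apply: is_derive_eq; rewrite /GRing.scale /= mulr1.
split.
  apply: (FTC _ (k%:R^-1 \*: (sin \o (fun t => t *+ k)))).
  - by apply: cM; exact: continuous_cos.
  - move=> t; apply: is_derive_eq.
    by rewrite /GRing.scale /= mulrC mulfK.
  - by rewrite /= per periodicn ?mul0rn //; exact: sinD2pi.
apply: (FTC _ ((- k%:R^-1) \*: (cos \o (fun t => t *+ k)))).
- by apply: cM; exact: continuous_sin.
- move=> t; apply: is_derive_eq.
  by rewrite /GRing.scale /= mulNr mulNr mulrN opprK mulrC mulfK.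
- by rewrite /= per periodicn ?mul0rn //; exact: cosD2pi.
Qed.

Lemma complex_integral_cisX k : (0 < k)%N ->
  CI (fun t => cis t ^+ k) = 0 /\ CI (fun t => (cis t)^-1 ^+ k) = 0.
Proof.
move=> k0; have [C0 S0] := Rintegral_trig k0.
have VE t : (cis t)^-1 ^+ k = cos (t *+ k) -i* sin (t *+ k).
  rewrite exprVn cisX /cis; apply/eqP.
  by rewrite eq_complex ReV ImV /= cos2Dsin2 !divr1 !eqxx.
split; rewrite /complex_integral.
  under eq_Rintegral do rewrite cisX /=.
  under [X in _ +i* X]eq_Rintegral do rewrite cisX /=.
  by rewrite C0 S0.
under eq_Rintegral do rewrite VE /=.
under [X in _ +i* X]eq_Rintegral do rewrite VE /=.
rewrite C0 (_ : (\int[mu]_(t in I02) (- sin (t *+ k)))%R = 0) //.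
have -> : (\int[mu]_(t in I02) (- sin (t *+ k)) = \int[mu]_(t in I02) (-1 * sin (t *+ k)))%R.
  by apply: eq_Rintegral => t _; rewrite mulN1r.
rewrite RintegralZl ?S0 ?mulr0 //; first exact: measurable_itv.
apply: integ => t; apply: continuous_comp; last exact: continuous_sin.
rewrite (_ : (fun t : R => t *+ k) = (fun t => k%:R * t)); last first.
  by apply/funext => u; rewrite mulr_natl.
by apply: continuousM; [exact: cst_continuous|exact: id].
Qed.

Lemma complex_integral1 : CI (fun=> 1) = (2 * pi)%:C.
Proof.
have muI : lebesgue_measure I02 = (2 * pi)%:E.
  by rewrite lebesgue_measure_itv /= lte_fin mulr_gt0 ?pi_gt0 // oppr0 adde0.
have cst (a : R) : (\int[mu]_(t in I02) a)%R = a * (2 * pi).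
  rewrite Rintegral_cst; last exact: measurable_itv.
  by congr (_ * _); exact: (congr1 fine muI).
by rewrite /complex_integral !cst mul0r mul1r.
Qed.

End ComplexIntegral.

Section CircleIntegral.
Variables (R : realType) (C : circle R).
Local Notation c := (ccenter C).
Local Notation rho := (cradius C).
Local Notation CI := (complex_integral (0 : R) (2 * pi)).
Local Notation normc := ComplexField.Normc.normc.
Hypothesis rho_gt0 : 0 < rho.

Let e (t : R) : R[i] := rho%:C * cis t.
Let zeta (t : R) : R[i] := c + e t.

Let e_neq0 t : e t != 0.
Proof. by rewrite mulf_neq0 ?cis_neq0 // eq_complex /= eqxx andbT gt_eqF. Qed.

Let normc_e t : normc (e t) = rho.
Proof.
rewrite ComplexField.Normc.normcM normc_cis mulr1 /= expr0n addr0 sqrtr_sqr.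
by rewrite ger0_norm // ltW.
Qed.

Let ce : ccontinuous e.
Proof. by apply: ccontinuousM; [exact: ccontinuous_cst|exact: ccontinuous_cis]. Qed.

Let czeta : ccontinuous zeta.
Proof. by apply: ccontinuousD => //; exact: ccontinuous_cst. Qed.

Let cei : ccontinuous (fun t => (e t)^-1).
Proof. exact: ccontinuousV. Qed.

Lemma ccontinuous_bounded (f : R -> R[i]) : ccontinuous f ->
  exists B, forall t, t \in `[0, 2 * pi] -> normc (f t) <= B.
Proof.
move=> [f1 f2].
have pi2 : (0 : R) <= 2 * pi by rewrite mulr_ge0 ?pi_ge0.
have bnd (h : R -> R) : continuous h -> exists B, forall t, t \in `[0, 2 * pi] -> `|h t| <= B.
  move=> ch; have cnh : {within `[0, 2 * pi], continuous (fun t => `|h t|)}.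
    apply: continuous_subspaceT => t; apply: continuous_comp; [exact: ch|exact: norm_continuous].
  by have [t0 _ hm] := EVT_max pi2 cnh; exists (`|h t0|) => t /hm.
have [B1 h1] := bnd _ f1; have [B2 h2] := bnd _ f2.
exists (B1 + B2) => t tI; apply: (le_trans (normc_ReIm _).2).
by apply: lerD; [exact: h1|exact: h2].
Qed.

(* Functions on the circle all of whose moments against positive powers of
   [zeta - c] vanish, i.e. boundary values of functions holomorphic inside. *)
Definition hardy_in (f : R -> R[i]) : Prop :=
  ccontinuous f /\ forall k, CI (fun t => f t * e t ^+ k.+1) = 0.

(* Boundary values of functions holomorphic outside, with value [L] at infinity. *)
Definition hardy_out (f : R -> R[i]) (L : R[i]) : Prop :=
  [/\ ccontinuous f, forall k, CI (fun t => f t * (e t)^-1 ^+ k.+1) = 0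
    & CI f = (2 * pi)%:C * L].

Let cX (f : R -> R[i]) g k : ccontinuous f -> ccontinuous g -> ccontinuous (fun t => f t * g t ^+ k).
Proof. by move=> cf cg; apply: ccontinuousM => //; exact: ccontinuousX. Qed.

Let ceiX f k : ccontinuous f -> ccontinuous (fun t => f t * (e t)^-1 ^+ k).
Proof. by move=> cf; exact: (@cX f (fun t => (e t)^-1) k cf cei). Qed.

Lemma hardy_inD f g : hardy_in f -> hardy_in g -> hardy_in (fun t => f t + g t).
Proof.
move=> [cf hf] [cg hg]; split; first exact: ccontinuousD.
move=> k; under eq_complex_integral do rewrite mulrDl.
by rewrite complex_integralD ?hf ?hg ?addr0 //; exact: cX.
Qed.

Lemma hardy_inZ a f : hardy_in f -> hardy_in (fun t => a * f t).
Proof.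
move=> [cf hf]; split; first by apply: ccontinuousM => //; exact: ccontinuous_cst.
move=> k; under eq_complex_integral do rewrite -mulrA.
by rewrite complex_integralZ ?hf ?mulr0 //; exact: cX.
Qed.

Lemma hardy_in_e f : hardy_in f -> hardy_in (fun t => f t * e t).
Proof.
move=> [cf hf]; split; first exact: ccontinuousM.
by move=> k; under eq_complex_integral do rewrite -mulrA -exprS; exact: hf.
Qed.

Lemma hardy_in_const a : hardy_in (fun=> a).
Proof.
split; first exact: ccontinuous_cst.
move=> k; rewrite complex_integralZ; last exact: ccontinuousX.
under eq_complex_integral do rewrite exprMn.
rewrite complex_integralZ; last by apply: ccontinuousX; exact: ccontinuous_cis.
by rewrite (complex_integral_cisX R (ltn0Sn k)).1 !mulr0.
Qed.

Lemma hardy_in_poly (p : {poly R[i]}) : hardy_in (fun t => p.[zeta t]).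
Proof.
elim/poly_ind: p => [|p a IH].
  by under eq_fun do rewrite horner0; exact: hardy_in_const.
under eq_fun do rewrite hornerMXaddC.
apply: hardy_inD; last exact: hardy_in_const.
under eq_fun do rewrite mulrDr mulrC.
by apply: hardy_inD; [exact: hardy_inZ|exact: hardy_in_e].
Qed.

Lemma zeta_neq_out q : rho < normc (q - c) -> forall t, zeta t - q != 0.
Proof.
move=> qr t; apply/eqP => z0; move: qr.
have -> : q - c = e t by apply/eqP; rewrite -subr_eq0 -opprB oppr_eq0 -z0 /zeta; apply/eqP; ring.
by rewrite normc_e ltxx.
Qed.

Lemma zeta_neq_in q : normc (q - c) < rho -> forall t, zeta t - q != 0.
Proof.
move=> qr t; apply/eqP => z0; move: qr.
have -> : q - c = e t by apply/eqP; rewrite -subr_eq0 -opprB oppr_eq0 -z0 /zeta; apply/eqP; ring.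
by rewrite normc_e ltxx.
Qed.

(** Since [zeta - q = e - (q - c)] and the moments of [f] vanish, each moment of the quotient is
    [q - c] times the previous one. A moment thus equals the [j]-th following one, of order [rho^j],
    divided by [(q - c)^j]; as [j] grows it must be 0. *)
Lemma hardy_in_div f q : rho < normc (q - c) -> hardy_in f ->
  hardy_in (fun t => f t / (zeta t - q)).
Proof.
move=> qr [cf hf]; have zq := zeta_neq_out qr.
have cg : ccontinuous (fun t => f t / (zeta t - q)).
  apply: ccontinuousM => //; apply: ccontinuousV => //.
  by apply: ccontinuousD => //; exact: ccontinuous_cst.
split=> // k; set g := fun t => f t / (zeta t - q).
have d0 : q - c != 0.
  apply/eqP => d0; move: qr; rewrite d0 ComplexField.Normc.normc0.
  by rewrite ltNge ltW.
have rec j : CI (fun t => g t * e t ^+ j.+2) = (q - c) * CI (fun t => g t * e t ^+ j.+1).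
  rewrite -complex_integralZ; last exact: cX.
  rewrite -[RHS]addr0 -(hf j) -complex_integralD; first last.
  - exact: cX.
  - by apply: ccontinuousM; [exact: ccontinuous_cst|exact: cX].
  apply: eq_complex_integral => t.
  have -> : f t = g t * (zeta t - q) by rewrite /g divfK.
  by rewrite [e t ^+ j.+2]exprS /zeta; ring.
have iter j : CI (fun t => g t * e t ^+ k.+1) = (q - c) ^- j * CI (fun t => g t * e t ^+ (k + j).+1).
  elim: j => [|j ->]; first by rewrite addn0 expr0 invr1 mul1r.
  by rewrite addnS rec exprSr invfM mulrA divfK.
have [B gB] := ccontinuous_bounded cg.
apply: (@geometric_eq0 _ _ (B * rho ^+ k.+1 * (4 * pi)) (rho / normc (q - c))).
  rewrite divr_ge0 ?normc_ge0 ?ltW //= ltr_pdivrMr ?mul1r //.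
  exact: lt_trans qr.
move=> j; rewrite (iter j) ComplexField.Normc.normcM ComplexField.Normc.normcV normcX.
have D0 : normc (q - c) != 0 by rewrite gt_eqF // (lt_trans rho_gt0).
have h : normc (CI (fun t => g t * e t ^+ (k + j).+1)) <= B * rho ^+ (k + j).+1 * (4 * pi).
  apply: normc_complex_integral; first exact: cX.
  move=> t tI; rewrite ComplexField.Normc.normcM normcX normc_e.
  by apply: ler_wpM2r; [rewrite exprn_ge0 ?ltW|exact: gB].
apply: (le_trans (ler_wpM2l _ h)); first by rewrite invr_ge0 exprn_ge0 ?normc_ge0.
by rewrite le_eqVlt; apply/orP; left; apply/eqP; rewrite -addSn exprD expr_div_n; field; rewrite expf_neq0.
Qed.

Lemma hardy_outD f g L L' : hardy_out f L -> hardy_out g L' ->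
  hardy_out (fun t => f t + g t) (L + L').
Proof.
move=> [cf hf Lf] [cg hg Lg]; split; first exact: ccontinuousD.
  move=> k; under eq_complex_integral do rewrite mulrDl.
  have -> := @complex_integralD _ (fun t => f t * (e t)^-1 ^+ k.+1) (fun t => g t * (e t)^-1 ^+ k.+1).
    by rewrite hf hg addr0.
    exact: (ceiX k.+1 cf).
  exact: (ceiX k.+1 cg).
rewrite complex_integralD; [|exact: cf|exact: cg].
by rewrite Lf Lg -mulrDr.
Qed.

Lemma hardy_outZ a f L : hardy_out f L -> hardy_out (fun t => a * f t) (a * L).
Proof.
move=> [cf hf Lf]; split; first by apply: ccontinuousM => //; exact: ccontinuous_cst.
  move=> k; under eq_complex_integral do rewrite -mulrA.
  have -> := @complex_integralZ _ a (fun t => f t * (e t)^-1 ^+ k.+1).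
    by rewrite hf mulr0.
  exact: (ceiX k.+1 cf).
rewrite complex_integralZ; last exact: cf.
by rewrite Lf [LHS]mulrCA.
Qed.

Lemma hardy_out_einv f L : hardy_out f L -> hardy_out (fun t => f t * (e t)^-1) 0.
Proof.
move=> [cf hf Lf]; split; first exact: ccontinuousM.
  by move=> k; under eq_complex_integral do rewrite -mulrA -exprS; exact: hf.
by rewrite mulr0; exact: (hf 0%N).
Qed.

Lemma hardy_out_const a : hardy_out (fun=> a) a.
Proof.
split; first exact: ccontinuous_cst.
  move=> k; rewrite complex_integralZ; last exact: ccontinuousX.
  under eq_complex_integral do rewrite invfM exprMn.
  rewrite complex_integralZ; last first.
    by apply: ccontinuousX; apply: ccontinuousV; [exact: cis_neq0|exact: ccontinuous_cis].
  by rewrite (complex_integral_cisX R (ltn0Sn k)).2 !mulr0.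
have -> : (fun _ : R => a) = (fun=> a * 1) by apply/funext => ?; rewrite mulr1.
rewrite complex_integralZ; last exact: ccontinuous_cst.
by rewrite complex_integral1; exact: mulrC.
Qed.

Lemma eq_hardy_out f g L : f =1 g -> hardy_out f L -> hardy_out g L.
Proof. by move=> /funext ->. Qed.

(** As [zeta = c + e], division by [e^d] leaves the coefficient of degree [d] as the value at
    infinity. *)
Lemma hardy_out_poly d (p : {poly R[i]}) : (size p <= d.+1)%N ->
  hardy_out (fun t => p.[zeta t] * (e t)^-1 ^+ d) p`_d.
Proof.
elim: d p => [|d IH] p sp.
  have -> : p = (p`_0)%:P by apply: size1_polyC.
  rewrite coefC eqxx; apply: eq_hardy_out (hardy_out_const _) => t.
  by rewrite hornerC expr0 mulr1.
case: (@poly_ind _ (fun q => exists q' b, q = q' * 'X + b%:P) _ _ p) => [||q [b pE]].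
- by exists 0, 0; rewrite mul0r add0r.
- by move=> q b _; exists q, b.
have sq : (size q <= d.+1)%N.
  have [->|q0] := eqVneq q 0; first by rewrite size_poly0.
  by move: sp; rewrite pE size_MXaddC (negPf q0).
have -> : p`_d.+1 = q`_d + (c * 0 + b * 0).
  by rewrite pE coefD coefMX coefC /= !mulr0 !addr0.
have h := IH q sq.
have h2 := hardy_out_einv h.
have hb : hardy_out (fun t => (e t)^-1 ^+ d.+1) 0.
  elim: d {IH sp sq h h2 q pE p} => [|d IH].
    by apply: eq_hardy_out (hardy_out_einv (hardy_out_const 1)) => t; rewrite mul1r expr1.
  by apply: eq_hardy_out (hardy_out_einv IH) => t; rewrite [RHS]exprSr.
apply: eq_hardy_out (hardy_outD h (hardy_outD (hardy_outZ c h2) (hardy_outZ b hb))) => t.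
rewrite pE hornerMXaddC !exprSr.
set Q := q.[zeta t]; have -> : zeta t = c + e t by [].
have ee : e t * (e t)^-1 = 1 by rewrite mulfV.
set E := (e t)^-1 ^+ d; set E1 := (e t)^-1 in ee *; move: Q E E1 ee => Q E E1 ee.
rewrite [RHS](_ : _ = Q * c * (E * E1) + Q * E * (e t * E1) + b * (E * E1)); last by ring.
by rewrite ee; ring.
Qed.

(** The factor [e / (zeta - q)] tends to 1 at infinity, hence the same [L]. The argument mirrors
    [hardy_in_div] with negative powers and the ratio of [|q - c|] to [rho]. *)
Lemma hardy_out_div f L q : normc (q - c) < rho -> hardy_out f L ->
  hardy_out (fun t => f t * (e t / (zeta t - q))) L.
Proof.
move=> qr [cf hf Lf]; have zq := zeta_neq_in qr.
set g := fun t => f t * (e t / (zeta t - q)).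
have cg : ccontinuous g.
  apply: ccontinuousM => //; apply: ccontinuousM => //; apply: ccontinuousV => //.
  by apply: ccontinuousD => //; exact: ccontinuous_cst.
have fE t : f t = g t * (1 - (q - c) * (e t)^-1).
  rewrite /g /zeta; have := zq t; have := e_neq0 t; rewrite /zeta => h1 h2.
  by field; rewrite h1 h2.
have rec k : CI (fun t => g t * (e t)^-1 ^+ k) - (q - c) * CI (fun t => g t * (e t)^-1 ^+ k.+1)
    = CI (fun t => f t * (e t)^-1 ^+ k).
  rewrite -mulNr -complex_integralZ; last exact: cX.
  rewrite -complex_integralD; first last.
  - by apply: ccontinuousM; [exact: ccontinuous_cst|exact: cX].
  - exact: cX.
  by apply: eq_complex_integral => t; rewrite fE exprS; ring.
have [B gB] := ccontinuous_bounded cg.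
have m0 k : CI (fun t => g t * (e t)^-1 ^+ k.+1) = 0.
  have iter j : CI (fun t => g t * (e t)^-1 ^+ k.+1) =
      (q - c) ^+ j * CI (fun t => g t * (e t)^-1 ^+ (k + j).+1).
    elim: j => [|j ->]; first by rewrite addn0 expr0 mul1r.
    have /eqP := etrans (rec (k + j).+1) (hf _); rewrite subr_eq0 => /eqP ->.
    by rewrite addnS exprSr mulrA.
  apply: (@geometric_eq0 _ _ (B * rho^-1 ^+ k.+1 * (4 * pi)) (normc (q - c) / rho)).
    by rewrite divr_ge0 ?normc_ge0 ?ltW //= ltr_pdivrMr ?mul1r.
  move=> j; rewrite (iter j) ComplexField.Normc.normcM normcX.
  have h : normc (CI (fun t => g t * (e t)^-1 ^+ (k + j).+1)) <= B * rho^-1 ^+ (k + j).+1 * (4 * pi).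
    apply: normc_complex_integral; first exact: cX.
    move=> t tI; rewrite ComplexField.Normc.normcM normcX ComplexField.Normc.normcV normc_e.
    by apply: ler_wpM2r; [rewrite exprn_ge0 ?invr_ge0 ?ltW|exact: gB].
  apply: (le_trans (ler_wpM2l _ h)); first by rewrite exprn_ge0 ?normc_ge0.
  have -> : rho^-1 ^+ (k + j).+1 = rho^-1 ^+ k.+1 * rho^-1 ^+ j by rewrite -exprD addSn.
  rewrite exprMn; move: (rho^-1 ^+ _) (rho^-1 ^+ _) (normc _ ^+ _) (4 * pi) => r1 r2 r3 r4.
  by rewrite le_eqVlt; apply/orP; left; apply/eqP; ring.
split=> //.
have := rec 0%N; rewrite m0 mulr0 subr0.
under eq_complex_integral do rewrite expr0 mulr1.
by move=> ->; rewrite -Lf; apply: eq_complex_integral => t; rewrite expr0 mulr1.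
Qed.

Lemma circle_integralE (f : R[i] -> R[i]) : ccontinuous (fun t => f (zeta t)) ->
  circle_integral C f = 'i%C * CI (fun t => f (zeta t) * e t).
Proof.
move=> cf; rewrite -complex_integralZ; last exact: ccontinuousM.
by apply: eq_complex_integral => t; exact: mulrCA.
Qed.

Lemma circle_integral_out (p : {poly R[i]}) s :
  (forall a, a \in s -> rho < normc (a - c)) ->
  ccontinuous (fun t => p.[zeta t] / (root_poly s).[zeta t]) /\
  circle_integral C (fun z => p.[z] / (root_poly s).[z]) = 0.
Proof.
move=> sout.
have h : hardy_in (fun t => p.[zeta t] / (root_poly s).[zeta t]).
  elim: s sout => [|a s IH] sout.
    rewrite /root_poly big_nil; under eq_fun do rewrite hornerC divr1.
    exact: hardy_in_poly.
  rewrite /root_poly big_cons; under eq_fun do rewrite hornerM hornerXsubC invfM mulrA mulrAC.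
  apply: hardy_in_div; first by apply: sout; rewrite mem_head.
  by apply: IH => b bs; apply: sout; rewrite inE bs orbT.
split; first by case: h.
rewrite circle_integralE; last by case: h.
by have [_ /(_ 0%N)] := h; rewrite /= => ->; rewrite mulr0.
Qed.

Lemma hardy_out_monic s (f : R -> R[i]) L :
  (forall a, a \in s -> normc (a - c) < rho) -> hardy_out f L ->
  hardy_out (fun t => f t * (e t ^+ size s / (root_poly s).[zeta t])) L.
Proof.
elim: s f => [|a s IH] f sin hf.
  by apply: eq_hardy_out hf => t; rewrite /root_poly big_nil hornerC divr1 mulr1.
have aE : normc (a - c) < rho by apply: sin; rewrite mem_head.
have H : hardy_out (fun t => f t * (e t / (zeta t - a)) * (e t ^+ size s / (root_poly s).[zeta t])) L.
  apply: IH; last exact: hardy_out_div aE hf.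
  by move=> b bs; apply: sin; rewrite inE bs orbT.
apply: eq_hardy_out H => t.
rewrite /root_poly big_cons hornerM hornerXsubC [size _]/= [in RHS]exprS invfM.
by move: (f t) (e t) (_^-1) (_^-1) (_ ^+ _) => *; ring.
Qed.

(** The integral is read off at infinity instead of summing residues: one factor [e] per root
    balances the denominator, [size s - 1] inverse factors balance the numerator, and the factor
    left over is the one of the line element. *)
Lemma circle_integral_in (p : {poly R[i]}) s : (size p <= size s)%N ->
  (forall a, a \in s -> normc (a - c) < rho) ->
  ccontinuous (fun t => p.[zeta t] / (root_poly s).[zeta t]) /\
  circle_integral C (fun z => p.[z] / (root_poly s).[z]) =
    (2 * pi)%:C * 'i%C * p`_(size s).-1.
Proof.
case: s => [|a0 s0] sp.
  have -> : p = 0 by apply/eqP; rewrite -size_poly_eq0 -leqn0.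
  move=> _; split; first by under eq_fun do rewrite horner0 mul0r; exact: ccontinuous_cst.
  rewrite coef0 mulr0 circle_integralE; last first.
    by under eq_fun do rewrite horner0 mul0r; exact: ccontinuous_cst.
  have := etrans (@complex_integralZ R 0 (fun=> 1) (ccontinuous_cst _)) (mul0r _).
  move=> I10; set I2 := CI _; set I1 := LHS in I10; suff -> : I2 = I1 by rewrite I10 mulr0.
  by apply: eq_complex_integral => t; rewrite horner0 !mul0r.
set s := a0 :: s0; move=> sin.
have h : hardy_out (fun t => p.[zeta t] * (e t)^-1 ^+ (size s).-1 *
    (e t ^+ size s / (root_poly s).[zeta t])) p`_(size s).-1.
  exact: hardy_out_monic sin (@hardy_out_poly (size s).-1 p sp).
have hE t : p.[zeta t] * (e t)^-1 ^+ (size s).-1 * (e t ^+ size s / (root_poly s).[zeta t]) =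
    p.[zeta t] / (root_poly s).[zeta t] * e t.
  rewrite /= exprVn [e t ^+ (size s0).+1]exprS.
  have := e_neq0 t; move=> e0.
  have e1 : e t ^+ size s0 != 0 by rewrite expf_neq0.
  rewrite mulrACA -!mulrA; congr (_ * _).
  by rewrite mulrCA [in LHS]mulrA mulrA [_ * e t]mulrC -!mulrA mulVKf //; ring.
have cq : ccontinuous (fun t => p.[zeta t] / (root_poly s).[zeta t]).
  have [ch _ _] := h.
  have -> : (fun t => p.[zeta t] / (root_poly s).[zeta t]) =
     (fun t => p.[zeta t] * (e t)^-1 ^+ (size s).-1 *
    (e t ^+ size s / (root_poly s).[zeta t]) * (e t)^-1).
    by apply/funext => t; rewrite hE mulfK.
  exact: ccontinuousM.
split=> //; rewrite circle_integralE //.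
under eq_complex_integral do rewrite -hE.
have [_ _ ->] := h.
by rewrite mulrA [_ * (2 * pi)%:C]mulrC.
Qed.

Lemma circle_integralD f g : ccontinuous (fun t => f (zeta t)) -> ccontinuous (fun t => g (zeta t)) ->
  circle_integral C (fun z => f z + g z) = circle_integral C f + circle_integral C g.
Proof.
move=> cf cg; rewrite !circle_integralE //; last exact: ccontinuousD.
under eq_complex_integral do rewrite mulrDl.
rewrite complex_integralD; [exact: mulrDr|exact: ccontinuousM|exact: ccontinuousM].
Qed.

Lemma circle_integralZ a f : ccontinuous (fun t => f (zeta t)) ->
  circle_integral C (fun z => a * f z) = a * circle_integral C f.
Proof.
move=> cf; rewrite !circle_integralE //; last by apply: ccontinuousM => //; exact: ccontinuous_cst.
under eq_complex_integral do rewrite -mulrA.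
rewrite complex_integralZ; last exact: ccontinuousM.
exact: mulrCA.
Qed.

Lemma eq_circle_integral (f g : R[i] -> R[i]) :
  (forall t, f (zeta t) = g (zeta t)) -> circle_integral C f = circle_integral C g.
Proof.
by move=> fg; rewrite /circle_integral; apply: eq_complex_integral => t; congr (_ * _); exact: fg.
Qed.

End CircleIntegral.

Section ContourIntegral.
Variable R : realType.
Local Notation normc := ComplexField.Normc.normc.
Implicit Types (C : circle R) (s : seq R[i]) (p : {poly R[i]}) (f g : R[i] -> R[i]).

Definition inside C (z : R[i]) := normc (z - ccenter C) < cradius C.
Definition outside C (z : R[i]) := cradius C < normc (z - ccenter C).
Definition on_circle C (z : R[i]) := normc (z - ccenter C) = cradius C.

Definition regular C f := ccontinuous (fun t => f (ccenter C + (cradius C)%:C * cis t)).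

Definition contour_int C f : R[i] := ((2 * pi)%:C * 'i%C)^-1 * circle_integral C f.

Lemma two_pi_i_neq0 : (2 * pi : R)%:C * 'i%C != 0.
Proof.
rewrite mulf_neq0 //; last by rewrite eq_complex /= oner_eq0 andbF.
by rewrite eq_complex /= eqxx andbT mulf_neq0 // gt_eqF // pi_gt0.
Qed.

Variable C : circle R.
Hypothesis C_gt0 : 0 < cradius C.

Lemma on_circleP t : on_circle C (ccenter C + (cradius C)%:C * cis t).
Proof.
rewrite /on_circle addrC addKr ComplexField.Normc.normcM normc_cis mulr1 /=.
by rewrite expr0n addr0 sqrtr_sqr ger0_norm // ltW.
Qed.

Lemma eq_regular f g : (forall z, on_circle C z -> f z = g z) -> regular C f -> regular C g.
Proof.
by move=> fg; congr ccontinuous; apply/funext => t; apply: fg; exact: on_circleP.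
Qed.

Lemma regularD f g : regular C f -> regular C g -> regular C (fun z => f z + g z).
Proof. exact: ccontinuousD. Qed.

Lemma regularM f g : regular C f -> regular C g -> regular C (fun z => f z * g z).
Proof. exact: ccontinuousM. Qed.

Lemma regular_cst a : regular C (fun=> a).
Proof. exact: ccontinuous_cst. Qed.

Lemma eq_contour_int f g : (forall z, on_circle C z -> f z = g z) ->
  contour_int C f = contour_int C g.
Proof.
move=> fg; congr (_ * _); apply: eq_circle_integral => t.
by apply: fg; exact: on_circleP.
Qed.

Lemma contour_intD f g : regular C f -> regular C g ->
  contour_int C (fun z => f z + g z) = contour_int C f + contour_int C g.
Proof.
by move=> rf rg; rewrite /contour_int circle_integralD //; exact: mulrDr.
Qed.

Lemma contour_intZ a f : regular C f ->
  contour_int C (fun z => a * f z) = a * contour_int C f.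
Proof.
by move=> rf; rewrite /contour_int circle_integralZ //; exact: mulrCA.
Qed.

Lemma inside_neq z a : inside C a -> on_circle C z -> z != a.
Proof. by move=> aC zC; apply/eqP => e; move: aC; rewrite /inside -e zC ltxx. Qed.

Lemma outside_neq z a : outside C a -> on_circle C z -> z != a.
Proof. by move=> aC zC; apply/eqP => e; move: aC; rewrite /outside -e zC ltxx. Qed.

Lemma inside_outside_neq a b : inside C a -> outside C b -> a != b.
Proof. by move=> aC bC; apply/eqP => e; move: bC; rewrite /outside -e ltNge ltW. Qed.

Lemma contour_int_out p s : (forall a, a \in s -> outside C a) ->
  regular C (fun z => p.[z] / (root_poly s).[z]) /\
  contour_int C (fun z => p.[z] / (root_poly s).[z]) = 0.
Proof.
move=> so; have [h1 h2] := circle_integral_out C_gt0 p so; split=> //.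
by rewrite /contour_int h2 mulr0.
Qed.

Lemma contour_int_in p s : (size p <= size s)%N -> (forall a, a \in s -> inside C a) ->
  regular C (fun z => p.[z] / (root_poly s).[z]) /\
  contour_int C (fun z => p.[z] / (root_poly s).[z]) = p`_(size s).-1.
Proof.
move=> sp si; have [h1 h2] := circle_integral_in C_gt0 sp si; split=> //.
by rewrite /contour_int h2; apply: mulKf; exact: two_pi_i_neq0.
Qed.

Lemma contour_int_in0 p s : (size p < size s)%N -> (forall a, a \in s -> inside C a) ->
  regular C (fun z => p.[z] / (root_poly s).[z]) /\
  contour_int C (fun z => p.[z] / (root_poly s).[z]) = 0.
Proof.
move=> sp si; have [h1 ->] := contour_int_in (ltnW sp) si; split=> //.
by rewrite nth_default // -ltnS (ltn_predK sp).
Qed.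

Lemma on_notin z s : (forall a, a \in s -> inside C a) \/ (forall a, a \in s -> outside C a) ->
  on_circle C z -> (root_poly s).[z] != 0.
Proof.
move=> h zC; apply: root_poly_horner_neq0; apply/negP => zs.
by case: h => /(_ _ zs) h; [have := inside_neq h zC|have := outside_neq h zC]; rewrite eqxx.
Qed.

Lemma contour_int_split p s1 s2 (A B : {poly R[i]}) :
  (forall a, a \in s1 -> inside C a) -> (forall a, a \in s2 -> outside C a) ->
  (size A <= size s1)%N -> p = A * root_poly s2 + B * root_poly s1 ->
  regular C (fun z => p.[z] / ((root_poly s1).[z] * (root_poly s2).[z])) /\
  contour_int C (fun z => p.[z] / ((root_poly s1).[z] * (root_poly s2).[z])) = A`_(size s1).-1.
Proof.
move=> h1 h2 sA e.
have [r1 i1] := contour_int_in sA h1; have [r2 i2] := contour_int_out B h2.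
have E z : on_circle C z -> A.[z] / (root_poly s1).[z] + B.[z] / (root_poly s2).[z] =
    p.[z] / ((root_poly s1).[z] * (root_poly s2).[z]).
  move=> zC; rewrite e hornerD !hornerM.
  have n1 := on_notin (or_introl h1) zC; have n2 := on_notin (or_intror h2) zC.
  by field; rewrite n1 n2.
split; first exact: eq_regular E (regularD r1 r2).
by rewrite -(eq_contour_int E) contour_intD // i1 i2 addr0.
Qed.

Lemma regular_frac p s1 s2 :
  (forall a, a \in s1 -> inside C a) -> (forall a, a \in s2 -> outside C a) ->
  regular C (fun z => p.[z] / ((root_poly s1).[z] * (root_poly s2).[z])).
Proof.
move=> h1 h2.
have [|A [B [sA e]]] := @partial_fraction _ p s1 s2.
  move=> a a1; apply/negP => a2.
  by have := inside_outside_neq (h1 _ a1) (h2 _ a2); rewrite eqxx.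
by have [] := contour_int_split h1 h2 sA e.
Qed.

(* Cauchy's formula at a point [u] outside [C] for a fraction vanishing at infinity. *)
Lemma cauchy_outside p s u : (size p <= size s)%N -> (forall a, a \in s -> inside C a) ->
  outside C u ->
  contour_int C (fun v => p.[v] / ((root_poly s).[v] * (root_poly [:: u]).[v])) =
  - (p.[u] / (root_poly s).[u]).
Proof.
move=> sp si uo.
have us : u \notin s.
  by apply/negP => /si /inside_outside_neq /(_ uo); rewrite eqxx.
have P0 := root_poly_horner_neq0 us.
set P := root_poly s in P0 *.
(* The quotient [E] gives the partial fraction that separates [u] from [s]. Its coefficient of
   degree [size s - 1] is [- p.[u]], because [P] is monic of degree [size s] and [p] has smaller
   degree. *)
have /factor_theorem[E eE] : root (P.[u] *: p - p.[u] *: P) u.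
  by rewrite /root !hornerE mulrC subrr.
have sE : (size E <= size s)%N.
  have [->|E0] := eqVneq E 0; first by rewrite size_poly0.
  have : (size (E * ('X - u%:P))%R <= (size s).+1)%N.
    rewrite -eE (leq_trans (size_polyD _ _)) // geq_max size_polyN.
    rewrite !(leq_trans (size_scale_leq _ _)) ?size_root_poly //.
    exact: leq_trans sp _.
  by rewrite size_Mmonic ?monicXsubC // size_XsubC addn2 ltnS.
have uo' : forall a, a \in [:: u] -> outside C a by move=> a; rewrite inE => /eqP ->.
have e : p = (P.[u]^-1 *: E) * root_poly [:: u] + (p.[u] / P.[u])%:P * P.
  rewrite /root_poly big_seq1 -scalerAl -eE scalerBr !scalerA mulVf // scale1r.
  by rewrite mul_polyC mulrC subrK.
have sE' : (size (P.[u]^-1 *: E) <= size s)%N by exact: leq_trans (size_scale_leq _ _) sE.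
have [_ ->] := contour_int_split si uo' sE' e.
rewrite coefZ mulrC -mulNr; congr (_ / _).
have [s0|s0] := posnP (size s).
  move: sp sE; rewrite s0 !leqn0 !size_poly_eq0 => /eqP -> /eqP ->.
  by rewrite coef0 horner0 oppr0.
have := congr1 (fun q : {poly _} => q`_(size s)) eE.
rewrite coefB !coefZ mulrBr coefB coefMX coefMC [p`_ _]nth_default // [E`_(size s)]nth_default //.
have -> : P`_(size s) = 1 by have := monic_root_poly s; rewrite monicE /lead_coef size_root_poly => /eqP.
by rewrite mulr0 mulr1 mul0r sub0r subr0 eqn0Ngt s0 /=.
Qed.

Lemma cauchy_inside p s u : inside C u -> (forall a, a \in s -> outside C a) ->
  contour_int C (fun v => p.[v] / ((root_poly [:: u]).[v] * (root_poly s).[v])) =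
  p.[u] / (root_poly s).[u].
Proof.
move=> uC so.
have us : u \notin s.
  by apply/negP => /so /(inside_outside_neq uC); rewrite eqxx.
have P0 := root_poly_horner_neq0 us.
set P := root_poly s in P0 *.
have /factor_theorem[E eE] : root (p - (p.[u] / P.[u]) *: P) u.
  by rewrite /root !hornerE divfK // subrr.
have ui : forall a, a \in [:: u] -> inside C a by move=> a; rewrite inE => /eqP ->.
have e : p = (p.[u] / P.[u])%:P * P + E * root_poly [:: u].
  by rewrite /root_poly big_seq1 -eE mul_polyC addrC subrK.
have [_ ->] := contour_int_split ui so (size_polyC_leq1 _) e.
by rewrite coefC.
Qed.

Lemma circle_integral2 (D : circle R) (f : R[i] -> R[i] -> R[i]) :
  regular C (fun u => contour_int D (f u)) ->
  ((2 * pi)%:C * 'i%C) ^- 2 * circle_integral C (fun u => circle_integral D (f u)) =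
  contour_int C (fun u => contour_int D (f u)).
Proof.
move=> rf; have -> : (fun u => circle_integral D (f u)) =
    (fun u => (2 * pi)%:C * 'i%C * contour_int D (f u)).
  by apply/funext => u; rewrite /contour_int mulVKf // two_pi_i_neq0.
rewrite circle_integralZ // [RHS]/contour_int.
move: (_ * 'i%C) two_pi_i_neq0 => z0 z00.
by rewrite mulrA; congr (_ * _); rewrite expr2 invfM mulfVK.
Qed.

End ContourIntegral.

Lemma size_mul_lt (F : fieldType) (p q : {poly F}) i j : (size p <= i)%N -> (size q <= j)%N ->
  (0 < j)%N -> (size (p * q)%R < i + j)%N.
Proof. by move: (size_polyMleq p q); lia. Qed.

Section Nested.
Variable R : realType.
Local Notation normc := ComplexField.Normc.normc.
Variables C D : circle R.
Hypothesis CD : normc (ccenter C - ccenter D) + cradius C < cradius D.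

Lemma nested_le z : normc (z - ccenter C) <= cradius C -> inside D z.
Proof.
move=> zC; rewrite /inside (_ : z - _ = (z - ccenter C) + (ccenter C - ccenter D)); last by ring.
by apply: (le_lt_trans (le_normcD _ _)); apply: le_lt_trans CD; rewrite addrC lerD2l.
Qed.

Lemma nested_ge z : cradius D <= normc (z - ccenter D) -> outside C z.
Proof.
move=> zD; rewrite /outside ltNge; apply/negP => /nested_le.
by rewrite /inside ltNge zD.
Qed.

Lemma nested_in z : inside C z -> inside D z.
Proof. by move=> /ltW /nested_le. Qed.

Lemma nested_on z : on_circle C z -> inside D z.
Proof. by move=> zC; apply: nested_le; rewrite zC. Qed.

Lemma nested_out z : outside D z -> outside C z.
Proof. by move=> /ltW /nested_ge. Qed.

Lemma nested_on_out z : on_circle D z -> outside C z.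
Proof. by move=> zD; apply: nested_ge; rewrite zD. Qed.

End Nested.

(** * Double integrals over nested circles *)

Section DoubleIntegral.
Variable R : realType.
Local Notation normc := ComplexField.Normc.normc.
Local Notation P := root_poly.

Lemma contour_int_indep (C D : circle R) (p : {poly R[i]}) s1 s2 :
  0 < cradius C -> 0 < cradius D ->
  (forall a, a \in s1 -> inside C a /\ inside D a) ->
  (forall a, a \in s2 -> outside C a /\ outside D a) ->
  contour_int C (fun z => p.[z] / ((P s1).[z] * (P s2).[z])) =
  contour_int D (fun z => p.[z] / ((P s1).[z] * (P s2).[z])).
Proof.
move=> C0 D0 h1 h2.
have [|A [B [sA e]]] := @partial_fraction _ p s1 s2.
  move=> a a1; apply/negP => a2.
  by have := inside_outside_neq (h1 _ a1).1 (h2 _ a2).1; rewrite eqxx.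
have [_ ->] := @contour_int_split _ _ C0 p s1 s2 A B (fun a h => (h1 a h).1) (fun a h => (h2 a h).1) sA e.
by have [_ ->] := @contour_int_split _ _ D0 p s1 s2 A B (fun a h => (h1 a h).2) (fun a h => (h2 a h).2) sA e.
Qed.

Variables (Cu Cv : circle R) (sx s1 s2 sd : seq R[i]) (n Q q : {poly R[i]}).
Variable f : R[i] -> R[i] -> R[i].
Hypotheses (Cu0 : 0 < cradius Cu) (Cv0 : 0 < cradius Cv).
Hypothesis sx_out : forall a, a \in sx -> outside Cu a.
Hypothesis s1_in : forall a, a \in s1 -> inside Cv a.
Hypothesis s2_out : forall a, a \in s2 -> outside Cv a.
Hypothesis sd_in : forall a, a \in sd -> inside Cu a.
Hypothesis s1_gt0 : (0 < size s1)%N.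
Hypothesis sq : (size q <= size sd)%N.
Hypothesis fE : forall u v, on_circle Cu u -> on_circle Cv v ->
  f u v = (u - v)^-1 * ((P sx).[v] * n.[v] / ((P s1).[v] * (P s2).[v])) *
    (Q.[u] / (P sx).[u] + q.[u] / (P sd).[u]).

(* The [v]-integrand splits as [A / P s1 + B / P s2] over [u - v]; the integral over
   [v] leaves [A / P s1] at [u] when [u] is outside [Cv], and [- B / P s2] at [u] when
   it is inside. *)
Let g u := Q.[u] / (P sx).[u] + q.[u] / (P sd).[u].

(** In the remaining integral over [u], the [q] part has all its poles inside [Cu] and decays at
    least quadratically, so it vanishes. The [Q] part has the same poles inside both circles and
    moves to [Cv]; there, adding [Q * B] over [P s2] and [P sx], with all poles outside, restores
    the numerator [n]. *)
Lemma double_contour_int_u_outer : normc (ccenter Cv - ccenter Cu) + cradius Cv < cradius Cu ->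
  regular Cu (fun u => contour_int Cv (f u)) /\
  contour_int Cu (fun u => contour_int Cv (f u)) =
  contour_int Cv (fun v => Q.[v] * n.[v] / ((P s1).[v] * (P s2).[v])).
Proof.
move=> nest.
have [|A [B [sA e]]] := @partial_fraction _ (P sx * n) s1 s2.
  move=> a a1; apply/negP => a2.
  by have := inside_outside_neq (s1_in a1) (s2_out a2); rewrite eqxx.
have ev z : (P sx).[z] * n.[z] = A.[z] * (P s2).[z] + B.[z] * (P s1).[z].
  by rewrite -!hornerM -hornerD e.
have sxv : forall a, a \in sx -> outside Cv a by move=> a /sx_out; exact: nested_out.
have s1u : forall a, a \in s1 -> inside Cu a by move=> a /s1_in; exact: nested_in.
have inner u : on_circle Cu u -> contour_int Cv (f u) =
    (Q * A).[u] / ((P s1).[u] * (P sx).[u]) + (q * A).[u] / (P (sd ++ s1)).[u].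
  move=> uC; have uo := nested_on_out nest uC.
  have uo1 : forall a, a \in [:: u] -> outside Cv a by move=> a; rewrite inE => /eqP ->.
  have uo2 : forall a, a \in u :: s2 -> outside Cv a.
    by move=> a; rewrite inE => /orP[/eqP ->//|/s2_out].
  have r1 := regular_frac Cv0 A s1_in uo1.
  have [r2 i2] := contour_int_out Cv0 B uo2.
  have -> : contour_int Cv (f u) = contour_int Cv (fun v => - g u *
      (A.[v] / ((P s1).[v] * (P [:: u]).[v]) + B.[v] / (P (u :: s2)).[v])).
    apply: eq_contour_int => // v vC; rewrite fE // ev -/(g u).
    have n1 := on_notin (or_introl s1_in) vC; have n2 := on_notin (or_intror s2_out) vC.
    have uv := outside_neq uo vC.
    rewrite [P (u :: s2)]big_cons [P [:: u]]big_seq1 hornerM hornerXsubC -/(P s2).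
    field.
    by rewrite n1 n2 !subr_eq0 uv eq_sym uv.
  rewrite contour_intZ //; last exact: regularD r1 r2.
  rewrite contour_intD // i2 addr0 cauchy_outside // /g root_poly_cat !hornerM.
  have n1 := on_notin (or_introl s1u) uC; have n2 := on_notin (or_intror sx_out) uC.
  have n3 := on_notin (or_introl sd_in) uC.
  by field; rewrite n1 n2 n3.
have [|a|r2 i2] := @contour_int_in0 _ _ Cu0 (q * A) (sd ++ s1).
- by rewrite size_cat size_mul_lt.
- by rewrite mem_cat => /orP[/sd_in|/s1u].
have r1 := regular_frac Cu0 (Q * A) s1u sx_out.
split.
  apply: eq_regular (regularD r1 r2) => // u uC; exact: esym (inner u uC).
rewrite (eq_contour_int Cu0 inner) contour_intD // i2 addr0 (@contour_int_indep Cu Cv) //; first last.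
- by move=> a asx; split; [exact: sx_out|exact: sxv].
- by move=> a a1; split; [exact: s1u|exact: s1_in].
have out2 : forall a, a \in s2 ++ sx -> outside Cv a.
  by move=> a; rewrite mem_cat => /orP[/s2_out|/sxv].
have [r3 i3] := contour_int_out Cv0 (Q * B) out2.
rewrite -[LHS]addr0 -i3 -contour_intD //; last exact: regular_frac.
apply: eq_contour_int => // v vC.
have n1 := on_notin (or_introl s1_in) vC; have n2 := on_notin (or_intror s2_out) vC.
have n3 := on_notin (or_intror sxv) vC.
rewrite root_poly_cat !hornerM.
have -> : n.[v] = (A.[v] * (P s2).[v] + B.[v] * (P s1).[v]) / (P sx).[v].
  by rewrite -ev mulrC mulKf.
by field; rewrite n1 n2 n3.
Qed.

(** Here it is the [Q] part that vanishes, all its poles being outside [Cu]. The [q] part moves to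
    [Cv], where adding [q * A] over [P sd] and [P s1], with poles inside and quadratic decay,
    restores the full numerator. *)
Lemma double_contour_int_v_outer : normc (ccenter Cu - ccenter Cv) + cradius Cu < cradius Cv ->
  regular Cu (fun u => contour_int Cv (f u)) /\
  contour_int Cu (fun u => contour_int Cv (f u)) =
  - contour_int Cv (fun v => q.[v] * (P sx).[v] * n.[v] / ((P sd).[v] * (P s1).[v] * (P s2).[v])).
Proof.
move=> nest.
have [|A [B [sA e]]] := @partial_fraction _ (P sx * n) s1 s2.
  move=> a a1; apply/negP => a2.
  by have := inside_outside_neq (s1_in a1) (s2_out a2); rewrite eqxx.
have ev z : (P sx).[z] * n.[z] = A.[z] * (P s2).[z] + B.[z] * (P s1).[z].
  by rewrite -!hornerM -hornerD e.
have s2u : forall a, a \in s2 -> outside Cu a by move=> a /s2_out; exact: nested_out.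
have sdv : forall a, a \in sd -> inside Cv a by move=> a /sd_in; exact: nested_in.
have inner u : on_circle Cu u -> contour_int Cv (f u) =
    -1 * ((Q * B).[u] / (P (sx ++ s2)).[u] + (q * B).[u] / ((P sd).[u] * (P s2).[u])).
  move=> uC; have uo := nested_on nest uC.
  have uo1 : forall a, a \in [:: u] -> inside Cv a by move=> a; rewrite inE => /eqP ->.
  have uo2 : forall a, a \in u :: s1 -> inside Cv a.
    by move=> a; rewrite inE => /orP[/eqP ->//|/s1_in].
  have r1 := regular_frac Cv0 B uo1 s2_out.
  have [r2 i2] := @contour_int_in0 _ _ Cv0 A (u :: s1) sA uo2.
  have -> : contour_int Cv (f u) = contour_int Cv (fun v => - g u *
      (A.[v] / (P (u :: s1)).[v] + B.[v] / ((P [:: u]).[v] * (P s2).[v]))).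
    apply: eq_contour_int => // v vC; rewrite fE // ev -/(g u).
    have n1 := on_notin (or_introl s1_in) vC; have n2 := on_notin (or_intror s2_out) vC.
    have uv := inside_neq uo vC.
    rewrite [P (u :: s1)]big_cons [P [:: u]]big_seq1 hornerM hornerXsubC -/(P s1).
    field.
    by rewrite n1 n2 !subr_eq0 uv eq_sym uv.
  rewrite contour_intZ //; last exact: regularD r2 r1.
  rewrite contour_intD // i2 add0r cauchy_inside // /g root_poly_cat !hornerM.
  have n1 := on_notin (or_intror s2u) uC; have n2 := on_notin (or_intror sx_out) uC.
  have n3 := on_notin (or_introl sd_in) uC.
  by field; rewrite n1 n2 n3.
have out1 : forall a, a \in sx ++ s2 -> outside Cu a.
  by move=> a; rewrite mem_cat => /orP[/sx_out|/s2u].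
have [r1 i1] := contour_int_out Cu0 (Q * B) out1.
have r2 := regular_frac Cu0 (q * B) sd_in s2u.
split.
  apply: eq_regular (regularM (regular_cst Cu (-1)) (regularD r1 r2)) => // u uC.
  exact: esym (inner u uC).
rewrite (eq_contour_int Cu0 inner) contour_intZ //; last exact: regularD.
rewrite mulN1r contour_intD // i1 add0r; congr (- _).
rewrite (@contour_int_indep Cu Cv) //; first last.
- by move=> a asx; split; [exact: s2u|exact: s2_out].
- by move=> a a1; split; [exact: sd_in|exact: sdv].
have [|a|r3 i3] := @contour_int_in0 _ _ Cv0 (q * A) (sd ++ s1).
- by rewrite size_cat size_mul_lt.
- by rewrite mem_cat => /orP[/sdv|/s1_in].
rewrite -[LHS]addr0 -i3 -contour_intD //; last exact: regular_frac.
apply: eq_contour_int => // v vC.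
have n1 := on_notin (or_introl s1_in) vC; have n2 := on_notin (or_intror s2_out) vC.
have n3 := on_notin (or_introl sdv) vC.
rewrite root_poly_cat !hornerM -[q.[v] * _ * _]mulrA ev.
by field; rewrite n1 n2 n3.
Qed.

End DoubleIntegral.

(** * The kernel as a double contour integral *)

Section HopMorphism.
Variables (F K : fieldType) (f : {rmorphism F -> K}) (y S w om : nat -> F).

Lemma rmorph_hops t n a b :
  f (hops y S w om t n a b) =
  hops (fun p => f (y p)) (fun p => f (S p)) (fun d => f (w d)) (fun d => f (om d)) t n a b.
Proof.
elim: n t a => [|n IH] t a /=; first by rewrite rmorph_nat.
rewrite rmorph_sum; apply: eq_bigr => c _; rewrite rmorphM IH; congr (_ * _).
rewrite /hop_at /hop; case: ifP => _; first by rewrite fmorph_div !rmorphB.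
case: ifP => _; last exact: rmorph0.
rewrite !rmorphM rmorph_prod !fmorphV !rmorphB; congr (_ * _ * _).
by apply: eq_bigr => j _; rewrite fmorph_div !rmorphB.
Qed.

End HopMorphism.

Section ScalarTransfer.
Variables (F : fieldType) (y S w om : nat -> F).

Definition phi_val b (v : F) := (\prod_(1 <= j < b) (v - S j)) / \prod_(1 <= j < b.+1) (v - y j).

(** The factor of the kernel that depends on [a]. On a circle separating the [y_p] from the [S_p] it
    is biorthogonal to [phi_val], by the three cases of [hop_density] with no rows. *)
Definition dual_val a (v : F) :=
  (y a - S a) / (v - S a) * \prod_(1 <= j < a) ((v - y j) / (v - S j)).

Definition tau_val t n (v : F) := \prod_(t <= d < t + n) ((v - om d) / (v - w d)).

Lemma tau_val0 t v : tau_val t 0 v = 1.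
Proof. by rewrite /tau_val addn0 big_geq. Qed.

Definition vac_val a (v : F) := \prod_(1 <= j < a.+1) ((v - S j) / (v - y j)).

Variable v : F.
Hypothesis vy : forall p, (1 <= p)%N -> v != y p.
Hypothesis vS : forall p, (1 <= p)%N -> v != S p.

Lemma vac_valS a : vac_val a.+1 v = vac_val a v * ((v - S a.+1) / (v - y a.+1)).
Proof. by rewrite /vac_val big_nat_recr. Qed.

Lemma phi_vac b : phi_val b.+1 v = vac_val b v / (v - y b.+1).
Proof.
rewrite /phi_val /vac_val prodf_div [X in _ / X]big_nat_recr //= invfM.
by rewrite mulrA.
Qed.

Lemma vac_dual a : (1 <= a)%N -> vac_val a v * dual_val a v = (y a - S a) / (v - y a).
Proof.
case: a => // a _; rewrite /vac_val /dual_val big_nat_recr //=.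
have e : (\prod_(1 <= j < a.+1) ((v - S j) / (v - y j))) *
   \prod_(1 <= j < a.+1) ((v - y j) / (v - S j)) = 1.
  rewrite -big_split big_nat big1 // => j /andP[j1 _] /=.
  have := vS j1; have := vy j1; rewrite -!(subr_eq0 v) => h1 h2.
  by field; rewrite h1 h2.
rewrite mulrACA [X in _ * X]mulrC mulrACA e mul1r.
have := vS (ltn0Sn a); have := vy (ltn0Sn a); rewrite -!(subr_eq0 v) => h1 h2.
by field; rewrite h1 h2.
Qed.

(** Scalar counterpart of [transfer_vecE] at a complex point. The number of columns stays finite, so
    that the remainder is a fraction whose contour integral can be evaluated. *)
Lemma hop_transfer t b M : (1 <= b)%N -> (b <= M)%N -> v != w t ->
  (forall p, (1 <= p)%N -> S p != w t) ->
  \sum_(b <= c < M.+1) hop_at y S w om t b c * phi_val c v =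
  phi_val b v * ((v - om t) / (v - w t)) -
  (om t - w t) / (S b - w t) * (\prod_(b.+1 <= j < M.+1) ((y j - w t) / (S j - w t))) *
    vac_val M v / (v - w t).
Proof.
move=> b1 bM vw Sw; have vw0 : v - w t != 0 by rewrite subr_eq0.
elim: M bM => [|M IH] bM; first by case: b b1 bM.
case: (ltnP M b) => Mb.
  have -> : b = M.+1 by lia.
  rewrite big_nat1 big_geq // mulr1 /hop_at /hop eqxx phi_vac.
  rewrite vac_valS.
  have := vS (ltn0Sn M); have := vy (ltn0Sn M); have := Sw _ (ltn0Sn M).
  rewrite -(subr_eq0 v) -(subr_eq0 v) -(subr_eq0 (S _)) => h1 h2 h3.
  by field; rewrite h1 h2 vw0.
rewrite big_nat_recr; last exact: bM.
rewrite (IH Mb) /=.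
have -> : \prod_(b.+1 <= j < M.+2) ((y j - w t) / (S j - w t)) =
    (\prod_(b.+1 <= j < M.+1) ((y j - w t) / (S j - w t))) * ((y M.+1 - w t) / (S M.+1 - w t)).
  by rewrite big_nat_recr.
rewrite {1}/hop_at /hop gtn_eqF ?ltnS // Mb phi_vac vac_valS.
have := vS (ltn0Sn M); have := vy (ltn0Sn M); have := Sw _ (ltn0Sn M).
rewrite -(subr_eq0 v) -(subr_eq0 v) -(subr_eq0 (S _)) => h1 h2 h3.
have h4 : S b - w t != 0 by rewrite subr_eq0 Sw.
move: (\prod_(_ <= _ < _) _) (vac_val M v) (phi_val b v) => A B D.
by field; rewrite h1 h2 vw0 h4.
Qed.

End ScalarTransfer.

Section ContourHops.
Variables (R : realType) (C : circle R) (y S w om : nat -> R[i]).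
Hypothesis C_gt0 : 0 < cradius C.
Hypothesis y_in : forall p, (1 <= p)%N -> inside C (y p).
Hypothesis S_out : forall p, (1 <= p)%N -> outside C (S p).
Hypothesis w_in : forall d, inside C (w d).

Definition nodes_in (f : nat -> R[i]) i j : seq R[i] := [seq f k | k <- index_iota i j].

Lemma size_nodes_in f i j : size (nodes_in f i j) = (j - i)%N.
Proof. by rewrite size_map size_iota. Qed.

Lemma root_poly_nodes f i j v :
  (root_poly (nodes_in f i j)).[v] = \prod_(i <= k < j) (v - f k).
Proof.
rewrite /root_poly big_map horner_prod; apply: eq_bigr => k _.
by rewrite hornerXsubC.
Qed.

Lemma nodes_inP (Q : R[i] -> Prop) f i j :
  (forall p, (i <= p)%N -> Q (f p)) -> forall a, a \in nodes_in f i j -> Q a.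
Proof. by move=> h a /mapP[p]; rewrite mem_index_iota => /andP[ip _] ->; exact: h. Qed.

Lemma contour_int_sum (I : eqType) (r : seq I) (f : I -> R[i] -> R[i]) :
  (forall i, i \in r -> regular C (f i)) ->
  regular C (fun z => \sum_(i <- r) f i z) /\
  contour_int C (fun z => \sum_(i <- r) f i z) = \sum_(i <- r) contour_int C (f i).
Proof.
elim: r => [|i r IH] h.
  have [r0 i0] := contour_int_out C_gt0 0 (s := [::]) (fun a h => ltac:(by [])).
  rewrite big_nil; split.
    by apply: eq_regular r0 => // z _; rewrite big_nil horner0 mul0r.
  by rewrite -i0; apply: eq_contour_int => // z _; rewrite big_nil horner0 mul0r.
have [|r1 i1] := IH; first by move=> j jr; apply: h; rewrite inE jr orbT.
have r2 : regular C (f i) by apply: h; rewrite mem_head.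
have e z : f i z + \sum_(j <- r) f j z = \sum_(j <- i :: r) f j z by rewrite big_cons.
rewrite big_cons; split; first by apply: eq_regular (regularD r2 r1).
by rewrite -i1 -contour_intD //; apply: eq_contour_int.
Qed.

Definition hop_density b a t n v := phi_val y S b v * dual_val y S a v * tau_val w om t n v.

Lemma dual_valE a v : (1 <= a)%N -> dual_val y S a v =
  (y a - S a) * ((\prod_(1 <= j < a) (v - y j)) / \prod_(1 <= j < a.+1) (v - S j)).
Proof.
case: a => // a _; rewrite /dual_val prodf_div [X in _ = _ * (_ / X)]big_nat_recr //= invfM.
by move: (_^-1) (\prod_(_ <= _ < _) _) (_^-1) => *; ring.
Qed.

Let prod_y_neq0 z i j : on_circle C z -> (1 <= i)%N -> \prod_(i <= k < j) (z - y k) != 0.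
Proof.
move=> zC i1; rewrite -root_poly_nodes.
suff h : forall a, a \in nodes_in y i j -> inside C a by exact: on_notin (or_introl h) zC.
by apply: nodes_inP => p ip; apply: y_in; exact: leq_trans ip.
Qed.

Let prod_S_neq0 z i j : on_circle C z -> (1 <= i)%N -> \prod_(i <= k < j) (z - S k) != 0.
Proof.
move=> zC i1; rewrite -root_poly_nodes.
suff h : forall a, a \in nodes_in S i j -> outside C a by exact: on_notin (or_intror h) zC.
by apply: nodes_inP => p ip; apply: S_out; exact: leq_trans ip.
Qed.

Let prod_w_neq0 z i j : on_circle C z -> \prod_(i <= k < j) (z - w k) != 0.
Proof.
move=> zC; rewrite -root_poly_nodes.
suff h : forall a, a \in nodes_in w i j -> inside C a by exact: on_notin (or_introl h) zC.
by apply: nodes_inP => p ip; exact: w_in.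
Qed.

Lemma regular_hop_density b a t n : (1 <= a)%N -> regular C (hop_density b a t n).
Proof.
move=> a1.
have h1 : forall c, c \in nodes_in y 1 b.+1 ++ nodes_in w t (t + n) -> inside C c.
  by move=> c; rewrite mem_cat => /orP[]; move: c; apply: nodes_inP => p ip; [exact: y_in|exact: w_in].
have h2 : forall c, c \in nodes_in S 1 a.+1 -> outside C c by apply: nodes_inP.
apply: eq_regular (regular_frac C_gt0 ((y a - S a) *: (root_poly (nodes_in S 1 b) *
  root_poly (nodes_in y 1 a) * root_poly (nodes_in om t (t + n)))) h1 h2) => // z zC.
rewrite /hop_density dual_valE // /phi_val /tau_val prodf_div.
rewrite hornerZ root_poly_cat !hornerM !root_poly_nodes !invfM.
by move: (_^-1) (_^-1) (_^-1) => *; ring.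
Qed.

(** The poles at the [S_p] cancel; the remaining ones are all inside, and the decay is quadratic. *)
Lemma hop_density_gt b a t n : (1 <= a)%N -> (a < b)%N ->
  contour_int C (hop_density b a t n) = 0.
Proof.
move=> a1 ab.
have h1 : forall c, c \in nodes_in y a b.+1 ++ nodes_in w t (t + n) -> inside C c.
  move=> c; rewrite mem_cat => /orP[]; move: c; apply: nodes_inP => p ip; last exact: w_in.
  by apply: y_in; exact: leq_trans ip.
set p := (y a - S a) *: (root_poly (nodes_in S a.+1 b) * root_poly (nodes_in om t (t + n))).
have [|_ <-] := @contour_int_in0 _ _ C_gt0 p _ _ h1.
  rewrite /p (leq_ltn_trans (size_scale_leq _ _)) // (leq_ltn_trans (size_polyMleq _ _)) //.
  by rewrite size_cat !size_root_poly !size_nodes_in; lia.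
apply: eq_contour_int => // z zC.
rewrite /hop_density dual_valE // /phi_val /tau_val prodf_div /p.
rewrite hornerZ root_poly_cat !hornerM !root_poly_nodes.
rewrite (@big_cat_nat _ _ _ a.+1 1 b) //=.
rewrite (@big_cat_nat _ _ _ a 1 b.+1) //=; last by rewrite ltnW // ltnW.
have := prod_y_neq0 a zC (leqnn 1); have := prod_y_neq0 b.+1 zC a1.
have := prod_S_neq0 a.+1 zC (leqnn 1); have := prod_w_neq0 t (t + n) zC.
move: (\prod_(1 <= i < a) _) (\prod_(a <= i < b.+1) _) (\prod_(1 <= i < a.+1) _)
  (\prod_(_ <= i < _) (z - w _)).
move=> P1 P2 P3 P4 n4 n3 n2 n1.
by field; rewrite n1 n2 n3 n4.
Qed.

(** Now the poles at the [y_p] cancel, and with no rows none is left inside. *)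
Lemma hop_density_lt b a t : (1 <= b)%N -> (b < a)%N ->
  contour_int C (hop_density b a t 0) = 0.
Proof.
move=> b1 ba; have a1 : (1 <= a)%N by exact: leq_ltn_trans ba.
have h2 : forall c, c \in nodes_in S b a.+1 -> outside C c.
  by apply: nodes_inP => p ip; apply: S_out; exact: leq_trans ip.
have [_ <-] := contour_int_out C_gt0 ((y a - S a) *: root_poly (nodes_in y b.+1 a)) h2.
apply: eq_contour_int => // z zC.
rewrite /hop_density dual_valE // /phi_val tau_val0 mulr1.
rewrite hornerZ !root_poly_nodes.
rewrite (@big_cat_nat _ _ _ b.+1 1 a) //=.
rewrite (@big_cat_nat _ _ _ b 1 a.+1) //=; last by rewrite ltnW // ltnW.
have := prod_y_neq0 b.+1 zC (leqnn 1).
have := prod_S_neq0 b zC (leqnn 1); have := prod_S_neq0 a.+1 zC b1.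
move: (\prod_(1 <= i < b) _) (\prod_(b <= i < a.+1) _) (\prod_(1 <= i < b.+1) _).
move=> P1 P2 P3 n3 n2 n1.
by field; rewrite n1 n2 n3.
Qed.

Lemma hop_density_diag a t : (1 <= a)%N -> contour_int C (hop_density a a t 0) = 1.
Proof.
move=> a1.
have h1 : forall c, c \in [:: y a] -> inside C c by move=> c; rewrite inE => /eqP ->; exact: y_in.
have h2 : forall c, c \in [:: S a] -> outside C c by move=> c; rewrite inE => /eqP ->; exact: S_out.
have [||_ e] := @contour_int_split _ _ C_gt0 (y a - S a)%:P _ _ 1 (-1) h1 h2.
- by rewrite size_poly1.
- by rewrite /root_poly !big_seq1 mul1r mulN1r polyCB; ring.
rewrite coef1 /= in e; apply: etrans e; apply: eq_contour_int => // z zC.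
rewrite /hop_density dual_valE // /phi_val tau_val0 mulr1.
rewrite /root_poly !big_seq1 !hornerXsubC hornerC.
have rec f : \prod_(1 <= j < a.+1) (z - f j) = (\prod_(1 <= j < a) (z - f j)) * (z - f a).
  by rewrite big_nat_recr.
rewrite !rec.
have := prod_y_neq0 a zC (leqnn 1); have := prod_S_neq0 a zC (leqnn 1).
have := inside_neq (y_in a1) zC; have := outside_neq (S_out a1) zC.
rewrite -!(subr_eq0 z) => n1 n2 n3 n4.
by field; rewrite n1 n2 n3 n4.
Qed.

(** Induction on [n], with the sum cut at column [a], which no path to [a] crosses. Against
    [dual_val] at [a], the remainder of [hop_transfer] has only poles inside and decays
    quadratically, so it integrates to 0. *)
Lemma hopsE n t b a : (1 <= a)%N -> (1 <= b)%N ->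
  contour_int C (hop_density b a t n) = hops y S w om t n b a.
Proof.
move=> a1; elim: n t b => [|n IH] t b b1.
  have [ba|ab|->] := ltngtP b a.
  - by rewrite hop_density_lt //= ltn_eqF.
  - by rewrite hop_density_gt //= gtn_eqF.
  - by rewrite hop_density_diag //= eqxx.
have [ab|ba] := ltnP a b; first by rewrite hop_density_gt // hops_gt.
rewrite /=.
set k := (om t - w t) / (S b - w t) * (\prod_(b.+1 <= j < a.+1) ((y j - w t) / (S j - w t))).
have h1 : forall c, c \in y a :: nodes_in w t (t + n.+1) -> inside C c.
  move=> c; rewrite inE => /orP[/eqP ->|]; first exact: y_in.
  by move: c; apply: nodes_inP => p ip; exact: w_in.
set p := (k * (y a - S a)) *: root_poly (nodes_in om t.+1 (t + n.+1)).
have [|r1 i1] := @contour_int_in0 _ _ C_gt0 p _ _ h1.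
  rewrite /p (leq_ltn_trans (size_scale_leq _ _)) //=.
  by rewrite !size_root_poly !size_nodes_in; lia.
have rc c : c \in index_iota b a.+1 -> regular C
    (fun z => hop_at y S w om t b c * hop_density c a t.+1 n z).
  move=> _; apply: (@regularM _ C); first exact: regular_cst.
  exact: regular_hop_density.
have [r2 i2] := contour_int_sum rc.
transitivity (contour_int C (fun z => \sum_(b <= c < a.+1)
    hop_at y S w om t b c * hop_density c a t.+1 n z
    + p.[z] / (root_poly (y a :: nodes_in w t (t + n.+1))).[z])).
  apply: eq_contour_int => // z zC.
  have zy q : (1 <= q)%N -> z != y q by move=> q1; exact: inside_neq (y_in q1) zC.
  have zS q : (1 <= q)%N -> z != S q by move=> q1; exact: outside_neq (S_out q1) zC.
  have zw d : z != w d by exact: inside_neq (w_in d) zC.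
  have Sw q : (1 <= q)%N -> S q != w t.
    by move=> q1; rewrite eq_sym; exact: inside_outside_neq (w_in t) (S_out q1).
  have e := hop_transfer om zy zS b1 ba (zw t) Sw.
  rewrite -/k in e.
  have tauS : tau_val w om t n.+1 z = (z - om t) / (z - w t) * tau_val w om t.+1 n z.
    by rewrite /tau_val big_ltn ?addSnnS // -addSnnS leq_addr.
  have -> : \sum_(b <= c < a.+1) hop_at y S w om t b c * hop_density c a t.+1 n z =
     (\sum_(b <= c < a.+1) hop_at y S w om t b c * phi_val y S c z) *
     (dual_val y S a z * tau_val w om t.+1 n z).
    by rewrite big_distrl; apply: eq_bigr => c _; rewrite /hop_density /= !mulrA.
  rewrite e mulrBl.
  have -> : p.[z] / (root_poly (y a :: nodes_in w t (t + n.+1))).[z] =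
     k / (z - w t) * (vac_val y S a z * dual_val y S a z) * tau_val w om t.+1 n z.
    rewrite vac_dual // /root_poly big_cons hornerM hornerXsubC -/(root_poly _) root_poly_nodes.
    rewrite /p hornerZ root_poly_nodes /tau_val addSnnS prodf_div.
    have -> : \prod_(t <= j < t + n.+1) (z - w j) =
        (z - w t) * \prod_(t.+1 <= j < t + n.+1) (z - w j).
      by rewrite big_ltn // addnS ltnS leq_addr.
    have := prod_w_neq0 t.+1 (t + n.+1) zC.
    have := zy _ a1; have := zw t; rewrite -!(subr_eq0 z) => n1 n2 n3.
    move: (\prod_(_ <= _ < _) (z - w _)) (\prod_(_ <= _ < _) (z - om _)) n3 => P1 P2 n3.
    by field; rewrite n1 n2 n3.
  by rewrite /hop_density tauS; ring.
rewrite contour_intD // i1 addr0 i2; apply: eq_big_nat => c /andP[bc _].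
rewrite contour_intZ; last exact: regular_hop_density.
by rewrite IH // (leq_trans b1).
Qed.

End ContourHops.

(** * The inverse matrix as a polynomial identity *)

Section NewtonDivisibility.
Variables (R : fieldType) (n : nat).
Local Notation N := n.+1.
Implicit Types (x : 'I_N -> R) (h g : {poly R}).

Lemma newton_row_inj x h : (size h <= N)%N -> newton_row x h = 0 -> h = 0.
Proof.
move=> sh; rewrite newton_row_coef // => h0.
set V := \matrix_(k < N) newton_row x 'X^k in h0.
have uV : V \in unitmx.
  have sX (i : 'I_N) : (size ('X^i : {poly R}) <= N)%N by rewrite size_polyXn.
  rewrite unitmxE (det_newton_row_coef x sX).
  rewrite (_ : \matrix_i _ = 1%:M) ?det1 ?unitr1 //.
  by apply/matrixP => i j; rewrite !mxE coefXn eq_sym.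
have : poly_rV h *m V *m invmx V = (0 : 'rV_N) by rewrite h0 mul0mx.
rewrite mulmxK // => /rowP hp; apply/polyP => i; rewrite coef0.
have [iN|iN] := ltnP i N; last by rewrite nth_default // (leq_trans sh).
by have := hp (Ordinal iN); rewrite !mxE.
Qed.

Lemma newton_row_dvd x h : newton_row x h = 0 -> exists q, h = q * newton_poly x N.
Proof.
move=> h0; exists (h %/ newton_poly x N).
have sN : size (newton_poly x N) = N.+1 by rewrite size_newton_poly.
have d := divp_eq h (newton_poly x N).
rewrite {1}d [X in _ + X](_ : _ = 0) ?addr0 //; apply: (@newton_row_inj x).
  by rewrite -ltnS -sN ltn_modp -size_poly_eq0 sN.
have : newton_row x (h %/ newton_poly x N * newton_poly x N + h %% newton_poly x N) = 0.
  by rewrite -d.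
by rewrite newton_rowD newton_rowM hJ_annihil mulmx0 add0r.
Qed.

Lemma newton_row_cancel x h g : nonvanishing x g -> newton_row x (h * g) = 0 -> newton_row x h = 0.
Proof.
move=> gn; rewrite newton_rowM => e.
by rewrite -(mulmxK (hJ_unit gn) (newton_row x h)) e mul0mx.
Qed.

Lemma newton_frac_inv x p q p' q' : nonvanishing x q -> nonvanishing x q' ->
  newton_frac x p q = newton_frac x p' q' -> newton_row x (p * q') = newton_row x (p' * q).
Proof.
move=> gq gq' e; have g1 := nonvanishing1 x.
have h a b c : nonvanishing x b ->
    newton_frac x a b *m horner_mx (jordan x) (b * c) = newton_row x (a * c).
  move=> gb; rewrite newton_fracMr // -newton_frac1; apply: newton_frac_eq => //.
  by rewrite mulr1 mulrA mulrAC.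
by rewrite -(h p q q') // e [in LHS]mulrC h.
Qed.

End NewtonDivisibility.

Section EventRelation.
Variables (R : realType) (n m T : nat).
Local Notation N := n.+1.
Variables (x : 'I_N -> R) (w th : nat -> R) (y s : nat -> R).
Local Notation S := (colS y s).
Let om t := th t ^- 2 * w t.
Hypothesis yx : forall p k, (1 <= p)%N -> y p != x k.
Hypothesis xw : forall k t, x k < w t.
Hypothesis xom : forall k t, x k != om t.
Variables (pt pa : 'I_m -> nat).
Hypothesis pt_lt : forall k, (pt k < T)%N.
Hypothesis pa_gt0 : forall k, (1 <= pa k)%N.
Hypothesis uQ : init_mx T x w th y s \in unitmx.

Definition event_coef (k : 'I_m) (i : 'I_N) : R :=
  (event_mx T x w th y s pt pa *m invmx (init_mx T x w th y s)) k i.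

Definition event_poly (k : 'I_m) : {poly R} :=
  \sum_(i < N) event_coef k i *:
    (colN S (N - i).-1 * \prod_((N - i).+1 <= j < N.+1) ('X - (y j)%:P)).

Lemma size_event_poly k : (size (event_poly k) <= N)%N.
Proof.
apply: (leq_trans (size_sum _ _ _)); apply/bigmax_leqP => i _.
apply: (leq_trans (size_scale_leq _ _)); apply: (leq_trans (size_polyMleq _ _)).
rewrite size_colN size_prod_XsubC size_iota.
by have := ltn_ord i; lia.
Qed.

(** By the choice of the coefficients, the left side and the first term on the right have equal
    divided differences, once denominators are cleared and the common factor of the rows after the
    point is cancelled. They thus differ by a multiple of [prod_k (X - x_k)]. After division this is
    the partial fraction of the [u]-integrand, and the bound on [size q] makes the [q] part
    proper. *)
Lemma event_relation k : exists q : {poly R},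
  (size q <= pa k + (pt k).+1)%N /\
  colD y N * (colN S (pa k).-1 * \prod_(0 <= d < (pt k).+1) ('X - (w d)%:P)) =
  event_poly k * (colD y (pa k) * \prod_(0 <= d < (pt k).+1) ('X - (om d)%:P)) +
  q * newton_poly x N.
Proof.
set t := (pt k).+1; set a := pa k; have a1 : (1 <= a)%N by exact: pa_gt0.
have tT : (t <= T)%N by exact: pt_lt.
have gD b : nonvanishing x (colD y b).
  by apply: nonvanishing_colD => p j p1; rewrite eq_sym yx.
have gt t0 := nonvanishing_tau_den T xw t0.
have gn t0 : nonvanishing x (tau_num T w th t0).
  by apply: nonvanishing_prod => d _; apply: nonvanishingXsubC => j; exact: xom.
have ev : newton_frac x (tau_num T w th 0 * event_poly k) (colD y N * tau_den T w 0) =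
    newton_frac x (tau_num T w th t * colN S a.-1) (colD y a * tau_den T w t).
  have -> : newton_frac x (tau_num T w th t * colN S a.-1) (colD y a * tau_den T w t) =
     row k (event_mx T x w th y s pt pa *m invmx (init_mx T x w th y s) *m init_mx T x w th y s).
    by rewrite mulmxKV // rowK.
  rewrite row_mul mulmx_sum_row /event_poly mulr_sumr.
  have fsum (I : finType) (f : I -> {poly R}) d :
      newton_frac x (\sum_i f i) d = \sum_i newton_frac x (f i) d.
    apply: (big_morph (fun p => newton_frac x p d)) => [p p'|]; first exact: newton_fracD.
    by rewrite -(scale0r (0 : {poly R})) newton_fracZ scale0r.
  rewrite fsum; apply: eq_bigr => i _.
  rewrite -scalerAr newton_fracZ /event_coef [in RHS]mxE rowK /phi_at; congr (_ *: _).
  apply: newton_frac_eq; [exact: nonvanishingM|exact: nonvanishingM|].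
  have -> : colD y N = colD y (N - i) * \prod_((N - i).+1 <= j < N.+1) ('X - (y j)%:P).
    by rewrite /colD -big_cat_nat // ltnS leq_subr.
  by ring.
have := newton_frac_inv (nonvanishingM (gD N) (gt 0%N)) (nonvanishingM (gD a) (gt t)) ev.
have sn : tau_num T w th 0 = \prod_(0 <= d < t) ('X - (om d)%:P) * tau_num T w th t.
  by rewrite /tau_num -big_cat_nat.
have sd : tau_den T w 0 = \prod_(0 <= d < t) ('X - (w d)%:P) * tau_den T w t.
  by rewrite /tau_den -big_cat_nat.
rewrite sn sd; set oms := \prod_(_ <= _ < _) _; set ws := \prod_(_ <= _ < _) _ => e.
have : newton_row x ((colD y N * (colN S a.-1 * ws) + -1 *: (event_poly k * (colD y a * oms))) *
   (tau_num T w th t * tau_den T w t)) = 0.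
  rewrite mulrDl newton_rowD -scalerAl newton_rowZ scaleN1r; apply/eqP; rewrite subr_eq0; apply/eqP.
  apply: etrans (etrans (esym e) _); congr (newton_row x _); ring.
move=> /(newton_row_cancel (nonvanishingM (gn t) (gt t))) /newton_row_dvd[q qE].
exists q; have qE' : colD y N * (colN S a.-1 * ws) = event_poly k * (colD y a * oms) + q * newton_poly x N.
  by rewrite -qE scaleN1r addrC subrK.
split=> //.
have sz : (size (q * newton_poly x N)%R <= N + a + t)%N.
  rewrite -qE (leq_trans (size_polyD _ _)) // geq_max; apply/andP; split.
    apply: (leq_trans (size_polyMleq _ _)); rewrite size_prod_XsubC size_iota.
    have := size_polyMleq (colN S a.-1) ws; rewrite size_colN size_prod_XsubC size_iota.
    by rewrite !subSS !subn0; lia.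
  apply: (leq_trans (size_scale_leq _ _)); apply: (leq_trans (size_polyMleq _ _)).
  have := size_polyMleq (colD y a) oms; have := size_event_poly k.
  rewrite !size_prod_XsubC !size_iota !subSS !subn0.
  by move: (size (event_poly k)) (size (colD y a * oms)%R) => A B; clear; lia.
have [->|q0] := eqVneq q 0; first by rewrite size_poly0.
move: sz; rewrite size_Mmonic ?monic_newton_poly // size_newton_poly //.
by move: (size q) => B; clear; lia.
Qed.

End EventRelation.

Section KernelIdentity.
Variables (R : realType) (n m T : nat).
Local Notation N := n.+1.
Variables (x : 'I_N -> R) (w0 th0 : 'I_T.+1 -> R) (y s : nat -> R).
Let w (d : nat) : R := w0 (inord d).
Let th (d : nat) : R := th0 (inord d).
Local Notation S := (colS y s).
Let om t := th t ^- 2 * w t.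
Hypothesis yx : forall p k, (1 <= p)%N -> y p != x k.
Hypothesis xw : forall k t, x k < w t.
Hypothesis xom : forall k t, x k != om t.
Variables (pt pa : 'I_m -> nat).
Hypothesis pt_lt : forall k, (pt k < T.+1)%N.
Hypothesis pa_gt0 : forall k, (1 <= pa k)%N.
Hypothesis uQ : init_mx T.+1 x w th y s \in unitmx.

Local Notation normc := ComplexField.Normc.normc.
Local Notation P := root_poly.
Let cy p : R[i] := (y p)%:C.
Let cS p : R[i] := (S p)%:C.
Let cw p : R[i] := (w p)%:C.
Let com p : R[i] := (om p)%:C.
Local Notation iota_poly := (map_poly (real_complex R)).

Lemma map_prod_XsubC (f : nat -> R) i j v :
  (iota_poly (\prod_(i <= k < j) ('X - (f k)%:P))).[v] = \prod_(i <= k < j) (v - (f k)%:C).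
Proof.
rewrite rmorph_prod horner_prod; apply: eq_bigr => k _.
by rewrite rmorphB /= map_polyX map_polyC hornerXsubC.
Qed.

Let sx : seq R[i] := [seq (x k)%:C | k <- enum 'I_N].

Let sxE v : (P sx).[v] = \prod_(k < N) (v - (x k)%:C).
Proof.
rewrite /root_poly big_map horner_prod big_enum; apply: eq_bigr => k _.
by rewrite hornerXsubC.
Qed.

Let newton_polyC v : (iota_poly (newton_poly x N)).[v] = (P sx).[v].
Proof.
rewrite sxE /newton_poly rmorph_prod horner_prod.
apply: eq_big => k; first by rewrite ltn_ord.
by move=> _; rewrite rmorphB /= map_polyX map_polyC hornerXsubC.
Qed.

Lemma prod_ord_le (f : nat -> R[i]) (t : 'I_T.+1) :
  \prod_(d < T.+1 | (d <= t)%N) f d = \prod_(0 <= d < t.+1) f d.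
Proof. by rewrite big_mkord (big_ord_widen _ f (ltn_ord t)). Qed.

Lemma event_polyE (k : 'I_m) v :
  (forall p, (1 <= p)%N -> v != cy p) ->
  (iota_poly (event_poly T.+1 x w th y s pt pa k)).[v] / \prod_(1 <= j < N.+1) (v - cy j) =
  \sum_(i < N) (event_coef T.+1 x w th y s pt pa k i)%:C * phi_val cy cS (N - i) v.
Proof.
move=> vy; rewrite /event_poly rmorph_sum horner_sum mulr_suml; apply: eq_bigr => i _.
rewrite -mul_polyC !rmorphM /= map_polyC !hornerM hornerC !map_prod_XsubC -mulrA; congr (_ * _).
have iN := ltn_ord i.
rewrite prednK ?subn_gt0 // /phi_val.
rewrite (@big_cat_nat _ _ _ (N - i).+1 1 N.+1) //=; last by rewrite ltnS leq_subr.
have n1 : \prod_((N - i).+1 <= j < N.+1) (v - cy j) != 0.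
  rewrite prodf_seq_neq0; apply/allP => j; rewrite mem_index_iota => /andP[ij _].
  by rewrite subr_eq0 vy //; exact: leq_ltn_trans ij.
by rewrite -mulf_div divff // mulr1.
Qed.

Lemma normc_ltE (z : R[i]) r : (`|z| < r%:C) = (normc z < r).
Proof. by rewrite normc_def ltcR; case: z. Qed.

Lemma normc_gtE (z : R[i]) r : (r%:C < `|z|) = (r < normc z).
Proof. by rewrite normc_def ltcR; case: z. Qed.

Section Contours.
Variables (k k' : 'I_m) (t t' : 'I_T.+1) (Cu Cv : circle R).
Hypotheses (tE : t = pt k' :> nat) (t'E : t' = pt k :> nat).
Hypothesis contours : ascFG_contours x w0 th0 y s t t' Cu Cv.
Let a := pa k'.
Let a' := pa k.
Let a1 : (1 <= a)%N := pa_gt0 k'.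
Let a'1 : (1 <= a')%N := pa_gt0 k.

Let yu p : (1 <= p)%N -> inside Cu (cy p).
Proof. by have [[h _ _] _] := contours => /h; rewrite /encircles normc_ltE. Qed.
Let omu d : inside Cu (com d).
Proof. by have [[_ h _] _] := contours; have := h (inord d); rewrite /encircles normc_ltE. Qed.
Let xu j : outside Cu (x j)%:C.
Proof. by have [[_ _ h] _] := contours; have := h j; rewrite /leaves_out normc_gtE. Qed.
Let yv p : (1 <= p)%N -> inside Cv (cy p).
Proof. by have [_ [[h _ _] _]] := contours => /h; rewrite /encircles normc_ltE. Qed.
Let wv d : inside Cv (cw d).
Proof. by have [_ [[_ h _] _]] := contours; have := h (inord d); rewrite /encircles normc_ltE. Qed.
Let Sv p : (1 <= p)%N -> outside Cv (cS p).
Proof. by have [_ [[_ _ h] _]] := contours => /h; rewrite /leaves_out normc_gtE. Qed.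

Let inside_gt0 (C : circle R) z : inside C z -> 0 < cradius C.
Proof. by move=> zC; apply: le_lt_trans zC; exact: normc_ge0. Qed.
Let Cu0 : 0 < cradius Cu := inside_gt0 (yu (leqnn 1)).
Let Cv0 : 0 < cradius Cv := inside_gt0 (yv (leqnn 1)).

Let s1 := nodes_in cy 1 N.+1 ++ nodes_in cw 0 t.+1.
Let s2 := nodes_in cS 1 a.+1.
Let sd := nodes_in cy 1 a'.+1 ++ nodes_in com 0 t'.+1.
Let nn : {poly R[i]} := (cy a - cS a) *: (P (nodes_in cy 1 a) * P (nodes_in com 0 t.+1)).

Let sx_out z : z \in sx -> outside Cu z.
Proof. by move=> /mapP[j _ ->]. Qed.
Let s1_in z : z \in s1 -> inside Cv z.
Proof. by rewrite mem_cat => /orP[]; move: z; apply: nodes_inP => p ip; [exact: yv|exact: wv]. Qed.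
Let s2_out z : z \in s2 -> outside Cv z.
Proof. by move: z; apply: nodes_inP. Qed.
Let sd_in z : z \in sd -> inside Cu z.
Proof. by rewrite mem_cat => /orP[]; move: z; apply: nodes_inP => p ip; [exact: yu|exact: omu]. Qed.

Let Q := iota_poly (event_poly T.+1 x w th y s pt pa k).

Let relation : exists q : {poly R[i]}, (size q <= size sd)%N /\ forall u,
  \prod_(1 <= j < N.+1) (u - cy j) *
    ((\prod_(1 <= j < a') (u - cS j)) * \prod_(0 <= d < t'.+1) (u - cw d)) =
  Q.[u] * (P sd).[u] + q.[u] * (P sx).[u].
Proof.
have [q [sq qE]] := event_relation yx xw xom pt_lt pa_gt0 uQ k.
exists (iota_poly q); split.
  by rewrite size_map_poly size_cat !size_nodes_in subSS !subn0 t'E.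
move=> u; have := congr1 (fun p => (iota_poly p).[u]) qE.
rewrite !(rmorphD, rmorphM) /= !hornerE /= newton_polyC /colD /colN !map_prod_XsubC.
by rewrite prednK // root_poly_cat hornerM !root_poly_nodes t'E [Q.[u] * _]mulrA.
Qed.

Let integrandE q u v : (forall u,
  \prod_(1 <= j < N.+1) (u - cy j) *
    ((\prod_(1 <= j < a') (u - cS j)) * \prod_(0 <= d < t'.+1) (u - cw d)) =
  Q.[u] * (P sd).[u] + q.[u] * (P sx).[u]) ->
  on_circle Cu u -> on_circle Cv v ->
  ascFG_integrand x w0 th0 y s t a t' a' u v =
  (u - v)^-1 * ((P sx).[v] * nn.[v] / ((P s1).[v] * (P s2).[v])) *
    (Q.[u] / (P sx).[u] + q.[u] / (P sd).[u]).
Proof.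
move=> qE uC vC.
have nx := on_notin (or_intror sx_out) uC; have nd := on_notin (or_introl sd_in) uC.
have -> : Q.[u] / (P sx).[u] + q.[u] / (P sd).[u] =
    (Q.[u] * (P sd).[u] + q.[u] * (P sx).[u]) / ((P sx).[u] * (P sd).[u]).
  by field; rewrite nx nd.
rewrite -qE /ascFG_integrand.
have ew z (g : 'I_T.+1 -> R) (t0 : 'I_T.+1) (g' : nat -> R) : (forall d : 'I_T.+1, g d = g' d) ->
    \prod_(d < T.+1 | (d <= t0)%N) (z - (g d)%:C) = \prod_(0 <= d < t0.+1) (z - (g' d)%:C).
  by move=> gg; rewrite -prod_ord_le; apply: eq_bigr => d _; rewrite gg.
have w0E (d : 'I_T.+1) : w0 d = w d by rewrite /w inord_val.
have om0E (d : 'I_T.+1) : th0 d ^- 2 * w0 d = om d by rewrite /om /th /w inord_val.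
rewrite !prodf_div !big_split /= !(ew _ _ _ _ w0E) !(ew _ (fun d => th0 d ^- 2 * w0 d) _ _ om0E).
have ey z : \prod_(i < N) (z - (y i.+1)%:C) = \prod_(1 <= j < N.+1) (z - cy j).
  by rewrite big_add1 big_mkord.
rewrite !ey -!sxE.
have -> : (y a * (1 - s a ^- 2))%:C = cy a - cS a.
  by rewrite -rmorphB /=; congr (_ %:C); rewrite /colS; ring.
rewrite hornerZ !root_poly_cat !hornerM !root_poly_nodes.
have rec z (f : nat -> R[i]) b : (1 <= b)%N ->
    \prod_(1 <= j < b.+1) (z - f j) = (\prod_(1 <= j < b) (z - f j)) * (z - f b).
  by move=> b1; rewrite big_nat_recr.
rewrite (rec u cy a') // (rec v cS a) //.
have fS z b : \prod_(1 <= j < b) (z - (s j ^- 2 * y j)%:C) = \prod_(1 <= j < b) (z - cS j) by [].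
have fy z b : \prod_(1 <= j < b) (z - (y j)%:C) = \prod_(1 <= j < b) (z - cy j) by [].
have fw z b : \prod_(0 <= j < b) (z - (w j)%:C) = \prod_(0 <= j < b) (z - cw j) by [].
have fo z b : \prod_(0 <= j < b) (z - (om j)%:C) = \prod_(0 <= j < b) (z - com j) by [].
rewrite !fS !fy !fw !fo (_ : (s a ^- 2 * y a)%:C = cS a) // (_ : (y a')%:C = cy a') // !invfM.
move: (u - v)^-1 (v - cS a)^-1 (u - cy a')^-1 => i1 i2 i3.
by ring.
Qed.

Let prodS v i j : on_circle Cv v -> (1 <= i)%N -> \prod_(i <= l < j) (v - cS l) != 0.
Proof.
move=> vC i1; rewrite prodf_seq_neq0; apply/allP => l; rewrite mem_index_iota => /andP[il _].
by rewrite subr_eq0; apply: outside_neq vC; apply: Sv; exact: leq_trans il.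
Qed.
Let prody v i j : on_circle Cv v -> (1 <= i)%N -> \prod_(i <= l < j) (v - cy l) != 0.
Proof.
move=> vC i1; rewrite prodf_seq_neq0; apply/allP => l; rewrite mem_index_iota => /andP[il _].
by rewrite subr_eq0; apply: inside_neq vC; apply: yv; exact: leq_trans il.
Qed.
Let prodw v i j : on_circle Cv v -> \prod_(i <= l < j) (v - cw l) != 0.
Proof.
move=> vC; rewrite prodf_seq_neq0; apply/allP => l _.
by rewrite subr_eq0; apply: inside_neq vC; exact: wv.
Qed.

Let c (i : 'I_N) : R := event_coef T.+1 x w th y s pt pa k i.

Let event_int : regular Cv (fun v => Q.[v] * nn.[v] / ((P s1).[v] * (P s2).[v])) /\
  contour_int Cv (fun v => Q.[v] * nn.[v] / ((P s1).[v] * (P s2).[v])) =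
  (\sum_(i < N) c i * hops_at w th y s 0 t.+1 (N - i) a)%:C.
Proof.
have rd b := regular_hop_density com Cv0 yv Sv wv b 0 t.+1 a1.
have [|r1 i1] := @contour_int_sum R Cv Cv0 _ (index_enum 'I_N)
    (fun (i : 'I_N) v => (c i)%:C * hop_density cy cS cw com (N - i) a 0 t.+1 v).
  by move=> i _; apply: (@regularM _ Cv); [exact: regular_cst|exact: rd].
have E v : on_circle Cv v -> \sum_(i < N) (c i)%:C * hop_density cy cS cw com (N - i) a 0 t.+1 v =
    Q.[v] * nn.[v] / ((P s1).[v] * (P s2).[v]).
  move=> vC; transitivity ((\sum_(i < N) (c i)%:C * phi_val cy cS (N - i) v) *
      (dual_val cy cS a v * tau_val cw com 0 t.+1 v)).
    by rewrite mulr_suml; apply: eq_bigr => i _; rewrite /hop_density !mulrA.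
  rewrite -event_polyE => [|p p1]; last by apply: inside_neq vC; exact: yv.
  rewrite dual_valE // /tau_val prodf_div add0n hornerZ !root_poly_cat !hornerM !root_poly_nodes.
  have := prodS a.+1 vC (leqnn 1); have := prody N.+1 vC (leqnn 1); have := prodw 0 t.+1 vC.
  move=> n1 n2 n3; by field; rewrite n1 n2 n3.
split; first exact: eq_regular E r1.
rewrite -(eq_contour_int Cv0 E) i1 rmorph_sum; apply: eq_bigr => i _ /=.
rewrite contour_intZ // rmorphM /=; congr (_ * _).
rewrite hopsE // ?subn_gt0 ?ltn_ord //.
exact: (esym (rmorph_hops (real_complex R) _ _ _ _ _ _ _ _)).
Qed.

Let nested_normc (C D : circle R) : circle_inside C D ->
  normc (ccenter C - ccenter D) + cradius C < cradius D.
Proof. by rewrite /circle_inside normc_def -rmorphD ltcR; case: (_ - _). Qed.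

(** The transposition appears here: [u], [t'] and [a'] belong to the row index [k] of
    [process_kernel], whereas [v], [t] and [a] belong to the column index [k']. *)
Lemma kernelE : ascFG_kernel x w0 th0 y s Cu Cv t a t' a' =
  (process_kernel T.+1 x w th y s pt pa k k')%:C.
Proof.
have [q [sq qE]] := relation.
have fE u v := @integrandE q u v qE.
have s1_gt0 : (0 < size s1)%N by rewrite size_cat !size_nodes_in subSS.
have [_ [_ nest]] := contours.
rewrite /ascFG_kernel [in RHS]mxE -t'E -tE -/a -/a'.
have -> : (\sum_(i < N) (event_mx T.+1 x w th y s pt pa *m invmx (init_mx T.+1 x w th y s)) k i *
    hops_at w th y s 0 t.+1 (N - i) a) = \sum_(i < N) c i * hops_at w th y s 0 t.+1 (N - i) a by [].
have [re ie] := event_int.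
case: (leqP t t') nest => tt nest.
  have [rf If] := double_contour_int_u_outer Cu0 Cv0 sx_out s1_in s2_out sd_in s1_gt0 sq fE
    (nested_normc nest).
  by rewrite circle_integral2 // If ie subr0.
have nest' := nested_normc nest.
have [rf If] := double_contour_int_v_outer Cu0 Cv0 sx_out s1_in s2_out sd_in s1_gt0 sq fE nest'.
rewrite circle_integral2 // If.
have rd := regular_hop_density com Cv0 yv Sv wv a' t'.+1 (t - t') a1.
have rn := regularM (regular_cst Cv (-1)) re.
(* For [t' < t] the relation replaces the [q] part by the full product minus the [Q] part. The
   former is the density of the transition weight from [a'] to [a] over the rows between the two
   times; the latter gives the same sum as in the first case. *)
rewrite (_ : contour_int Cv _ = contour_int Cv (fun v => hop_density cy cS cw com a' a t'.+1 (t - t') v +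
    -1 * (Q.[v] * nn.[v] / ((P s1).[v] * (P s2).[v])))).
  rewrite contour_intD // contour_intZ // ie hopsE // mulN1r opprB rmorphB /=; congr (_ - _).
  exact: (esym (rmorph_hops (real_complex R) _ _ _ _ _ _ _ _)).
apply: eq_contour_int => // v vC.
have -> : q.[v] * (P sx).[v] = \prod_(1 <= j < N.+1) (v - cy j) *
    ((\prod_(1 <= j < a') (v - cS j)) * \prod_(0 <= d < t'.+1) (v - cw d)) - Q.[v] * (P sd).[v].
  by rewrite qE addrC addKr.
rewrite /hop_density /phi_val dual_valE // /tau_val prodf_div addSn subnKC; last exact: ltnW.
have sp (g : nat -> R[i]) : \prod_(0 <= d < t.+1) (v - g d) =
    (\prod_(0 <= d < t'.+1) (v - g d)) * \prod_(t'.+1 <= d < t.+1) (v - g d).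
  by rewrite -big_cat_nat // ltnS ltnW.
rewrite hornerZ !root_poly_cat !hornerM !root_poly_nodes !sp.
have n0 : \prod_(0 <= l < t'.+1) (v - com l) != 0.
  rewrite prodf_seq_neq0; apply/allP => l _; rewrite subr_eq0.
  by apply: inside_neq vC; apply: (nested_in nest'); exact: omu.
have := prodS a.+1 vC (leqnn 1); have := prody N.+1 vC (leqnn 1); have := prody a'.+1 vC (leqnn 1).
have := prodw 0 t'.+1 vC; have := prodw t'.+1 t.+1 vC.
move=> n1 n2 n3 n4 n5; field.
by rewrite n0 n1 n2 n3 n4 n5.
Qed.

End Contours.

End KernelIdentity.

(** * From the bound on the supremum to the probability of an event *)

Section RatioBound.
Variable R : realType.

(** If [w <= x], numerator minus denominator is [(S - y) (x - w)], which is nonnegative, so the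
    ratio would be at least 1. *)
Lemma ratio_lt (S x y w : R) : x < y -> y < S -> w < y ->
  `|(S - x) / (y - x) * ((y - w) / (S - w))| < 1 -> x < w.
Proof.
move=> xy yS wy; rewrite ltNge => /negP h; rewrite ltNge; apply/negP => wx; apply: h.
have d1 : 0 < y - x by lra.
have d2 : 0 < S - w by lra.
rewrite mulf_div ger0_norm; last by rewrite divr_ge0 // mulr_ge0 //; lra.
rewrite ler_pdivlMr ?mulr_gt0 // mul1r -subr_ge0.
rewrite (_ : _ - _ = (S - y) * (x - w)); last by ring.
by rewrite mulr_ge0 //; lra.
Qed.

Lemma sup_ratio_bound (f : nat -> R) : (forall p, 0 <= f p) ->
  (ereal_sup [set (f p)%:E | p in [set p | (1 <= p)%N]] < 1)%E ->
  exists c, 0 <= c < 1 /\ forall p, (1 <= p)%N -> f p <= c.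
Proof.
move=> f0; set E := ereal_sup _ => E1.
have ub p : (1 <= p)%N -> ((f p)%:E <= E)%E.
  by move=> p1; apply: ereal_sup_ubound; exists p.
have E0 : (0 <= E)%E by apply: le_trans (ub 1%N isT); rewrite lee_fin.
have fE : E \is a fin_num by rewrite ge0_fin_numE // (lt_trans E1) // ltry.
exists (fine E); split.
  by rewrite fine_ge0 //= -lte_fin fineK.
by move=> p /ub; rewrite -{1}(fineK fE) lee_fin.
Qed.

End RatioBound.

Lemma bigmax_bound (R : realType) (n : nat) (c : 'I_n -> R) :
  (forall k, 0 <= c k < 1) -> exists q, 0 <= q < 1 /\ forall k, c k <= q.
Proof.
move=> h; exists (\big[Num.max/0]_k c k); split; last by move=> k; exact: le_bigmax.
apply/andP; split; first by apply: bigmax_ge_id.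
by apply/bigmax_ltP; split=> // k _; case/andP: (h k).
Qed.

Section EventProbability.
Variables (R : realType) (n m T : nat).
Local Notation N := n.+1.
Variables (x r : 'I_N -> R) (w th : nat -> R) (y s : nat -> R).
Variable A : 'I_m -> 'I_T * nat.
Local Notation S := (colS y s).
Hypothesis ineq_x : forall k p, (1 <= p)%N ->
  [/\ x k < y p, y p < r k ^- 2 * x k & r k ^- 2 * x k < S p].
Hypothesis ineq_w : forall t p, (1 <= p)%N ->
  [/\ w t < y p, y p < th t ^- 2 * w t & th t ^- 2 * w t < S p].
Hypothesis xw : forall k t, x k < w t.
Variable q : nat -> R.
Hypothesis q01 : forall t, 0 <= q t < 1.
Hypothesis ratio : forall k t p, (1 <= p)%N ->
  `|(S p - x k) / (y p - x k) * ((y p - w t) / (S p - w t))| <= q t.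
Hypothesis A_inj : injective A.

Let pt (k : 'I_m) : nat := (A k).1.
Let pa (k : 'I_m) : nat := (A k).2.

Let Z := ascFG_Z x r (fun j : 'I_T => w j) (fun j : 'I_T => th j) y s.

Let pt_lt k : (pt k < T)%N.
Proof. exact: ltn_ord. Qed.

Let pt_inj k k' : pt k = pt k' -> pa k = pa k' -> k = k'.
Proof.
move=> e1 e2; apply: A_inj; move: e1 e2; rewrite /pt /pa.
by case: (A k) (A k') => [a b] [a' b'] /= /val_inj -> ->.
Qed.

Let yx p k : (1 <= p)%N -> y p != x k.
Proof. by move=> p1; have [h _ _] := ineq_x k p1; rewrite gt_eqF. Qed.

Let Z_gt0 : 0 < Z.
Proof.
apply: ascFG_Z_gt0 => // [k p p1|k p p1|t p p1].
- by have [] := ineq_x k p1.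
- by have [] := ineq_x k p1.
- by have [] := ineq_w t p1.
Qed.

(** Invertibility is read off the normalization: [F_const] times the determinant is [Z], which is
    positive. *)
Lemma init_mx_unit : init_mx T x w th y s \in unitmx.
Proof.
rewrite unitmxE unitfE; apply/eqP => d0; move: Z_gt0.
by rewrite /Z -(F_const_det_init T r th s yx xw) d0 mulr0 ltxx.
Qed.

Lemma hitsE (l : T.-tuple (signature N)) :
  (l \in [set lam | range A `<=` ascFG_points lam]) = [forall t : 'I_T, hits pt pa t (tnth l t)].
Proof.
apply/idP/forallP => [|h]; rewrite inE /=.
  move=> h t; apply/forallP => k; apply/implyP => /eqP e.
  have := h (A k) (imageT A k); rewrite /ascFG_points /= => hk.
  by rewrite (_ : t = (A k).1) //; apply: val_inj; exact: esym e.
move=> _ [k _ <-]; rewrite /ascFG_points /=.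
by have := h (A k).1 => /forallP/(_ k)/implyP/(_ (eqxx _)).
Qed.

Lemma event_probability :
  ascFG_prob x r (fun j : 'I_T => w j) (fun j : 'I_T => th j) y s
    [set lam | range A `<=` ascFG_points lam] =
  (\det (process_kernel T x w th y s pt pa))%:E.
Proof.
rewrite /ascFG_prob esum_mkcond.
pose step t (mu lam : signature N) : R :=
  FG_G lam mu (fun _ : 'I_1 => w t) y (fun _ => th t) s * (hits pt pa t lam)%:R.
pose a (l : T.-tuple (signature N)) : R :=
  \prod_(t < T) step t (nth (sig0 N) (sig0 N :: l) t) (tnth l t) * FG_F (last (sig0 N) l) x y r s.
(* The event becomes one indicator per time step, the form in which [esum_process] sums. *)
have aE l : (if l \in [set lam | range A `<=` ascFG_points lam] then
    (ascFG x r (fun j : 'I_T => w j) (fun j : 'I_T => th j) y s l)%:E else 0%E) = (Z^-1 * a l)%:E.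
  rewrite hitsE /a /step big_split /=; case: forallP => [h|/forallP].
    rewrite [X in _ * X * _](_ : _ = 1) ?mulr1 /ascFG ?mulrA //.
    by apply: big1 => t _; rewrite h.
  rewrite negb_forall => /existsP[t /negPf ht].
  have -> : \prod_(t < T) (hits pt pa t (tnth l t))%:R = 0 :> R.
    by apply/eqP; rewrite prodf_seq_eq0; apply/hasP; exists t; rewrite ?mem_index_enum ?ht ?eqxx.
  by rewrite mulr0 mul0r mulr0.
under eq_esum do rewrite aE.
have a0 l : 0 <= a l.
  rewrite mulr_ge0 //; last exact: (FG_F_ge0 ineq_x).
  by apply: prodr_ge0 => t _; rewrite mulr_ge0 ?ler0n // FG_G_ge0 // => p p1; exact: ineq_w.
rewrite (esumZ _ a0 (esum_process ineq_x ineq_w xw q01 ratio pt_lt pt_inj)); last first.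
  by rewrite invr_ge0 ltW.
rewrite ext_det0 //; last exact: init_mx_unit.
by rewrite [F_const x r * _]mulrA F_const_det_init // -/Z mulKf // gt_eqF.
Qed.

End EventProbability.

Theorem theorem1p8 (R : realType) (N T : nat)
    (x r : 'I_N -> R) (w theta : 'I_T -> R) (y s : nat -> R)
    (N_ge1 : (1 <= N)%N) (T_ge1 : (1 <= T)%N)
    (r_neq0 : forall i, r i != 0) (theta_neq0 : forall j, theta j != 0)
    (s_neq0 : forall p, (1 <= p)%N -> s p != 0)
    (sup_lt1 : forall i j,
       (ereal_sup [set `|(s p ^- 2 * y p - x i) / (y p - x i) *
                         ((y p - w j) / (s p ^- 2 * y p - w j))|%:E
                   | p in [set p | (1 <= p)%N]] < 1)%E)
    (x_ineq : forall i p, (1 <= p)%N ->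
       [/\ x i < y p, y p < r i ^- 2 * x i & r i ^- 2 * x i < s p ^- 2 * y p])
    (w_ineq : forall j p, (1 <= p)%N ->
       [/\ w j < y p, y p < theta j ^- 2 * w j &
           theta j ^- 2 * w j < s p ^- 2 * y p])
    (Cu Cv : 'I_T -> 'I_T -> circle R)
    (contours : forall t t',
       ascFG_contours x w theta y s t t' (Cu t t') (Cv t t'))
    (m : nat) (A : 'I_m -> 'I_T * nat)
    (A_inj : injective A) (A_pos : forall i, (1 <= (A i).2)%N) :
  let P := ascFG_prob x r w theta y s [set lam | range A `<=` ascFG_points lam] in
  let K := fun p q : 'I_T * nat =>
    ascFG_kernel x w theta y s (Cu p.1 q.1) (Cv p.1 q.1) p.1 p.2 q.1 q.2 in
  P \is a fin_num /\ (fine P)%:C = \det (\matrix_(i < m, j < m) K (A i) (A j)).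
Proof.
clear r_neq0 theta_neq0 s_neq0.
case: N x r N_ge1 sup_lt1 x_ineq contours => // n x r _ sup_lt1 x_ineq contours.
case: T w theta A Cu Cv T_ge1 sup_lt1 w_ineq contours A_inj A_pos =>
  // T w theta A Cu Cv _ sup_lt1 w_ineq contours A_inj A_pos P K.
(* Past the last time the extended parameters repeat an existing value, so all inequalities
   persist. *)
pose wn d : R := w (inord d); pose thn d : R := theta (inord d).
have wE : w = (fun j : 'I_T.+1 => wn j) by apply/funext => j; rewrite /wn inord_val.
have thE : theta = (fun j : 'I_T.+1 => thn j) by apply/funext => j; rewrite /thn inord_val.
have /choice[c cP] : forall ij : 'I_n.+1 * 'I_T.+1, exists c, 0 <= c < 1 /\ forall p, (1 <= p)%N ->
    `|(colS y s p - x ij.1) / (y p - x ij.1) * ((y p - w ij.2) / (colS y s p - w ij.2))| <= c.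
  by move=> [i j]; apply: sup_ratio_bound.
have /choice[q qP] : forall t : nat, exists q, 0 <= q < 1 /\ forall k : 'I_n.+1, c (k, inord t) <= q.
  by move=> t; apply: bigmax_bound => k; have [] := cP (k, inord t).
have ineq_w t p (p1 : (1 <= p)%N) : [/\ wn t < y p, y p < thn t ^- 2 * wn t & thn t ^- 2 * wn t < colS y s p].
  exact: w_ineq.
have xw k t : x k < wn t.
  have [h1 h2 h3] := x_ineq k 1%N isT; have [h4 h5 h6] := ineq_w t 1%N isT.
  have [/andP[_ c1] hc] := cP (k, inord t).
  by apply: (ratio_lt h1 _ h4 (le_lt_trans (hc 1%N isT) c1)); rewrite /colS; lra.
have q01 t : 0 <= q t < 1 by have [] := qP t.
have ratio k t p : (1 <= p)%N ->
    `|(colS y s p - x k) / (y p - x k) * ((y p - wn t) / (colS y s p - wn t))| <= q t.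
  by move=> p1; have [_ /(_ p p1) h] := cP (k, inord t); apply: (le_trans h); case: (qP t).
have PE : P = (\det (process_kernel T.+1 x wn thn y s (fun k => (A k).1) (fun k => (A k).2)))%:E.
  by rewrite /P {1}wE {1}thE;
  exact: (@event_probability R n m T.+1 x r wn thn y s A x_ineq ineq_w xw q q01 ratio A_inj).
have yx p k : (1 <= p)%N -> y p != x k.
  by move=> p1; have [h _ _] := x_ineq k p p1; rewrite gt_eqF.
have xom k t : x k != thn t ^- 2 * wn t.
  have [h1 _ _] := x_ineq k 1%N isT; have [_ h2 _] := ineq_w t 1%N isT.
  by rewrite lt_eqF // (lt_trans h1).
have uQ : init_mx T.+1 x wn thn y s \in unitmx by exact: (init_mx_unit T.+1 x_ineq ineq_w xw).
(* The indices [i] and [j] are exchanged, which the determinant does not see. *)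
have KE i j : K (A i) (A j) =
    (process_kernel T.+1 x wn thn y s (fun k => (A k).1) (fun k => (A k).2) j i)%:C.
  apply: (@kernelE R n m T x w theta y s yx xw xom (fun k => (A k).1) (fun k => (A k).2)
    (fun k => ltn_ord (A k).1) A_pos uQ j i (A i).1 (A j).1) => //.
rewrite PE; split=> //; rewrite /= -[LHS]/(real_complex R _) -det_map_mx -det_tr; congr (\det _).
by apply/matrixP => i j; rewrite [LHS]mxE [LHS]mxE [RHS]mxE KE.
Qed.
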